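(* Let $\nu>0$ and $\eta>0$. Let $s\ge 0$ and $\sigma\ge 0$ satisfy $s+\sigma\ge 2$. Consider on $\mathbb R^2$ the linearized system $$ \begin{cases} \partial_{tt} u -( \eta \partial_{11} + \nu \partial_{22}) \partial_t u + \nu \eta \partial_{11} \partial_{22} u + \partial_{11}\Delta^{-1} u = 0,\\ \partial_{tt} \theta -( \eta \partial_{11} + \nu \partial_{22}) \partial_t \theta + \nu \eta \partial_{11} \partial_{22} \theta + \partial_{11}\Delta^{-1} \theta = 0, \\ u(x,0) =u_0(x), \quad \theta(x,0) = \theta_0(x), \end{cases} $$ with the initial time derivatives $$ (\partial_t u_1)(x,0) = \nu \partial_{22} u_{10}-\partial_1\partial_2\Delta^{-1}\theta_0,\quad (\partial_t u_2)(x,0) = \nu \partial_{22} u_{20}+\partial_{11}\Delta^{-1}\theta_0,\quad (\partial_t\theta)(x,0)=\eta\partial_{11}\theta_0-u_{20}, $$ where $u=(u_1,u_2)$ and $u_0=(u_{10},u_{20})$. Assume that $\nabla\cdot u_0 =0$ and $$ u_0 \in \mathring H^{0, -\sigma} \cap \mathring H^{s, -\sigma} \cap \mathring H^{s-2, -\sigma}, \qquad \theta_0 \in \mathring H^{0, -\sigma} \cap \mathring H^{s, -\sigma} \cap \mathring H^{s-1, -\sigma}. $$ Then there is a constant $C>0$ such that the corresponding solution $(u, \theta)$ satisfies, for all $t>0$, $$ \|u_1(t)\|_{\mathring H^s} \le C\, t^{-\frac12 (s+\sigma)}\, \|u_{10}\|_{\mathring H^{0, -\sigma}} + C\, t^{-\frac{\sigma}{2}}\,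 \|u_{10}\|_{\mathring H^{s, -\sigma}} + C\, t^{-\frac12 (s+\sigma) +1}\, \|\theta_0\|_{\mathring H^{0, -\sigma}} + C\,t^{-\frac12-\frac{\sigma}{2}}\, \|\theta_0\|_{\mathring H^{s-1, -\sigma}}, $$ $$ \|u_2(t)\|_{\mathring H^s} \le C\, t^{-\frac12 (s+\sigma)}\, \|u_{20}\|_{\mathring H^{0, -\sigma}} + C\, t^{-\frac{\sigma}{2}}\, \|u_{20}\|_{\mathring H^{s, -\sigma}} + C\, t^{-\frac12 (s+\sigma) +1}\, \|\theta_0\|_{\mathring H^{0, -\sigma}} + C\,t^{-1-\frac{\sigma}{2}}\, \|\theta_0\|_{\mathring H^{s, -\sigma}}, $$ $$ \|\theta(t)\|_{\mathring H^s} \le C\, t^{-\frac12 (s+\sigma) +1}\, \|u_{20}\|_{\mathring H^{0, -\sigma}} + C\,t^{-\frac{\sigma}{2}}\, \|u_{20}\|_{\mathring H^{s-2, -\sigma}} + C\, t^{-\frac12 (s+\sigma)}\, \|\theta_0\|_{\mathring H^{0, -\sigma}} + C\, t^{-\frac{\sigma}{2}}\, \|\theta_0\|_{\mathring H^{s, -\sigma}}. $$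
   Context: Here $\partial_i=\partial_{x_i}$, $\partial_{ii}=\partial_i\partial_i$, $\xi=(\xi_1,\xi_2)$, and $\widehat f$ denotes the Fourier transform. Operators involving $\Delta^{-1}$ are Fourier multipliers: $\partial_i\partial_j\Delta^{-1}$ has symbol $\xi_i\xi_j/|\xi|^2$. The prescribed initial time derivatives express that $(u,\theta)$ arises from the first-order linearized system $\partial_t u_1=\nu\partial_{22}u_1-\partial_1\partial_2\Delta^{-1}\theta$, $\partial_t u_2=\nu\partial_{22}u_2+\partial_{11}\Delta^{-1}\theta$, $\partial_t\theta=\eta\partial_{11}\theta-u_2$ with data $(u_0,\theta_0)$. For real $r$ and $\sigma\ge0$ and $i=1,2$, $\mathring H_i^{r,-\sigma}(\mathbb R^2)$ is the space of functions $f$ with $$\|f\|_{\mathring H_i^{r,-\sigma}}=\left(\int_{\mathbb R^2}|\xi|^{2r}|\xi_i|^{-2\sigma}|\widehat f(\xi)|^2\,d\xi\right)^{1/2}<\infty .$$ Also $\mathring H^{r,-\sigma}=\mathring H_1^{r,-\sigma}\cap\mathring H_2^{r,-\sigma}$, with norm $\|f\|_{\mathring H^{r,-\sigma}}=\|f\|_{\mathring H_1^{r,-\sigma}}+\|f\|_{\mathring H_2^{r,-\sigma}}$. The homogeneous Sobolev norm is $\|f\|_{\mathring H^s}=\||\xi|^s|\widehat f(\xi)|\|_{L^2(\mathbb R^2)}$. The constant $C$ is independent of $t$ and of the initial data. *)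

(* Defs.v *)
From mathcomp Require Import all_boot all_order all_algebra.
From mathcomp Require Import all_classical all_reals all_analysis.
From mathcomp Require Import complex.

Set Implicit Arguments.
Unset Strict Implicit.
Unset Printing Implicit Defensive.

Import Order.TTheory GRing.Theory Num.Theory.
Import numFieldNormedType.Exports.

Local Open Scope classical_set_scope.
Local Open Scope ring_scope.

Definition ax1 : 'I_2 := ord0.
Definition ax2 : 'I_2 := ord_max.

Section plane.
Context {R : realType}.
Implicit Types (x xi : R * R) (phi psi : R * R -> R) (i j : 'I_2).

Definition coord i x : R := if i == ax1 then x.1 else x.2.

Definition unit_vec i : R * R := if i == ax1 then (1, 0) else (0, 1).

Definition dotp x xi : R := x.1 * xi.1 + x.2 * xi.2.

(* [`|x|] on [R * R] is the sup norm of the library, hence this definition. *)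
Definition enorm x : R := Num.sqrt (x.1 ^+ 2 + x.2 ^+ 2).

Definition leb2 : set (measurableTypeR R * measurableTypeR R) -> \bar R :=
  (@lebesgue_measure R \x @lebesgue_measure R)%E.

Definition partial i phi : R * R -> R := fun x => 'D_(unit_vec i) phi x.

(* The partial derivative of [phi] along the successive axes listed in [w]. *)
Definition partials (w : seq 'I_2) phi : R * R -> R := foldr partial phi w.

(* The quantity whose supremum over x is the Schwartz seminorm of [phi] for
   the monomial x_1^k x_2^l and the derivative [w]. *)
Definition schwartz_weight (k l : nat) (w : seq 'I_2) phi x : R :=
  `|x.1 ^+ k * x.2 ^+ l * partials w phi x|.

Definition schwartz phi : Prop :=
  forall w : seq 'I_2,
    [/\ forall x, {for x, continuous (partials w phi)},
        forall i x, derivable (partials w phi) x (unit_vec i)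
      & forall k l : nat, exists M : R,
          forall x, schwartz_weight k l w phi x <= M].

(* Real-valued distributions: functionals on real test functions. Only their
   values on Schwartz functions are ever used. *)
Definition dist := (R * R -> R) -> R.

Definition tempered (T : dist) : Prop :=
  (forall (a : R) phi psi, schwartz phi -> schwartz psi ->
     T (fun x => a * phi x + psi x) = a * T phi + T psi) /\
  (exists (N : nat) (K : R), forall phi (M : R), schwartz phi ->
     (forall (k l : nat) (w : seq 'I_2) x,
        (k <= N)%N -> (l <= N)%N -> (size w <= N)%N ->
        schwartz_weight k l w phi x <= M) ->
     `|T phi| <= K * M).

Definition dist_partial i (T : dist) : dist := fun phi => - T (partial i phi).

(* Real and imaginary parts of the Fourier transform
   x |-> \int exp(- i x.xi) psi(xi) dxi of a real test function. *)
Definition fourier_re psi : R * R -> R :=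
  fun x => Rintegral leb2 setT (fun xi => cos (dotp x xi) * psi xi).
Definition fourier_im psi : R * R -> R :=
  fun x => - Rintegral leb2 setT (fun xi => sin (dotp x xi) * psi xi).

(* The Fourier transform of [T], defined by duality, is the function [g]:
   T(psi^) = \int g psi, where the real functional [T] is extended
   complex-linearly to psi^ = fourier_re psi + i fourier_im psi. *)
Definition is_fourier (T : dist) (g : R * R -> R[i]) : Prop :=
  [/\ measurable_fun [set: measurableTypeR R * measurableTypeR R]
        (fun xi => complex.Re (g xi) : measurableTypeR R),
      measurable_fun [set: measurableTypeR R * measurableTypeR R]
        (fun xi => complex.Im (g xi) : measurableTypeR R)
    & forall psi, schwartz psi ->
      [/\ leb2.-integrable setT (fun xi => (complex.Re (g xi) * psi xi)%:E),
          leb2.-integrable setT (fun xi => (complex.Im (g xi) * psi xi)%:E),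
          T (fourier_re psi) = Rintegral leb2 setT (fun xi => complex.Re (g xi) * psi xi)
        & T (fourier_im psi) = Rintegral leb2 setT (fun xi => complex.Im (g xi) * psi xi)]].

(* The function representing the Fourier transform of [T]; it is unique up to
   a null set. *)
Definition hat (T : dist) : R * R -> R[i] :=
  xget (fun=> 0) [set g | is_fourier T g].

Definition sq_modulus (z : R[i]) : R := complex.Re z ^+ 2 + complex.Im z ^+ 2.

(* || weight^(1/2) T^ ||_{L^2}, infinite if T^ is not a function. *)
Definition weighted_norm (weight : R * R -> R) (T : dist) : \bar R :=
  if `[< exists g, is_fourier T g >] then
    ((\int[leb2]_xi (weight xi * sq_modulus (hat T xi))%:E) `^ 2^-1)%E
  else +oo%E.

Definition hdot_norm (s : R) : dist -> \bar R :=
  weighted_norm (fun xi => enorm xi `^ (2 * s)).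

Definition aniso_norm i (r sigma : R) : dist -> \bar R :=
  weighted_norm
    (fun xi => enorm xi `^ (2 * r) * `|coord i xi| `^ (- (2 * sigma))).

Definition neg_norm (r sigma : R) (T : dist) : \bar R :=
  (aniso_norm ax1 r sigma T + aniso_norm ax2 r sigma T)%E.

Definition in_neg_space (r sigma : R) (T : dist) : Prop :=
  [/\ tempered T, (aniso_norm ax1 r sigma T < +oo)%E
    & (aniso_norm ax2 r sigma T < +oo)%E].

(* [S] is the Fourier multiplier with real symbol [m] applied to [T]. *)
Definition is_multiplier (m : R * R -> R) (T S : dist) : Prop :=
  tempered S /\
  exists g, is_fourier T g /\
            is_fourier S (fun xi => (m xi * complex.Re (g xi)) +i* (m xi * complex.Im (g xi)))%C.

(* The symbol of \partial_i \partial_j \Delta^{-1}. *)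
Definition riesz_symbol i j : R * R -> R :=
  fun xi => coord i xi * coord j xi / enorm xi ^+ 2.

Definition divergence_free (v1 v2 : dist) : Prop :=
  forall phi, schwartz phi ->
    dist_partial ax1 v1 phi + dist_partial ax2 v2 phi = 0.

(* Time derivative, in the weak sense, of a time-dependent distribution. *)
Definition dt (W : R -> dist) : R -> dist :=
  fun t phi => derive1 (fun tau : R => W tau phi) t.

(* \partial_tt W - (eta \partial_11 + nu \partial_22) \partial_t W
   + nu eta \partial_11 \partial_22 W + \partial_11 \Delta^{-1} W = 0 at time t *)
Definition wave_eq (nu eta : R) (W : R -> dist) (t : R) : Prop :=
  exists2 S : dist, is_multiplier (riesz_symbol ax1 ax1) (W t) S &
  forall phi, schwartz phi ->
    dt (dt W) t phi
    - (eta * dist_partial ax1 (dist_partial ax1 (dt W t)) phi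
       + nu * dist_partial ax2 (dist_partial ax2 (dt W t)) phi)
    + nu * eta * dist_partial ax1 (dist_partial ax1
                   (dist_partial ax2 (dist_partial ax2 (W t)))) phi
    + S phi = 0.

(* [W] solves [wave_eq] for t > 0 with W = W0 and \partial_t W = V0 at t = 0:
   W is a curve of tempered distributions, weakly C^1 on [0, +oo[ and weakly
   twice differentiable on ]0, +oo[, and bounded on bounded time intervals in
   the space H^{0,-sigma} of the data; this determines the solution uniquely. *)
Definition solves (nu eta sigma : R) (W : R -> dist) (W0 V0 : dist) : Prop :=
  [/\ forall t, 0 <= t -> tempered (W t),
      forall t1, 0 <= t1 -> exists M : R, forall t, 0 <= t <= t1 ->
        (neg_norm 0 sigma (W t) <= M%:E)%E,
      forall phi, schwartz phi ->
        [/\ forall t, 0 < t -> derivable (fun tau => W tau phi) t 1,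
            forall t, 0 < t -> derivable (fun tau => dt W tau phi) t 1,
            W 0 phi = W0 phi,
            W t phi @[t --> 0^'+] --> W0 phi
          & dt W t phi @[t --> 0^'+] --> V0 phi]
    & forall t, 0 < t -> wave_eq nu eta W t].

(* The second-order system for (u, theta) with the initial time derivatives
   inherited from the first-order system; [S12] and [S11] are
   \partial_1 \partial_2 \Delta^{-1} theta_0 and \partial_11 \Delta^{-1} theta_0. *)
Definition linearized_solution (nu eta sigma : R) (u1 u2 theta : R -> dist)
    (u10 u20 theta0 : dist) : Prop :=
  exists S12 S11 : dist,
  [/\ is_multiplier (riesz_symbol ax1 ax2) theta0 S12,
      is_multiplier (riesz_symbol ax1 ax1) theta0 S11,
      solves nu eta sigma u1 u10 (fun phi =>
        nu * dist_partial ax2 (dist_partial ax2 u10) phi - S12 phi),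
      solves nu eta sigma u2 u20 (fun phi =>
        nu * dist_partial ax2 (dist_partial ax2 u20) phi + S11 phi)
    & solves nu eta sigma theta theta0 (fun phi =>
        eta * dist_partial ax1 (dist_partial ax1 theta0) phi - u20 phi)].

End plane.

Arguments dist R : clear implicits.

(* Main.v *)
(* On the Fourier side the equation for each component is, at fixed xi, the
   oscillator w'' + (a + b) w' + (a b + r) w = 0 with a = eta xi_1^2,
   b = nu xi_2^2 and r = xi_1^2 / |xi|^2. To pass from the weak formulation to
   this equation, one tests against the Fourier transforms of smooth functions
   supported in rectangles away from the axis xi_1 = 0, where the symbols are
   smooth; the resulting linear system has at most one solution, by iterating
   its integral form, so that w is given almost everywhere by the kernel
   G with w(0) = 0, w'(0) = 1 and by K = G' + a G.
   The energy K^2 + r G^2 decays like exp (- 2 min (a, b) t). As for G, with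
   p = (a + b) / 2: if ((a - b) / 2)^2 - r <= (p / 2)^2 then G decays like
   t exp (- p t / 2), otherwise like p^-1 exp (- (a b + r) t / (2 p)). The
   inequality exp (- y) <= C y^-k turns these bounds into negative powers of t
   multiplied by the weights of the norms of the data. *)

Require Import Defs.
From mathcomp Require Import all_boot all_order all_algebra.
From mathcomp Require Import all_classical all_reals all_analysis.
From mathcomp Require Import measurable_realfun complex ring lra.

Set Implicit Arguments.
Unset Strict Implicit.
Unset Printing Implicit Defensive.

Import Order.TTheory GRing.Theory Num.Theory.
Import numFieldNormedType.Exports.

Local Open Scope classical_set_scope.
Local Open Scope ring_scope.

(** * Oscillator kernels *)

(** The Riesz symbols are singular at the origin, so multipliers do not act on Schwartz functions
    and the equation cannot be tested freely. The class [test] is therefore built to be stable under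
    all that the equation does: partial derivatives, coordinates, division by |xi|^2. Uniqueness is
    shown for tested quantities and not for each xi, because [hat (W t)] is fixed only up to a null
    set that may change with t. The iteration applies symbols n times to a test function, so it
    needs a bound by the sup norm alone, without derivatives; boundedness in H^{0,-sigma} supplies
    it. Writing the initial velocity as g - b f gives w = f K + g G with f and g read off from the
    data. K loses no derivative. In the slow regime of G, each 1/p is worth |xi|^-2 and each factor
    r/p is worth 1/t, and the three components differ only in how many factors r they carry. The
    rate min (a, b) degenerates near both axes, whence the two weights |xi_1|^(-2 sigma) and
    |xi_2|^(-2 sigma). *)

Section kernels.
Context {R : realType}.
Implicit Types (D a b r t m : R).

(** The function sinh (sqrt D t) / sqrt D, continued to D <= 0 in real form; with [coshc], one
    formula covers the overdamped, critical and oscillating cases. *)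
Definition sinhc D t : R :=
  if 0 < D then (expR (Num.sqrt D * t) - expR (- (Num.sqrt D * t))) / (2 * Num.sqrt D)
  else if D < 0 then sin (Num.sqrt (- D) * t) / Num.sqrt (- D) else t.

Definition coshc D t : R :=
  if 0 < D then (expR (Num.sqrt D * t) + expR (- (Num.sqrt D * t))) / 2
  else if D < 0 then cos (Num.sqrt (- D) * t) else 1.

Lemma is_derive_sinhc D t : is_derive t 1 (sinhc D) (coshc D t).
Proof.
rewrite /sinhc /coshc; case: ifPn => [D0|_]; last case: ifPn => [D0|_].
- have s0 : Num.sqrt D != 0 by rewrite gt_eqF// sqrtr_gt0.
  apply: is_derive_eq; rewrite /GRing.scale/=; field.
  by rewrite s0.
- have s0 : Num.sqrt (- D) != 0 by rewrite gt_eqF// sqrtr_gt0 oppr_gt0.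
  apply: is_derive_eq; rewrite /GRing.scale/=; field.
  by rewrite s0.
- exact: is_derive_id.
Qed.

Lemma is_derive_coshc D t : is_derive t 1 (coshc D) (D * sinhc D t).
Proof.
rewrite /sinhc /coshc; case: ifPn => [D0|nD]; last case: ifPn => [D0|nD'].
- have s0 : Num.sqrt D != 0 by rewrite gt_eqF// sqrtr_gt0.
  apply: is_derive_eq; rewrite /GRing.scale/= -[X in _ = X * _](@sqr_sqrtr _ D) ?ltW//.
  by field; rewrite s0.
- have s0 : Num.sqrt (- D) != 0 by rewrite gt_eqF// sqrtr_gt0 oppr_gt0.
  apply: is_derive_eq; rewrite /GRing.scale/= -[X in _ = X * _]opprK.
  rewrite -[X in _ = - X * _](@sqr_sqrtr _ (- D)) ?oppr_ge0 ?ltW//.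
  by field; rewrite s0.
- have -> : D = 0 by apply/eqP; rewrite eq_le !leNgt nD nD'.
  by rewrite mul0r; exact: is_derive_cst.
Qed.

Lemma sinhc0 D : sinhc D 0 = 0.
Proof.
rewrite /sinhc; case: ifP => _; last case: ifP => _ //.
  by rewrite mulr0 oppr0 subrr mul0r.
by rewrite mulr0 sin0 mul0r.
Qed.

Lemma coshc0 D : coshc D 0 = 1.
Proof.
rewrite /coshc; case: ifP => _; last case: ifP => _ //.
  by rewrite mulr0 oppr0 expR0 divff.
by rewrite mulr0 cos0.
Qed.

Lemma MVT_le0 (f df : R -> R) t : 0 <= t ->
  (forall x : R, is_derive x 1 f (df x)) -> (forall x, 0 <= x -> df x <= 0) ->
  f t <= f 0.
Proof.
move=> t0 fdf df0.
have cf : {within `[0, t], continuous f}.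
  apply: continuous_subspaceT => x.
  by apply: differentiable_continuous; apply/derivable1_diffP; case: (fdf x).
have [c c0t e] := MVT_segment t0 (fun x _ => fdf x) cf.
by rewrite -subr_le0 e subr0 mulr_le0_ge0// df0// (itvP c0t).
Qed.

Lemma ler_norm_sin t : 0 <= t -> `|sin t| <= t.
Proof.
move=> t0; rewrite ler_norml; apply/andP; split; rewrite -subr_le0.
- rewrite [leRHS](_ : _ = - 0 - sin 0); last by rewrite sin0 oppr0 addr0.
  apply: (@MVT_le0 (fun x => - x - sin x) (fun x => - 1 - cos x)) => // x.
- rewrite [leRHS](_ : _ = sin 0 - 0); last by rewrite sin0 oppr0 addr0.
  apply: (@MVT_le0 (fun x => sin x - x) (fun x => cos x - 1)) => // x.
Qed.

(** For D > 0 this is sinh z <= z exp z, that is 1 - 2 z <= exp (- 2 z); for D < 0 it is |sin z| <=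
    z. Only the upper bound d for a real square root of D enters. *)
Lemma ler_norm_sinhc D t d : 0 <= d -> D <= d ^+ 2 -> 0 <= t ->
  `|sinhc D t| <= t * expR (d * t).
Proof.
move=> d0 Dd t0.
have e1 : 1 <= expR (d * t) by rewrite -expR0 ler_expR mulr_ge0.
rewrite /sinhc; case: ifPn => [D0|nD]; last case: ifPn => [D0|nD'].
- have s0 : 0 < Num.sqrt D by rewrite sqrtr_gt0.
  have sd : Num.sqrt D <= d.
    by rewrite -[leRHS]ger0_norm// -sqrtr_sqr ler_sqrt// sqr_ge0.
  set s := Num.sqrt D in s0 sd *.
  have st0 : 0 <= s * t by rewrite mulr_ge0// ltW.
  rewrite ger0_norm; last first.
    by rewrite divr_ge0// ?mulr_ge0// ?(ltW s0)// subr_ge0 ler_expR; lra.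
  apply: (@le_trans _ _ (t * expR (s * t))); last first.
    by rewrite ler_wpM2l// ler_expR ler_wpM2r.
  rewrite ler_pdivrMr ?mulr_gt0//.
  have e3 : 1 - 2 * (s * t) <= expR (- (2 * (s * t))).
    by have := expR_ge1Dx (- (2 * (s * t))); lra.
  have -> : expR (- (s * t)) = expR (s * t) * expR (- (2 * (s * t))).
    by rewrite -expRD; congr expR; lra.
  have -> : t * expR (s * t) * (2 * s) = expR (s * t) * (2 * (s * t)) by ring.
  by rewrite -[X in X - _]mulr1 -mulrBr ler_wpM2l ?expR_ge0//; lra.
- have s0 : 0 < Num.sqrt (- D) by rewrite sqrtr_gt0 oppr_gt0.
  set s := Num.sqrt (- D) in s0 *.
  rewrite normrM normfV (gtr0_norm s0) ler_pdivrMr//.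
  apply: le_trans (ler_norm_sin _) _; first by rewrite mulr_ge0// ltW.
  by rewrite [leLHS]mulrC; apply: ler_wpM2r; [exact: ltW|exact: ler_peMr].
- by rewrite ger0_norm// ler_peMr.
Qed.

Lemma ler_norm_coshc D t d : 0 <= d -> D <= d ^+ 2 -> 0 <= t ->
  `|coshc D t| <= expR (d * t).
Proof.
move=> d0 Dd t0.
have e1 : 1 <= expR (d * t) by rewrite -expR0 ler_expR mulr_ge0.
rewrite /coshc; case: ifPn => [D0|nD]; last case: ifPn => [D0|nD'].
- have sd : Num.sqrt D <= d.
    by rewrite -[leRHS]ger0_norm// -sqrtr_sqr ler_sqrt// sqr_ge0.
  have s0 : 0 <= Num.sqrt D * t by rewrite mulr_ge0// sqrtr_ge0.
  rewrite ger0_norm ?divr_ge0 ?addr_ge0 ?expR_ge0//.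
  have : expR (- (Num.sqrt D * t)) <= expR (d * t).
    by rewrite ler_expR (le_trans _ (mulr_ge0 d0 t0))// oppr_le0.
  have : expR (Num.sqrt D * t) <= expR (d * t) by rewrite ler_expR ler_wpM2r.
  lra.
- by rewrite (le_trans (cos_max _)).
- by rewrite normr1.
Qed.

(** Parity extends the crude bounds to negative times, so that integrals can be differentiated under
    the integral sign at t = 0 as well. *)
Lemma sinhcN D t : sinhc D (- t) = - sinhc D t.
Proof.
rewrite /sinhc; case: ifP => _; last case: ifP => // _; rewrite mulrN.
  by rewrite opprK -[RHS]mulNr opprB.
by rewrite sinN mulNr.
Qed.

Lemma coshcN D t : coshc D (- t) = coshc D t.
Proof.
rewrite /coshc; case: ifP => _; last case: ifP => // _; rewrite mulrN.
  by rewrite opprK addrC.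
by rewrite cosN.
Qed.

(** The characteristic roots of the oscillator are - (a + b) / 2 plus or minus the square root of
    [disc a b r]. *)
Definition disc a b r : R := ((a - b) / 2) ^+ 2 - r.

(* [kerG] is the solution of w'' + (a + b) w' + (a b + r) w = 0 with w(0) = 0
   and w'(0) = 1, and [kerK] is w' + a w. *)
Definition kerG a b r t : R := expR (- ((a + b) / 2) * t) * sinhc (disc a b r) t.
Definition kerK a b r t : R := expR (- ((a + b) / 2) * t) *
  (coshc (disc a b r) t + (a - b) / 2 * sinhc (disc a b r) t).

Lemma is_derive_kerG a b r t :
  is_derive t 1 (kerG a b r) (kerK a b r t - a * kerG a b r t).
Proof.
have := is_derive_sinhc (disc a b r) t => ?.
apply: is_derive_eq; rewrite /kerK /kerG /GRing.scale/=; by field.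
Qed.

Lemma is_derive_kerK a b r t :
  is_derive t 1 (kerK a b r) (- b * kerK a b r t - r * kerG a b r t).
Proof.
have := is_derive_sinhc (disc a b r) t => ?.
have := is_derive_coshc (disc a b r) t => ?.
apply: is_derive_eq; rewrite /kerK /kerG /GRing.scale/=.
move: (sinhc _ _) (coshc _ _) => S C; by rewrite /disc; field.
Qed.

Lemma kerG0 a b r : kerG a b r 0 = 0.
Proof. by rewrite /kerG sinhc0 mulr0. Qed.

Lemma kerK0 a b r : kerK a b r 0 = 1.
Proof. by rewrite /kerK sinhc0 coshc0 !mulr0 expR0 addr0 mulr1. Qed.

Lemma disc_sym a b r : disc a b r = disc b a r.
Proof. by rewrite /disc; field. Qed.

(** G is symmetric in a and b, and K is G' + a G. The swapped kernel is the one for theta, whose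
    initial velocity contains - a theta_0 where that of u contains - b u_0. *)
Lemma kerK_sym a b r t : kerK b a r t = kerK a b r t + (b - a) * kerG a b r t.
Proof.
rewrite /kerK /kerG (disc_sym b) [b + a]addrC.
by field.
Qed.

(** In the system K' = - b K - r G, G' = K - a G the cross terms of the derivative of K^2 + r G^2
    cancel; what remains is - 2 b K^2 - 2 a r G^2, at most - 2 m times the energy. *)
Lemma kernel_energy a b r m t : 0 <= r -> m <= a -> m <= b -> 0 <= t ->
  kerK a b r t ^+ 2 + r * kerG a b r t ^+ 2 <= expR (- (2 * m * t)).
Proof.
move=> r0 ma mb t0.
rewrite expRN -[leRHS]mul1r ler_pdivlMr ?expR_gt0//.
pose E x := expR (2 * m * x) * (kerK a b r x ^+ 2 + r * kerG a b r x ^+ 2).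
have := @MVT_le0 E (fun x => expR (2 * m * x) *
  (2 * (m - b) * kerK a b r x ^+ 2 + 2 * (m - a) * r * kerG a b r x ^+ 2)) t t0.
rewrite /E mulr0 expR0 mul1r kerK0 kerG0 expr0n/= mulr0 addr0 expr1n [X in _ -> _ -> X <= _]mulrC.
apply.
- move=> x; have := is_derive_kerG a b r x => ?; have := is_derive_kerK a b r x => ?.
  apply: is_derive_eq; rewrite /GRing.scale/=; ring.
- move=> x x0; rewrite mulr_ge0_le0 ?expR_ge0//.
  have : 0 <= (b - m) * kerK a b r x ^+ 2 by rewrite mulr_ge0 ?subr_ge0 ?sqr_ge0.
  have : 0 <= (a - m) * (r * kerG a b r x ^+ 2).
    by rewrite mulr_ge0 ?subr_ge0// mulr_ge0 ?sqr_ge0.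
  lra.
Qed.

Lemma kerK_bound a b r m t : 0 <= r -> m <= a -> m <= b -> 0 <= t ->
  kerK a b r t ^+ 2 <= expR (- (2 * m * t)).
Proof.
move=> r0 ma mb t0; apply: le_trans (kernel_energy r0 ma mb t0).
by rewrite lerDl mulr_ge0// sqr_ge0.
Qed.

(** Both roots have real part at most - p / 2; the factor t allows for a double root. *)
Lemma kerG_small_disc a b r t (p := (a + b) / 2) : 0 <= p -> 0 <= t ->
  disc a b r <= (p / 2) ^+ 2 -> `|kerG a b r t| <= t * expR (- (p / 2 * t)).
Proof.
move=> p0 t0 Dp; rewrite /kerG normrM ger0_norm ?expR_ge0//.
have p20 : 0 <= p / 2 by rewrite divr_ge0.
apply: (@le_trans _ _ (expR (- p * t) * (t * expR (p / 2 * t)))).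
  by rewrite ler_wpM2l ?expR_ge0// ler_norm_sinhc.
by rewrite mulrCA -expRD ler_wpM2l// ler_expR; lra.
Qed.

(** With s the square root of the discriminant, p / 2 < s <= p. The first inequality bounds the
    prefactor 1 / (2 s) by 1 / p; the second bounds the slow rate p - s = (a b + r) / (p + s) below
    by (a b + r) / (2 p). *)
Lemma kerG_large_disc a b r t (p := (a + b) / 2) : 0 < p -> 0 <= t ->
  0 <= a * b + r -> (p / 2) ^+ 2 < disc a b r ->
  `|kerG a b r t| <= p^-1 * expR (- ((a * b + r) / (2 * p) * t)).
Proof.
move=> p0 t0 abr Dp; rewrite /kerG normrM ger0_norm ?expR_ge0//.
have D0 : 0 < disc a b r by rewrite (le_lt_trans _ Dp)// sqr_ge0.
have s0 : 0 < Num.sqrt (disc a b r) by rewrite sqrtr_gt0.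
have ss : Num.sqrt (disc a b r) ^+ 2 = disc a b r by rewrite sqr_sqrtr// ltW.
rewrite /sinhc D0; set s := Num.sqrt _ in s0 ss *.
have ps : p / 2 < s.
  by rewrite ltNge; apply/negP => h; move: Dp; rewrite -ss; nra.
have sp : s <= p.
  have : s ^+ 2 <= p ^+ 2 by rewrite ss -subr_ge0 /disc (_ : _ - _ = a * b + r)// /p; field.
  move=> ?; rewrite leNgt; apply/negP => h; nra.
have st : 0 <= s * t by rewrite mulr_ge0// ltW.
rewrite ger0_norm; last first.
  by rewrite divr_ge0 ?mulr_ge0// ?(ltW s0)// subr_ge0 ler_expR; lra.
apply: (@le_trans _ _ (expR (- p * t) * (p^-1 * expR (s * t)))).
  rewrite ler_wpM2l ?expR_ge0// ler_pdivrMr ?mulr_gt0// mulrAC.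
  rewrite (@le_trans _ _ (expR (s * t)))// ?gerBl ?expR_ge0//.
  by rewrite ler_peMl ?expR_ge0// mulrC ler_pdivlMr// mul1r; lra.
rewrite mulrCA -expRD ler_wpM2l ?invr_ge0 ?(ltW p0)// ler_expR.
rewrite -subr_ge0.
have -> : - ((a * b + r) / (2 * p) * t) - (- p * t + s * t) =
    t * ((p - s) - (a * b + r) / (2 * p)) by ring.
have ab0 : 0 < a + b by move: p0; rewrite /p pmulr_lgt0.
rewrite mulr_ge0// subr_ge0 ler_pdivrMr ?mulr_gt0//.
have -> : a * b + r = (p - s) * (p + s) by rewrite -subr_sqr ss /disc /p; field.
  by rewrite ler_wpM2l ?subr_ge0//; lra.
Qed.

End kernels.

(** * Smooth bump functions *)

Section derivatives.
Context {R : realType}.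

(** Serves where the rules of calculus do not apply directly: at the end points of the bumps, and
    for Fourier integrals, where it replaces differentiation under the integral sign. *)
Lemma is_derive_quadratic (V : normedModType R) (f : V -> R) (x v : V) (l M : R) :
  (forall h : R, `|h| <= 1 -> `|f (h *: v + x) - f x - h * l| <= M * h ^+ 2) ->
  is_derive x v f l.
Proof.
move=> fM.
have fl : h^-1 *: (f (h *: v + x) - f x) @[h --> 0^'] --> l.
  apply/cvgrPdist_le => e e0.
  have M10 : 0 < `|M| + 1 by rewrite ltr_pwDr.
  near=> h.
  have h0 : h != 0 by near: h; exact: nbhs_dnbhs_neq.
  have h1 : `|h| <= 1 by near: h; apply: dnbhs0_le.
  have he : `|h| <= e / (`|M| + 1) by near: h; apply: dnbhs0_le; rewrite divr_gt0.
  have -> : l - h^-1 *: (f (h *: v + x) - f x) =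
      - (h^-1 * (f (h *: v + x) - f x - h * l)).
    by rewrite /GRing.scale/=; field.
  rewrite normrN normrM normfV ler_pdivrMl ?normr_gt0//.
  apply: (le_trans (fM _ h1)).
  rewrite -real_normK ?num_real// expr2 mulrCA ler_wpM2l//.
  move: he; rewrite ler_pdivlMr// mulrDr mulr1 => he.
  have : M * `|h| <= `|M| * `|h| by rewrite ler_wpM2r// ler_norm.
  have := normr_ge0 h; lra.
apply: DeriveDef; last exact/cvg_lim.
by apply/cvg_ex; exists l.
Unshelve. all: by end_near.
Qed.

Lemma is_derive_axis1 (f : R * R -> R) (x : R * R) (l : R) :
  is_derive x (unit_vec ax1) f l <-> is_derive x.1 1 (fun s => f (s, x.2)) l.
Proof.
have e (h : R) : h *: unit_vec ax1 + x = (h *: 1 + x.1, x.2).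
  rewrite /unit_vec/= /GRing.scale/=; case: x => x y/=.
  by rewrite /GRing.add/= /add_pair/= /scale_pair /GRing.scale/= mulr0 add0r.
case: x e => x y /= e.
have ee : (fun h : R => h^-1 *: (f (h *: unit_vec ax1 + (x, y)) - f (x, y))) =
          (fun h : R => h^-1 *: (f (h *: 1 + x, y) - f (x, y))).
  by apply/funext => h; rewrite e.
have eC : derivable f (x, y) (unit_vec ax1) = derivable (fun s => f (s, y)) x 1.
  by rewrite /derivable ee.
have eD : 'D_(unit_vec ax1) f (x, y) = 'D_1 (fun s => f (s, y)) x by rewrite /derive ee.
by split=> -[d dl]; apply: DeriveDef; [rewrite -eC|rewrite -eD|rewrite eC|rewrite eD].
Qed.

Lemma is_derive_axis2 (f : R * R -> R) (x : R * R) (l : R) :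
  is_derive x (unit_vec ax2) f l <-> is_derive x.2 1 (fun s => f (x.1, s)) l.
Proof.
have e (h : R) : h *: unit_vec ax2 + x = (x.1, h *: 1 + x.2).
  rewrite /unit_vec/= /GRing.scale/=; case: x => x y/=.
  by rewrite /GRing.add/= /add_pair/= /scale_pair /GRing.scale/= mulr0 add0r.
case: x e => x y /= e.
have ee : (fun h : R => h^-1 *: (f (h *: unit_vec ax2 + (x, y)) - f (x, y))) =
          (fun h : R => h^-1 *: (f (x, h *: 1 + y) - f (x, y))).
  by apply/funext => h; rewrite e.
have eC : derivable f (x, y) (unit_vec ax2) = derivable (fun s => f (x, s)) y 1.
  by rewrite /derivable ee.
have eD : 'D_(unit_vec ax2) f (x, y) = 'D_1 (fun s => f (x, s)) y by rewrite /derive ee.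
by split=> -[d dl]; apply: DeriveDef; [rewrite -eC|rewrite -eD|rewrite eC|rewrite eD].
Qed.

Lemma is_derive_continuous (f df : R -> R) :
  (forall x : R, is_derive x 1 f (df x)) -> continuous f.
Proof.
move=> fdf x; apply: differentiable_continuous.
by apply/derivable1_diffP; case: (fdf x).
Qed.

Lemma continuous_bounded_itv (f : R -> R) (a b : R) : continuous f ->
  exists2 M, 0 <= M & forall x, a <= x <= b -> `|f x| <= M.
Proof.
move=> cf; have [ab|ba] := leP a b; last first.
  by exists 0 => // x /andP[ax xb]; move: (le_trans ax xb); rewrite leNgt ba.
have cn : {within `[a, b], continuous (fun x => `|f x|)}.
  apply: continuous_subspaceT => x.
  exact: (continuous_comp (cf x) (@norm_continuous _ R^o (f x))).
have [c _ fc] := EVT_max ab cn.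
by exists `|f c| => // x xab; apply: fc; rewrite in_itv.
Qed.

End derivatives.

Section bump.
Context {R : realType}.
Variables (al be c : R).

Definition quadp : {poly R} := ('X - al%:P) * (be%:P - 'X).

(* The factor exp (- c / quad) and all its derivatives vanish at the end points. *)
Definition bumpf (p : {poly R}) (k : nat) (x : R) : R :=
  if 0 < quadp.[x] then p.[x] * quadp.[x]^-1 ^+ k * expR (- (c / quadp.[x])) else 0.

(** The numerator of (p q^-k exp (- c / q))' over q^(k+2), for q = [quadp]. The family [bumpf] is
    thus closed under differentiation, and smoothness reduces to first derivatives. *)
Definition dbump (p : {poly R}) (k : nat) : {poly R} :=
  p^`() * quadp ^+ 2 - k%:R *: (p * quadp^`() * quadp) + c *: (p * quadp^`()).

Hypothesis c0 : 0 < c.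

Lemma quadpE x : quadp.[x] = (x - al) * (be - x).
Proof. by rewrite /quadp !hornerE. Qed.

Lemma inv_expR_bound (q : R) n : 0 < q ->
  q^-1 ^+ n.+1 * expR (- (c / q)) <= (n.+1)`!%:R / c ^+ n.+1.
Proof.
move=> q0; rewrite expRN ler_pdivrMr ?expR_gt0//.
have h := @expR_ge1Dxn R (c / q) n (divr_ge0 (ltW c0) (ltW q0)).
have f0 : 0 < (n.+1)`!%:R :> R by rewrite ltr0n fact_gt0.
have cn0 : 0 < c ^+ n.+1 by rewrite exprn_gt0.
rewrite mulrAC ler_pdivlMr// mulrC -exprMn mulrC -ler_pdivrMl// mulrC.
apply: le_trans h; rewrite [leLHS]mulrC -subr_ge0 addrK.
exact: ler01.
Qed.

(** Near a zero x, [quadp] is h (al + be - 2 x - h), hence O(h). The exponential absorbs k + 2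
    inverse powers of it, two more than present, which leaves a factor [quadp] squared. *)
Lemma bump_quadratic p k x : quadp.[x] = 0 ->
  exists M, forall h, `|h| <= 1 -> `|bumpf p k (h + x)| <= M * h ^+ 2.
Proof.
move=> qx.
have [M M0 pM] := @continuous_bounded_itv R (horner p) (x - 1) (x + 1) (@continuous_horner R p).
pose K := (k.+2)`!%:R / c ^+ k.+2.
have K0 : 0 <= K by rewrite divr_ge0// exprn_ge0// ltW.
exists (M * (K * (`|al + be - 2 * x| + 1) ^+ 2)) => h h1.
rewrite /bumpf; case: ifPn => [q0|_]; last first.
  by rewrite normr0; apply: mulr_ge0; [apply: mulr_ge0 => //; apply: mulr_ge0|]; rewrite ?sqr_ge0.
have e : quadp.[h + x] = h * (al + be - 2 * x - h).
  move: qx; rewrite !quadpE => qx.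
  by rewrite -[RHS]addr0 -qx; ring.
have : `|p.[h + x]| <= M.
  by apply: pM; move: h1; rewrite ler_norml; lra.
set q := quadp.[h + x] in q0 e *; move=> pM'.
have -> : p.[h + x] * q^-1 ^+ k * expR (- (c / q)) =
   p.[h + x] * (q^-1 ^+ k.+2 * expR (- (c / q)) * q ^+ 2).
  rewrite -addn2 exprD; field; by rewrite gt_eqF.
have E0 : 0 <= q^-1 ^+ k.+2 * expR (- (c / q)).
  by rewrite mulr_ge0 ?expR_ge0// exprn_ge0// invr_ge0 ltW.
have EK : q^-1 ^+ k.+2 * expR (- (c / q)) <= K by exact: inv_expR_bound.
have eq2 : q ^+ 2 <= (`|al + be - 2 * x| + 1) ^+ 2 * h ^+ 2.
  rewrite e exprMn mulrC ler_wpM2r ?sqr_ge0// -real_normK ?num_real//.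
  rewrite ler_pXn2r ?nnegrE ?addr_ge0//.
  by apply: le_trans (ler_normB _ _) _; rewrite lerD2l.
rewrite normrM -[leRHS]mulrA; apply: ler_pM => //.
rewrite ger0_norm; last by rewrite mulr_ge0 ?sqr_ge0.
rewrite -[leRHS]mulrA; apply: ler_pM => //; exact: sqr_ge0.
Qed.

Lemma is_derive_bump_formula (P Q : R -> R) (dP dQ x : R) k :
  is_derive x 1 P dP -> is_derive x 1 Q dQ -> Q x != 0 ->
  is_derive x 1 (fun y => P y * (Q y)^-1 ^+ k * expR (- (c / Q y)))
    ((dP * Q x ^+ 2 - k%:R * (P x * dQ * Q x) + c * (P x * dQ)) *
     (Q x)^-1 ^+ k.+2 * expR (- (c / Q x))).
Proof.
move=> dPx dQx Q0.
have dV := is_deriveV Q0 dQx.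
have dVk : is_derive x 1 (fun y => (Q y)^-1 ^+ k)
    ((k%:R * (Q x)^-1 ^+ k.-1) * (- Q x ^- 2 * dQ)).
  have -> : (fun y => (Q y)^-1 ^+ k) = ((fun y => (Q y)^-1) ^+ k : R -> R).
    by apply/funext => y; rewrite exprfctE.
  exact: (@is_deriveX R R (fun y => (Q y)^-1) k x 1 _ dV).
have dc : is_derive x 1 (fun y => - (c / Q y)) (c * dQ * Q x ^- 2).
  by apply: is_derive_eq; rewrite /GRing.scale/=; field.
have dE : is_derive x 1 (fun y => expR (- (c / Q y))) (expR (- (c / Q x)) * (c * dQ * Q x ^- 2)).
  exact: is_derive1_comp.
apply: is_derive_eq; rewrite /GRing.scale/=.
case: k {dVk} => [|k]; first by rewrite !expr0; field.
rewrite !exprS /=; move: (_ ^+ k) (expR _) (k.+1%:R) => A E K; field.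
exact: Q0.
Qed.

(** The sign of [quadp] decides: the explicit formula inside, a locally zero function outside, and
    at an end point vanishing to second order, which gives derivative 0, the value of the right-hand
    side there. *)
Lemma is_derive_bump p k (x : R) :
  is_derive x 1 (bumpf p k) (bumpf (dbump p k) k.+2 x).
Proof.
have cq : continuous (horner quadp) by exact: continuous_horner.
have [q0|q0|q0] := ltgtP 0 quadp.[x].
- have n0 : \forall y \near x, 0 < quadp.[y].
    by have := cq x; move/cvgr_gt => /(_ _ q0).
  apply: (@near_eq_is_derive _ _ _ (fun y => p.[y] * quadp.[y]^-1 ^+ k * expR (- (c / quadp.[y])))).
    by near=> y; rewrite /bumpf ifT//; near: y.
  have q0' : quadp.[x] != 0 by rewrite gt_eqF.
  have := is_derive_bump_formula k (is_derive_poly p x) (is_derive_poly quadp x) q0'.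
  by rewrite /bumpf q0 /dbump !hornerE.
- have n1 : \forall y \near x, quadp.[y] < 0.
    by have := cq x; move/cvgr_lt => /(_ _ q0).
  apply: (@near_eq_is_derive _ _ _ (fun y => 0)).
    by near=> y; rewrite /bumpf ifF//; apply/negbTE; rewrite -leNgt ltW//; near: y.
  rewrite /bumpf ifF//; first exact: is_derive_cst.
  by rewrite ltNge (ltW q0).
- have [M bM] := bump_quadratic p k (esym q0).
  apply: (@is_derive_quadratic _ _ _ _ _ _ M) => h h1.
  rewrite /GRing.scale/= mulr1 /bumpf -q0 ltxx mulr0 !subr0.
  exact: bM.
Unshelve. all: by end_near.
Qed.

Lemma continuous_bump p k : continuous (bumpf p k).
Proof. by apply: is_derive_continuous => x; exact: is_derive_bump. Qed.

Lemma bump_supp p k x : al < be -> bumpf p k x != 0 -> al < x < be.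
Proof.
rewrite /bumpf; case: ifPn; rewrite ?eqxx// quadpE => q0 ab _.
by apply/andP; split; rewrite ltNge; apply/negP => h; nra.
Qed.

Lemma bumpZ (a : R) p k x : bumpf (a *: p) k x = a * bumpf p k x.
Proof. by rewrite /bumpf hornerZ; case: ifP => _; rewrite ?mulr0 ?mulrA. Qed.

Lemma bumpX (p : {poly R}) k x : bumpf ('X * p) k x = x * bumpf p k x.
Proof. by rewrite /bumpf !hornerE; case: ifP => _; rewrite ?mulr0 ?mulrA. Qed.

End bump.

(** * Test functions away from an axis *)

(* A rectangle [al, be] x [ga, de] away from the axis xi_1 = 0, with the
   steepness cc of the bump functions it carries. *)
Record box (R : realType) := Box {
  al : R; be : R; ga : R; de : R; cc : R; ka : R;
  al_lt_be : al < be; ga_lt_de : ga < de; cc_gt0 : 0 < cc; ka_gt0 : 0 < ka;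
  ka_le : forall x, al <= x <= be -> ka <= x ^+ 2 }.

Section test_functions.
Context {R : realType}.
Variable Q : box R.

Definition rho (x : R * R) : R := x.1 ^+ 2 + x.2 ^+ 2.

Definition rect : set (R * R) := `[al Q, be Q]%classic `*` `[ga Q, de Q]%classic.

Definition bump1 := bumpf (al Q) (be Q) (cc Q).
Definition bump2 := bumpf (ga Q) (de Q) (cc Q).

(** The powers of 1 / |xi|^2 make the class stable under the Riesz symbols, and the sums make it
    stable under derivatives. A syntactic class lets each closure property be proved by induction on
    the terms. *)
Inductive test : (R * R -> R) -> Prop :=
| test_term p q k l m :
    test (fun x => bump1 p k x.1 * bump2 q l x.2 * (rho x)^-1 ^+ m)
| test_add f g : test f -> test g -> test (fun x => f x + g x).

Lemma testZ a f : test f -> test (fun x => a * f x).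
Proof.
elim => [p q k l m|{}f g _ tf _ tg]; last first.
  by under eq_fun do rewrite mulrDr; exact: test_add.
have := test_term (a *: p) q k l m.
by under eq_fun do rewrite /bump1 bumpZ -!mulrA; under [X in _ -> test X]eq_fun do rewrite -!mulrA.
Qed.

Lemma testX1 f : test f -> test (fun x => x.1 * f x).
Proof.
elim => [p q k l m|{}f g _ tf _ tg]; last first.
  by under eq_fun do rewrite mulrDr; exact: test_add.
have := test_term ('X * p) q k l m.
by under eq_fun do rewrite /bump1 bumpX -!mulrA; under [X in _ -> test X]eq_fun do rewrite -!mulrA.
Qed.

Lemma testX2 f : test f -> test (fun x => x.2 * f x).
Proof.
elim => [p q k l m|{}f g _ tf _ tg]; last first.
  by under eq_fun do rewrite mulrDr; exact: test_add.
have := test_term p ('X * q) k l m.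
congr test; apply/funext => x; rewrite /bump2 bumpX; ring.
Qed.

Lemma test_coord i f : test f -> test (fun x => Defs.coord i x * f x).
Proof. by rewrite /Defs.coord; case: (i == ax1); [exact: testX1|exact: testX2]. Qed.

Lemma test_divrho f : test f -> test (fun x => (rho x)^-1 * f x).
Proof.
elim => [p q k l m|{}f g _ tf _ tg]; last first.
  by under eq_fun do rewrite mulrDr; exact: test_add.
have := test_term p q k l m.+1.
congr test; apply/funext => x; rewrite exprS; ring.
Qed.

Lemma testD f g : test f -> test g -> test (fun x => f x + g x).
Proof. exact: test_add. Qed.

Lemma test_supp f x : test f -> f x != 0 ->
  (al Q < x.1 < be Q) && (ga Q < x.2 < de Q).
Proof.
elim => [p q k l m|{}f g _ tf _ tg]; last first.
  apply: contraNT => nx.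
  have /eqP -> : f x == 0 by apply: contraNT nx; exact: tf.
  have /eqP -> : g x == 0 by apply: contraNT nx; exact: tg.
  by rewrite addr0.
rewrite !mulf_eq0 !negb_or -!andbA => /and3P[h1 h2 _].
have := bump_supp (al_lt_be Q) h1; have := bump_supp (ga_lt_de Q) h2.
by move=> /andP[-> ->] /andP[-> ->].
Qed.

Lemma rectP x : rect x <-> (al Q <= x.1 <= be Q) && (ga Q <= x.2 <= de Q).
Proof. by rewrite /rect/= !in_itv/=; split => [[-> ->]|/andP[]]. Qed.

Lemma rho_ge x : rect x -> ka Q <= rho x.
Proof.
by move=> /rectP/andP[x1 _]; rewrite (le_trans (ka_le x1))// lerDl sqr_ge0.
Qed.

Lemma test_out f x : test f -> ~ rect x -> f x = 0.
Proof.
move=> tf nx; apply/eqP; apply: contra_notT nx => /(test_supp tf).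
move=> /andP[/andP[h1 h2] /andP[h3 h4]].
by apply/rectP; rewrite !ltW.
Qed.

(** A continuous function that agrees with the inverse on the values of |xi|^2 over the rectangle;
    continuity and measurability of test functions follow without treating the origin apart. *)
Definition cutinv (r : R) : R := (Num.max r (ka Q))^-1.

Lemma cutinvE x : rect x -> cutinv (rho x) = (rho x)^-1.
Proof. by move=> /rho_ge h; rewrite /cutinv max_l. Qed.

Lemma continuous_cutinv : continuous cutinv.
Proof.
move=> r; apply: (@continuousV _ R^o (fun r => Num.max r (ka Q))).
  by rewrite gt_eqF// lt_max ka_gt0 orbT.
apply: continuous_max => //; exact: cst_continuous.
Qed.

Lemma test_termE p q k l m x :
  bump1 p k x.1 * bump2 q l x.2 * (rho x)^-1 ^+ m =
  bump1 p k x.1 * bump2 q l x.2 * cutinv (rho x) ^+ m.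
Proof.
have [/cutinvE->//|nx] := pselect (rect x).
suff /eqP -> : bump1 p k x.1 * bump2 q l x.2 == 0 by rewrite !mul0r.
rewrite mulf_eq0; apply: contra_notT nx; rewrite negb_or => /andP[h1 h2].
have := bump_supp (al_lt_be Q) h1; have := bump_supp (ga_lt_de Q) h2.
by move=> /andP[? ?] /andP[? ?]; apply/rectP; rewrite !ltW.
Qed.

Lemma continuous_bump1 p k : continuous (bump1 p k).
Proof. exact/continuous_bump/cc_gt0. Qed.

Lemma continuous_bump2 p k : continuous (bump2 p k).
Proof. exact/continuous_bump/cc_gt0. Qed.

Lemma continuous_rho : continuous rho.
Proof.
move=> x; have c1 : {for x, continuous (fun x : R * R => x.1)} by exact: cvg_fst.
have c2 : {for x, continuous (fun x : R * R => x.2)} by exact: cvg_snd.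
exact: (continuousD (continuousM c1 c1) (continuousM c2 c2)).
Qed.

Lemma test_continuous f : test f -> continuous f.
Proof.
elim => [p q k l m|{}f g _ cf _ cg] x; last first.
  by apply: (@continuousD _ R^o); [exact: cf|exact: cg].
have -> : (fun x => bump1 p k x.1 * bump2 q l x.2 * (rho x)^-1 ^+ m) =
          (fun x => bump1 p k x.1 * bump2 q l x.2 * cutinv (rho x) ^+ m).
  by apply/funext => y; rewrite test_termE.
have c1 : {for x, continuous (fun x : R * R => x.1)} by exact: cvg_fst.
have c2 : {for x, continuous (fun x : R * R => x.2)} by exact: cvg_snd.
have d1 : {for x, continuous (fun x : R * R => bump1 p k x.1)}.
  exact: (continuous_comp c1 (@continuous_bump1 p k x.1)).
have d2 : {for x, continuous (fun x : R * R => bump2 q l x.2)}.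
  exact: (continuous_comp c2 (@continuous_bump2 q l x.2)).
have d3 : {for x, continuous (fun x : R * R => cutinv (rho x))}.
  exact: (continuous_comp (@continuous_rho x) (@continuous_cutinv (rho x))).
have d4 : {for x, continuous (fun x : R * R => cutinv (rho x) ^+ m)}.
  exact: (continuous_comp d3 (@exprn_continuous R m _)).
exact: (continuousM (continuousM d1 d2) d4).
Qed.

Lemma test_measurable f : test f ->
  measurable_fun [set: measurableTypeR R * measurableTypeR R] (f : _ -> measurableTypeR R).
Proof.
elim => [p q k l m|{}f g _ cf _ cg]; last exact: measurable_funD.
under [X in measurable_fun _ X]eq_fun do rewrite test_termE.
have m1 := @measurable_fst _ _ (measurableTypeR R) (measurableTypeR R).
have m2 := @measurable_snd _ _ (measurableTypeR R) (measurableTypeR R).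
have mr : measurable_fun [set: measurableTypeR R * measurableTypeR R] (rho : _ -> measurableTypeR R).
  by apply: measurable_funD; apply: measurable_funX.
apply: measurable_funM; first apply: measurable_funM.
- apply: (measurableT_comp _ m1); apply: continuous_measurable_fun.
  exact: continuous_bump1.
- apply: (measurableT_comp _ m2); apply: continuous_measurable_fun.
  exact: continuous_bump2.
- apply: measurable_funX; apply: (measurableT_comp _ mr).
  by apply: continuous_measurable_fun; exact: continuous_cutinv.
Qed.

Lemma test_bounded f : test f -> exists2 M, 0 <= M & forall x, `|f x| <= M.
Proof.
elim => [p q k l m|{}f g _ [M M0 fM] _ [N N0 gN]]; last first.
  exists (M + N); rewrite ?addr_ge0// => x.
  by apply: le_trans (ler_normD _ _) _; rewrite lerD.
have [M M0 hM] := continuous_bounded_itv (al Q) (be Q) (@continuous_bump1 p k).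
have [N N0 hN] := continuous_bounded_itv (ga Q) (de Q) (@continuous_bump2 q l).
exists (M * N * (ka Q)^-1 ^+ m).
  by rewrite !mulr_ge0// exprn_ge0// invr_ge0 ltW// ka_gt0.
move=> x; have [rx|nx] := pselect (rect x); last first.
  rewrite (@test_out _ x (test_term p q k l m) nx) normr0.
  by rewrite !mulr_ge0// exprn_ge0// invr_ge0 ltW// ka_gt0.
have /andP[r1 r2] := (rectP x).1 rx.
rewrite !normrM; apply: ler_pM => //; first by apply: ler_pM => //; [exact: hM|exact: hN].
have r0 : 0 < rho x by rewrite (lt_le_trans (ka_gt0 Q))// rho_ge.
rewrite normrX; apply: lerXn2r; rewrite ?nnegrE// ?invr_ge0 ?(ltW (ka_gt0 Q))//.
by rewrite normfV gtr0_norm// lef_pV2 ?posrE// ?ka_gt0// rho_ge.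
Qed.

Lemma is_derive_inv_rho (x y : R) m : x ^+ 2 + y ^+ 2 != 0 ->
  is_derive x 1 (fun s => (s ^+ 2 + y ^+ 2)^-1 ^+ m)
    (- (2 * m%:R) * x * (x ^+ 2 + y ^+ 2)^-1 ^+ m.+1).
Proof.
move=> r0.
have dr : is_derive x 1 (fun s : R => s ^+ 2 + y ^+ 2) (2 * x).
  by apply: is_derive_eq; rewrite /GRing.scale/=; ring.
have dV := @is_deriveV R (fun s : R => s ^+ 2 + y ^+ 2) x _ 1 r0 dr.
have -> : (fun s : R => (s ^+ 2 + y ^+ 2)^-1 ^+ m) =
    ((fun s : R => (s ^+ 2 + y ^+ 2)^-1) ^+ m : R -> R).
  by apply/funext => s; rewrite exprfctE.
apply: (@is_derive_eq _ _ _ _ _ _ _ _ (@is_deriveX R R _ m x 1 _ dV)).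
case: m => [|m]; first by rewrite /GRing.scale/=; ring.
rewrite /GRing.scale/= !exprS; move: (_ ^+ m) (m.+1%:R) => A B; field.
by rewrite -!expr2.
Qed.

Lemma is_derive_term1 p q k l m x :
  is_derive x (unit_vec ax1)
    (fun x => bump1 p k x.1 * bump2 q l x.2 * (rho x)^-1 ^+ m)
    (bump1 (dbump (al Q) (be Q) (cc Q) p k) k.+2 x.1 * bump2 q l x.2 * (rho x)^-1 ^+ m +
     bump1 ((- (2 * m%:R)) *: ('X * p)) k x.1 * bump2 q l x.2 * (rho x)^-1 ^+ m.+1).
Proof.
apply/is_derive_axis1; rewrite /rho/=; case: x => x y /=.
have db : is_derive x 1 (bump1 p k) (bump1 (dbump (al Q) (be Q) (cc Q) p k) k.+2 x).
  exact/is_derive_bump/cc_gt0.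
(* Either the first bump vanishes near x, or x lies in [al, be], where x^2 >= [ka Q] > 0 and the
   powers of 1 / |xi|^2 are differentiable. *)
have [qx|qx] := leP 0 (quadp (al Q) (be Q)).[x]; last first.
  have cq := @continuous_horner R (quadp (al Q) (be Q)) x.
  have n1 : \forall s \near x, (quadp (al Q) (be Q)).[s] < 0.
    by move/cvgr_lt : cq => /(_ _ qx).
  rewrite /bump1 /bumpf !(ltNge 0) !(ltW qx)/= !mul0r addr0.
  apply: (@near_eq_is_derive _ _ _ (fun=> 0 : R)).
    by near=> s; rewrite (ltNge 0) ltW ?mul0r//; near: s.
have xi : al Q <= x <= be Q.
  move: qx; rewrite quadpE => qx; have ab := al_lt_be Q.
  by apply/andP; split; rewrite leNgt; apply/negP => h; nra.
have r0 : x ^+ 2 + y ^+ 2 != 0.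
  rewrite gt_eqF// ltr_pwDl ?sqr_ge0//.
  exact: lt_le_trans (ka_gt0 Q) (ka_le xi).
have di := is_derive_inv_rho m r0.
apply: is_derive_eq; rewrite /GRing.scale/= /bump1 bumpZ bumpX.
by ring.
Unshelve. all: by end_near.
Qed.

Lemma is_derive_term2 p q k l m x :
  is_derive x (unit_vec ax2)
    (fun x => bump1 p k x.1 * bump2 q l x.2 * (rho x)^-1 ^+ m)
    (bump1 p k x.1 * bump2 (dbump (ga Q) (de Q) (cc Q) q l) l.+2 x.2 * (rho x)^-1 ^+ m +
     bump1 p k x.1 * bump2 ((- (2 * m%:R)) *: ('X * q)) l x.2 * (rho x)^-1 ^+ m.+1).
Proof.
apply/is_derive_axis2; rewrite /rho/=; case: x => x y /=.
have db : is_derive y 1 (bump2 q l) (bump2 (dbump (ga Q) (de Q) (cc Q) q l) l.+2 y).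
  exact/is_derive_bump/cc_gt0.
have [qx|qx] := leP 0 (quadp (al Q) (be Q)).[x]; last first.
  rewrite /bump1 /bumpf !(ltNge 0) !(ltW qx)/= !mul0r addr0.
  rewrite (_ : (fun _ => _) = fun=> 0); first exact: is_derive_cst.
  by apply/funext => s; rewrite !mul0r.
have xi : al Q <= x <= be Q.
  move: qx; rewrite quadpE => qx; have ab := al_lt_be Q.
  by apply/andP; split; rewrite leNgt; apply/negP => h; nra.
have r0 : y ^+ 2 + x ^+ 2 != 0.
  rewrite addrC gt_eqF// ltr_pwDl ?sqr_ge0//.
  exact: lt_le_trans (ka_gt0 Q) (ka_le xi).
have di := is_derive_inv_rho m r0.
under eq_fun do rewrite addrC.
apply: is_derive_eq; rewrite /GRing.scale/= /bump2 bumpZ bumpX [x ^+ 2 + _]addrC.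
by ring.
Qed.

Lemma test_derive i f : test f ->
  exists2 g, test g & forall x, is_derive x (unit_vec i) f (g x).
Proof.
elim => [p q k l m|{}f g _ [f' tf' ff'] _ [g' tg' gg']]; last first.
  exists (fun x => f' x + g' x); first exact: test_add.
  by move=> x; exact: is_deriveD.
have [->|->] : i = ax1 \/ i = ax2.
  by case: i => -[|[|//]] ? ; [left|right]; exact/val_inj.
- eexists; last by move=> x; exact: is_derive_term1.
  by apply: test_add; exact: test_term.
- eexists; last by move=> x; exact: is_derive_term2.
  by apply: test_add; exact: test_term.
Qed.

Lemma test_partial i f : test f -> test (partial i f).
Proof.
move=> /(test_derive i)[g tg fg].
by rewrite (_ : partial i f = g)//; apply/funext => x; case: (fg x).
Qed.

Lemma test_is_derive i f x : test f -> is_derive x (unit_vec i) f (partial i f x).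
Proof.
by move=> /(test_derive i)[g _ /(_ x)[d _]]; exact: derivableP.
Qed.

End test_functions.

Section schwartz_family.
Context {R : realType}.

(** Every Schwartz weight of a member is the absolute value of another member, so boundedness of
    single members yields all seminorms. It is applied to the test functions and to their Fourier
    transforms. *)
Lemma schwartz_family (P : (R * R -> R) -> Prop) :
  (forall f, P f -> continuous f) ->
  (forall f i x, P f -> derivable f x (unit_vec i)) ->
  (forall f, P f -> exists M, forall x, `|f x| <= M) ->
  (forall f i, P f -> P (partial i f)) ->
  (forall f i, P f -> P (fun x => Defs.coord i x * f x)) ->
  forall f, P f -> schwartz f.
Proof.
move=> cP dP bP pP mP f Pf w.
have Pw : P (partials w f) by elim: w => [//|i w]; exact: pP.
split.
- exact: cP.
- by move=> i x; exact: dP.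
move=> k l.
have [g Pg gE] : exists2 g, P g & forall x, g x = x.1 ^+ k * x.2 ^+ l * partials w f x.
  elim: k => [|k [g Pg gE]].
    elim: l => [|l [g Pg gE]]; first by exists (partials w f) => // x; rewrite !mul1r.
    exists (fun x => Defs.coord ax2 x * g x); first exact: mP.
    by move=> x; rewrite gE exprS /Defs.coord/=; ring.
  exists (fun x => Defs.coord ax1 x * g x); first exact: mP.
  by move=> x; rewrite gE exprS /Defs.coord/=; ring.
have [M gM] := bP _ Pg; exists M => x.
by rewrite /schwartz_weight -gE.
Qed.

Lemma test_schwartz (Q : box R) f : test Q f -> schwartz f.
Proof.
apply: schwartz_family => {f}.
- exact: test_continuous.
- by move=> f i x /(@test_is_derive _ _ i _ x)[].
- by move=> f /test_bounded[M _ fM]; exists M.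
- by move=> f i; exact: test_partial.
- by move=> f i; exact: test_coord.
Qed.

End schwartz_family.

(** * Fourier transforms of test functions *)

Definition pmeas {R : realType} (f : R * R -> R) : Prop :=
  measurable_fun [set: measurableTypeR R * measurableTypeR R]
    (f : measurableTypeR R * measurableTypeR R -> measurableTypeR R).

Section bsupp.
Context {R : realType}.
Variable Q : box R.
Implicit Types (f g h psi : R * R -> R).

(** Wider than [test]: products of a test function with the kernels K and G are only handled as
    bounded measurable functions, and they stay in this class. *)
Definition bsupp psi : Prop :=
  [/\ pmeas psi, exists2 M, 0 <= M & forall x, `|psi x| <= M
    & forall x, ~ rect Q x -> psi x = 0].

Lemma test_bsupp psi : test Q psi -> bsupp psi.
Proof.
move=> t; split; [exact: test_measurable t|exact: test_bounded t|].
by move=> x; exact: test_out.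
Qed.

Lemma pmeas_cst (a : R) : pmeas (fun=> a). Proof. exact: measurable_cst. Qed.
Lemma pmeas1 : pmeas (fun x : R * R => x.1).
Proof. exact: (@measurable_fst _ _ (measurableTypeR R) (measurableTypeR R)). Qed.
Lemma pmeas2 : pmeas (fun x : R * R => x.2).
Proof. exact: (@measurable_snd _ _ (measurableTypeR R) (measurableTypeR R)). Qed.
Lemma pmeasD f g : pmeas f -> pmeas g -> pmeas (fun x => f x + g x).
Proof. exact: measurable_funD. Qed.
Lemma pmeasM f g : pmeas f -> pmeas g -> pmeas (fun x => f x * g x).
Proof. exact: measurable_funM. Qed.
Lemma pmeasX f n : pmeas f -> pmeas (fun x => f x ^+ n).
Proof. exact: measurable_funX. Qed.
Lemma pmeas_comp (k : R -> R) f : measurable_fun setT (k : measurableTypeR R -> measurableTypeR R) ->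
  pmeas f -> pmeas (fun x => k (f x)).
Proof. by move=> mk mf; exact: (measurableT_comp mk mf). Qed.
Lemma pmeas_continuous (k : R -> R) f : continuous k -> pmeas f -> pmeas (fun x => k (f x)).
Proof. by move=> ck; apply: pmeas_comp; exact: continuous_measurable_fun. Qed.
Lemma pmeasN f : pmeas f -> pmeas (fun x => - f x).
Proof. by apply: pmeas_continuous => x; exact: oppr_continuous. Qed.
Lemma pmeas_coord i : pmeas (@Defs.coord R i).
Proof. by rewrite /Defs.coord; case: (i == ax1); [exact: pmeas1|exact: pmeas2]. Qed.
Lemma pmeas_dotp (x : R * R) : pmeas (dotp x).
Proof.
by apply: pmeasD; apply: pmeasM; [exact: pmeas_cst|exact: pmeas1|exact: pmeas_cst|exact: pmeas2].
Qed.
Lemma pmeas_rho : pmeas (@rho R).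
Proof. by apply: pmeasD; apply: pmeasX; [exact: pmeas1|exact: pmeas2]. Qed.

Lemma measurable_rect : measurable (rect Q : set (measurableTypeR R * measurableTypeR R)).
Proof. by apply: measurableX; exact: measurable_itv. Qed.

Lemma leb2_rect : (leb2 (rect Q) < +oo)%E.
Proof.
rewrite /leb2 product_measure1E; [|exact: measurable_itv..].
have lt a b : (@lebesgue_measure R `[a, b]%classic < +oo)%E.
  by rewrite lebesgue_measure_itv /=; case: ifP => _; rewrite -?EFinB ltry.
apply: lte_mul_pinfty; [exact: measure_ge0| |exact: lt].
by rewrite ge0_fin_numE ?measure_ge0//; exact: lt.
Qed.

(* [h] is only tested against functions supported in the rectangle. *)
Definition rect_int h : Prop := pmeas h /\ leb2.-integrable (rect Q) (EFin \o h).

Lemma rect_int_cst a : rect_int (fun=> a).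
Proof.
split; first exact: pmeas_cst.
apply: measurable_bounded_integrable; first exact: measurable_rect.
- exact: leb2_rect.
- exact: measurable_cst.
- exists `|a|; split; first exact: num_real.
  by move=> M aM x _ /=; rewrite ltW.
Qed.

Lemma bsuppM psi g : pmeas g -> (exists M, forall x, rect Q x -> `|g x| <= M) ->
  bsupp psi -> bsupp (fun x => g x * psi x).
Proof.
move=> mg [M gM] [mp [N N0 pN] p0]; split.
- exact: pmeasM.
- exists (`|M| * N); first by rewrite mulr_ge0.
  move=> x; have [rx|nx] := pselect (rect Q x); last first.
    by rewrite p0// mulr0 normr0 mulr_ge0.
  rewrite normrM ler_pM//.
  exact: le_trans (gM _ rx) (ler_norm _).
- by move=> x /p0 ->; rewrite mulr0.
Qed.

Lemma bsuppD f g : bsupp f -> bsupp g -> bsupp (fun x => f x + g x).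
Proof.
move=> [mf [M M0 fM] f0] [mg [N N0 gN] g0]; split.
- exact: pmeasD.
- exists (M + N); first exact: addr_ge0.
  by move=> x; rewrite (le_trans (ler_normD _ _))// lerD.
- by move=> x nx; rewrite f0// g0// addr0.
Qed.

Lemma bsuppZ a f : bsupp f -> bsupp (fun x => a * f x).
Proof. by apply: bsuppM; [exact: pmeas_cst|exists `|a|]. Qed.

Lemma bsuppB f g : bsupp f -> bsupp g -> bsupp (fun x => f x - g x).
Proof.
move=> bf /(bsuppZ (-1)) bg; have := bsuppD bf bg.
by congr bsupp; apply/funext => x; rewrite mulN1r.
Qed.

Lemma bsupp_norm f : bsupp f -> bsupp (fun x => `|f x|).
Proof.
move=> [mf [M M0 fM] f0]; split.
- by apply: pmeas_continuous mf => x; exact: norm_continuous.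
- by exists M => // x; rewrite normr_id.
- by move=> x /f0 ->; rewrite normr0.
Qed.

Lemma integrable_bsupp h psi : rect_int h -> bsupp psi ->
  leb2.-integrable setT (EFin \o (fun x => h x * psi x)).
Proof.
move=> [mh ih] [mp [M M0 pM] p0].
have ih' : leb2.-integrable setT ((fun x => M%:E * (EFin \o h) x)%E \_ (rect Q)).
  apply: (integrable_mkcond _ measurable_rect).1.
  by apply: integrableZl => //; exact: measurable_rect.
apply: le_integrable ih' => //.
  by apply/measurable_EFinP; exact: pmeasM.
move=> x _ /=; rewrite /patch; case: ifPn => rx.
  by rewrite lee_fin mulrC !normrM ler_wpM2r// (le_trans (pM x))// ler_norm.
have -> : psi x = 0 by apply: p0; move: rx; rewrite notin_setE.
by rewrite mulr0 normr0 abse_ge0.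
Qed.

Lemma integrable_bsupp1 psi : bsupp psi -> leb2.-integrable setT (EFin \o psi).
Proof.
move=> b; have := integrable_bsupp (rect_int_cst 1) b.
by congr integrable; apply/funext => x /=; rewrite mul1r.
Qed.

Definition integ (f : R * R -> R) : R := Rintegral leb2 setT f.
Definition intg (f : R * R -> R) : Prop := leb2.-integrable setT (EFin \o f).

Lemma intg_bsupp psi : bsupp psi -> intg psi.
Proof. exact: integrable_bsupp1. Qed.

Lemma intgD f g : intg f -> intg g -> intg (fun x => f x + g x).
Proof. by move=> hf hg; exact: (integrableD measurableT hf hg). Qed.

Lemma intgB f g : intg f -> intg g -> intg (fun x => f x - g x).
Proof. by move=> hf hg; exact: (integrableB measurableT hf hg). Qed.

Lemma intgZ a f : intg f -> intg (fun x => a * f x).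
Proof. by move=> hf; exact: (integrableZl measurableT a hf). Qed.

Lemma integD f g : intg f -> intg g ->
  integ (fun x => f x + g x) = integ f + integ g.
Proof. by move=> ? ?; rewrite /integ RintegralD. Qed.

Lemma integB f g : intg f -> intg g ->
  integ (fun x => f x - g x) = integ f - integ g.
Proof. by move=> ? ?; rewrite /integ RintegralB. Qed.

Lemma integZ a f : intg f -> integ (fun x => a * f x) = a * integ f.
Proof. by move=> ?; rewrite /integ RintegralZl. Qed.

Lemma eq_integ f g : (forall x, f x = g x) -> integ f = integ g.
Proof. by move=> fg; congr integ; apply/funext. Qed.

Lemma le_norm_integ f g : intg f -> intg g -> (forall x, `|f x| <= g x) ->
  `|integ f| <= integ g.
Proof.
move=> mf mg fg; apply: (le_trans (le_normr_Rintegral _ mf)) => //.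
apply: le_Rintegral => //.
by move/integrable_norm : mf.
Qed.

End bsupp.

Section fourier.
Context {R : realType}.
Variable Q : box R.
Implicit Types (f g h psi : R * R -> R) (phi : R).

(** Fubini with the first variable inside; on each horizontal line the fundamental theorem of
    calculus gives the difference of [f] at the two ends, where it vanishes. *)
Lemma bsupp_integ_partial1 f df :
  (forall x, is_derive x (unit_vec ax1) f (df x)) -> continuous df ->
  (forall x, ~~ ((al Q < x.1 < be Q) && (ga Q < x.2 < de Q)) -> f x = 0) ->
  bsupp Q df -> integ df = 0.
Proof.
move=> fdf cdf f0 bdf; have idf := integrable_bsupp1 bdf.
rewrite /integ /Rintegral -[RHS]/(fine 0); congr fine.
rewrite -[LHS](integral21_prod_meas1 idf).
apply: integral0_eq => y _; rewrite /fubini_G/=.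
have -> : (\int[@lebesgue_measure R]_x (df (x, y))%:E =
  \int[@lebesgue_measure R]_(x in `[al Q, be Q]) (df (x, y))%:E)%E.
  rewrite [RHS]integral_mkcond; apply: eq_integral => x _; rewrite /patch.
  case: ifPn => // xi; case: bdf => _ _ ->//.
  by move=> /rectP/andP[/= xi' _]; move: xi; rewrite notin_setE/= in_itv/= xi'.
have ds (s : R) : is_derive s 1 (fun s => f (s, y)) (df (s, y)).
  by apply/(is_derive_axis1 f (s, y)).
have cf : continuous (fun s => f (s, y)) by apply: is_derive_continuous.
rewrite (@continuous_FTC2 _ _ (fun s => f (s, y)))//.
- by rewrite !f0 ?subee//= ?ltxx ?andbF.
- exact: al_lt_be.
- apply: continuous_subspaceT => s.
  apply: (continuous_comp (f := fun s => (s, y)) _ (cdf (s, y))).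
  exact: (cvg_pair (G := nbhs s) cvg_id (cvg_cst y)).
- split.
  + by move=> s _; case: (ds s).
  + by apply: cvg_at_right_filter; exact: cf.
  + by apply: cvg_at_left_filter; exact: cf.
- by move=> s _; rewrite derive1E; case: (ds s).
Qed.

Lemma bsupp_integ_partial2 f df :
  (forall x, is_derive x (unit_vec ax2) f (df x)) -> continuous df ->
  (forall x, ~~ ((al Q < x.1 < be Q) && (ga Q < x.2 < de Q)) -> f x = 0) ->
  bsupp Q df -> integ df = 0.
Proof.
move=> fdf cdf f0 bdf; have idf := integrable_bsupp1 bdf.
rewrite /integ /Rintegral -[RHS]/(fine 0); congr fine.
rewrite -[LHS](integral12_prod_meas1 idf).
apply: integral0_eq => x _; rewrite /fubini_F/=.
have -> : (\int[@lebesgue_measure R]_y (df (x, y))%:E =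
  \int[@lebesgue_measure R]_(y in `[ga Q, de Q]) (df (x, y))%:E)%E.
  rewrite [RHS]integral_mkcond; apply: eq_integral => y _; rewrite /patch.
  case: ifPn => // xi; case: bdf => _ _ ->//.
  by move=> /rectP/andP[/= _ xi']; move: xi; rewrite notin_setE/= in_itv/= xi'.
have ds (s : R) : is_derive s 1 (fun s => f (x, s)) (df (x, s)).
  by apply/(is_derive_axis2 f (x, s)).
have cf : continuous (fun s => f (x, s)) by apply: is_derive_continuous.
rewrite (@continuous_FTC2 _ _ (fun s => f (x, s)))//.
- by rewrite !f0 ?subee//= ?ltxx ?andbF.
- exact: ga_lt_de.
- apply: continuous_subspaceT => s.
  apply: (continuous_comp (f := fun s => (x, s)) _ (cdf (x, s))).
  exact: (cvg_pair (G := nbhs x) (cvg_cst x) cvg_id).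
- split.
  + by move=> s _; case: (ds s).
  + by apply: cvg_at_right_filter; exact: cf.
  + by apply: cvg_at_left_filter; exact: cf.
- by move=> s _; rewrite derive1E; case: (ds s).
Qed.

Lemma integ_partial i f df :
  (forall x, is_derive x (unit_vec i) f (df x)) -> continuous df ->
  (forall x, ~~ ((al Q < x.1 < be Q) && (ga Q < x.2 < de Q)) -> f x = 0) ->
  bsupp Q df -> integ df = 0.
Proof.
have [->|->] : i = ax1 \/ i = ax2.
  by case: i => -[|[|//]] ? ; [left|right]; exact/val_inj.
- exact: bsupp_integ_partial1.
- exact: bsupp_integ_partial2.
Qed.

(* The real and imaginary parts of the Fourier transform are the cases
   [phi = 0] and [phi = pi / 2]. *)
Definition four phi psi (x : R * R) : R :=
  integ (fun xi => cos (dotp x xi + phi) * psi xi).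

Lemma four_re psi : fourier_re psi = four 0 psi.
Proof.
by apply/funext => x; apply: eq_Rintegral => xi _; rewrite addr0.
Qed.

Lemma bsupp_cos phi x psi : bsupp Q psi ->
  bsupp Q (fun xi => cos (dotp x xi + phi) * psi xi).
Proof.
move=> bp; apply: bsuppM bp; last by exists 1 => xi _; exact: cos_max.
apply: (@pmeas_continuous _ cos); first exact: continuous_cos.
by apply: pmeasD; [exact: pmeas_dotp|exact: pmeas_cst].
Qed.

Lemma four_im psi : bsupp Q psi -> fourier_im psi = four (pi / 2) psi.
Proof.
move=> bp; apply/funext => x; rewrite /fourier_im -/(integ _) /four.
have -> : integ (fun xi => sin (dotp x xi) * psi xi) =
    -1 * integ (fun xi => cos (dotp x xi + pi / 2) * psi xi).
  rewrite -integZ; last exact: intg_bsupp (bsupp_cos _ _ bp).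
  by apply: eq_integ => xi; rewrite cosDpihalf; ring.
by rewrite mulN1r opprK.
Qed.

Lemma fourN phi psi : bsupp Q psi -> four (phi + pi) psi = four phi (fun x => - psi x).
Proof.
by move=> bp; apply/funext => x; apply: eq_Rintegral => xi _; rewrite addrA cosDpi mulrN mulNr.
Qed.

Lemma bounded_coord i : exists M, forall x, rect Q x -> `|Defs.coord i x| <= M.
Proof.
have [M _ hM] := @continuous_bounded_itv R (fun x => x) (al Q) (be Q) (fun _ => cvg_id).
have [N _ hN] := @continuous_bounded_itv R (fun x => x) (ga Q) (de Q) (fun _ => cvg_id).
rewrite /Defs.coord; case: (i == ax1); [exists M|exists N] => x /rectP/andP[? ?].
  exact: hM.
exact: hN.
Qed.

Lemma bsupp_coord i psi : bsupp Q psi -> bsupp Q (fun x => Defs.coord i x * psi x).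
Proof. by apply: bsuppM; [exact: pmeas_coord|exact: bounded_coord]. Qed.

Lemma sin_lip (a b : R) : `|sin a - sin b| <= `|a - b|.
Proof.
wlog ab : a b / b <= a.
  by move=> H; have [/H//|/ltW/H] := leP b a; rewrite distrC [leRHS]distrC.
have [c _ ->] := MVT_segment ab (fun x _ => is_derive_sin x) (continuous_subspaceT (@continuous_sin R)).
by rewrite normrM ler_piMl// cos_max.
Qed.

Lemma cos_lip (a b : R) : `|cos a - cos b| <= `|a - b|.
Proof.
by rewrite -!sinDpihalf (le_trans (sin_lip _ _))// opprD addrACA subrr addr0.
Qed.

(** Mean value theorem for w |-> cos (u + w) + w sin u, whose derivative sin u - sin (u + w) is at
    most |w|; this costs the factor 1/2 of Taylor's formula, which does not matter here. *)
Lemma cos_taylor (u v : R) : `|cos (u + v) - cos u + v * sin u| <= v ^+ 2.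
Proof.
wlog v0 : u v / 0 <= v.
  move=> H; have [/H//|/ltW v0] := leP 0 v.
  have := H (- u) (- v); rewrite oppr_ge0 => /(_ v0).
  by rewrite -opprD !cosN sinN mulrNN sqrrN.
pose f w := cos (u + w) + w * sin u.
have fd (w : R) : is_derive w 1 f (sin u - sin (u + w)).
  by apply: is_derive_eq; rewrite /GRing.scale/=; ring.
have [c c0v e] := MVT_segment v0 (fun x _ => fd x) (continuous_subspaceT (is_derive_continuous fd)).
have -> : cos (u + v) - cos u + v * sin u = f v - f 0.
  by rewrite /f addr0 mul0r addr0 addrAC.
rewrite e subr0 normrM expr2 (ger0_norm v0) ler_wpM2r//.
rewrite (le_trans (sin_lip _ _))// opprD addrA subrr add0r normrN ger0_norm (itvP c0v)//.
Qed.

Lemma dotp_shift i (h : R) (x xi : R * R) :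
  dotp (h *: (unit_vec i : R * R) + x) xi = dotp x xi + h * Defs.coord i xi.
Proof.
rewrite /dotp /unit_vec /Defs.coord; case: (i == ax1); case: x => x y /=;
  rewrite /GRing.scale/= /scale_pair/= /GRing.scale/=; ring.
Qed.

(** Since - sin is cos shifted by pi / 2, differentiating turns the phase by a quarter. The
    remainder is at most h^2 times the integral of |xi_i^2 psi|. *)
Lemma is_derive_four i phi psi x : bsupp Q psi ->
  is_derive x (unit_vec i) (four phi psi)
    (four (phi + pi / 2) (fun xi => Defs.coord i xi * psi xi) x).
Proof.
move=> bp; have bc := bsupp_coord i bp; have bcc := bsupp_coord i bc.
apply: (@is_derive_quadratic _ _ _ _ _ _
  (integ (fun xi => `|Defs.coord i xi * (Defs.coord i xi * psi xi)|))) => h _.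
have i1 := intg_bsupp (bsupp_cos phi (h *: unit_vec i + x) bp).
have i2 := intg_bsupp (bsupp_cos phi x bp).
have i3 := intg_bsupp (bsupp_cos (phi + pi / 2) x bc).
have i4 := intg_bsupp (bsupp_norm bcc).
rewrite /four -integB// -integZ// -integB//; [|exact: intgB|exact: intgZ].
rewrite [leRHS]mulrC -integZ//; apply: le_norm_integ.
- by apply: intgB; [exact: intgB|exact: intgZ].
- exact: intgZ.
- move=> xi; rewrite addrA cosDpihalf dotp_shift.
  set c := Defs.coord i xi; rewrite (addrAC (dotp x xi) _ phi); set u := dotp x xi + phi.
  rewrite (_ : _ - _ = psi xi * (cos (u + h * c) - cos u + (h * c) * sin u)); last by ring.
  rewrite (_ : _ * `|_| = `|psi xi| * (h * c) ^+ 2); last first.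
    by rewrite !normrM exprMn -[c ^+ 2](real_normK (num_real c)); ring.
  by rewrite normrM ler_wpM2l// cos_taylor.
Qed.

Lemma continuous_four phi psi : bsupp Q psi -> continuous (four phi psi).
Proof.
move=> bp x.
have b1 := bsupp_norm (bsupp_coord ax1 bp); have b2 := bsupp_norm (bsupp_coord ax2 bp).
pose C1 := integ (fun xi => `|Defs.coord ax1 xi * psi xi|).
pose C2 := integ (fun xi => `|Defs.coord ax2 xi * psi xi|).
have lip y : `|four phi psi x - four phi psi y| <=
    `|x.1 - y.1| * C1 + `|x.2 - y.2| * C2.
  have ix := intg_bsupp (bsupp_cos phi x bp).
  have iy := intg_bsupp (bsupp_cos phi y bp).
  have j1 := intg_bsupp b1; have j2 := intg_bsupp b2.
  rewrite /four -integB// -!integZ// -integD; [|exact: intgZ|exact: intgZ].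
  apply: le_norm_integ; [exact: intgB|by apply: intgD; exact: intgZ|].
  move=> xi; rewrite -mulrBl normrM.
  apply: (@le_trans _ _ (`|(x.1 - y.1) * xi.1 + (x.2 - y.2) * xi.2| * `|psi xi|)).
    rewrite ler_wpM2r// (le_trans (cos_lip _ _))//.
    by rewrite (_ : _ - _ = (x.1 - y.1) * xi.1 + (x.2 - y.2) * xi.2)// /dotp; ring.
  rewrite !normrM /Defs.coord/= !mulrA -mulrDl ler_wpM2r//.
  by rewrite -!normrM ler_normD.
have C10 : 0 <= C1 by apply: Rintegral_ge0.
have C20 : 0 <= C2 by apply: Rintegral_ge0.
apply/cvgrPdist_le => e e0.
have d0 : 0 < e / (C1 + C2 + 1) by rewrite divr_gt0// ltr_wpDl// addr_ge0.
have n1 : \forall y \near x, `|x.1 - y.1| <= e / (C1 + C2 + 1).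
  have c1 : (fun x : R * R => x.1) y @[y --> x] --> x.1 by exact: cvg_fst.
  by move/cvgrPdist_le : c1; apply.
have n2 : \forall y \near x, `|x.2 - y.2| <= e / (C1 + C2 + 1).
  have c2 : (fun x : R * R => x.2) y @[y --> x] --> x.2 by exact: cvg_snd.
  by move/cvgrPdist_le : c2; apply.
near=> y; apply: (le_trans (lip y)).
apply: (@le_trans _ _ (e / (C1 + C2 + 1) * C1 + e / (C1 + C2 + 1) * C2)).
  by apply: lerD; apply: ler_wpM2r => //; near: y.
rewrite -mulrDr mulrAC ler_pdivrMr; last by rewrite ltr_wpDl// addr_ge0.
by rewrite ler_wpM2l ?(ltW e0)// lerDl.
Unshelve. all: by end_near.
Qed.

Lemma continuous_dotp (x : R * R) : continuous (dotp x).
Proof.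
move=> y; have c1 : {for y, continuous (fun x : R * R => x.1)} by exact: cvg_fst.
have c2 : {for y, continuous (fun x : R * R => x.2)} by exact: cvg_snd.
have k1 : {for y, continuous (fun _ : R * R => x.1)} by exact: cvg_cst.
have k2 : {for y, continuous (fun _ : R * R => x.2)} by exact: cvg_cst.
exact: (continuousD (continuousM k1 c1) (continuousM k2 c2)).
Qed.

Lemma continuous_cos_dotp phi (x : R * R) : continuous (fun xi => cos (dotp x xi + phi)).
Proof.
move=> y; have c1 : {for y, continuous (fun _ : R * R => phi)} by exact: cvg_cst.
have := continuousD (@continuous_dotp x y) c1.
by move=> /(continuous_comp)/(_ (@continuous_cos R _)).
Qed.

Lemma is_derive_sin_dotp i phi (x xi : R * R) :
  is_derive xi (unit_vec i) (fun xi => sin (dotp x xi + phi))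
     (Defs.coord i x * cos (dotp x xi + phi)).
Proof.
apply: (@is_derive_quadratic _ _ _ _ _ _ (Defs.coord i x ^+ 2)) => h _.
have dC (y z : R * R) : dotp y z = dotp z y by rewrite /dotp mulrC [y.2 * _]mulrC.
rewrite dC dotp_shift -dC (addrAC (dotp x xi) _ phi).
set u := dotp x xi + phi; set v := h * Defs.coord i x.
have := cos_taylor (u + pi / 2) v.
rewrite sinDpihalf (addrAC u (pi / 2) v) !cosDpihalf.
rewrite (_ : - sin _ - - sin u + v * cos u = - (sin (u + v) - sin u - v * cos u)); last by ring.
by rewrite normrN mulrA -exprMn [Defs.coord i x * h]mulrC.
Qed.

(** Integration by parts: the difference of the two integrands is the derivative along xi_i of sin
    (x.xi + phi) psi, which is supported in the rectangle. *)
Lemma mul_coord_four i phi psi x : test Q psi ->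
  Defs.coord i x * four phi psi x = four (phi + pi / 2) (partial i psi) x.
Proof.
move=> tp; have bp := test_bsupp tp; have bd := test_bsupp (test_partial i tp).
rewrite /four -integZ; last exact: intg_bsupp (bsupp_cos _ _ bp).
apply/eqP; rewrite -subr_eq0 -integB; last 2 first.
- by apply: intgZ; exact: intg_bsupp (bsupp_cos _ _ bp).
- exact: intg_bsupp (bsupp_cos _ _ bd).
apply/eqP; apply: (@integ_partial i (fun xi => sin (dotp x xi + phi) * psi xi)).
- move=> xi; have dp := test_is_derive i xi tp.
  have ds := is_derive_sin_dotp i phi x xi.
  by apply: is_derive_eq; rewrite /GRing.scale/= addrA cosDpihalf; ring.
- have cp := test_continuous tp; have cd := test_continuous (test_partial i tp).
  move=> y; have k1 : {for y, continuous (fun _ : R * R => Defs.coord i x)} by exact: cvg_cst.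
  have c1 := continuousM (@continuous_cos_dotp phi x y) (cp y).
  have c2 := continuousM (@continuous_cos_dotp (phi + pi / 2) x y) (cd y).
  exact: (continuousB (continuousM k1 c1) c2).
- move=> xi h; have /eqP -> : psi xi == 0; last by rewrite mulr0.
  by apply: contraNT h; exact: test_supp.
- by apply: bsuppB; [apply: bsuppZ|]; exact: bsupp_cos.
Qed.

(** All phases have to be taken together, since derivatives and multiplications by coordinates both
    shift the phase by pi / 2. *)
Lemma schwartz_four phi psi : test Q psi -> schwartz (four phi psi).
Proof.
move=> tp.
apply: (@schwartz_family R (fun f => exists phi' psi', test Q psi' /\ f = four phi' psi')).
- by move=> f [p [g [tg ->]]]; exact: continuous_four (test_bsupp tg).
- by move=> f i x [p [g [tg ->]]]; case: (is_derive_four i p x (test_bsupp tg)).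
- move=> f [p [g [tg ->]]]; have bg := test_bsupp tg.
  exists (integ (fun xi => `|g xi|)) => x; apply: le_norm_integ.
  + exact: intg_bsupp (bsupp_cos _ _ bg).
  + exact: intg_bsupp (bsupp_norm bg).
  + by move=> xi; rewrite normrM ler_piMl// cos_max.
- move=> f i [p [g [tg ->]]].
  exists (p + pi / 2), (fun xi => Defs.coord i xi * g xi); split.
    exact: test_coord.
  by apply/funext => x; case: (is_derive_four i p x (test_bsupp tg)).
- move=> f i [p [g [tg ->]]]; exists (p + pi / 2), (partial i g); split.
    exact: test_partial.
  by apply/funext => x; exact: mul_coord_four.
- by exists phi, psi.
Qed.

Lemma partial2_four i phi psi : test Q psi ->
  partial i (partial i (four phi psi)) =
  four phi (fun xi => - Defs.coord i xi ^+ 2 * psi xi).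
Proof.
move=> tp; have bp := test_bsupp tp; have bc := bsupp_coord i bp.
have e p g : bsupp Q g -> partial i (four p g) =
    four (p + pi / 2) (fun xi => Defs.coord i xi * g xi).
  by move=> bg; apply/funext => x; case: (is_derive_four i p x bg).
rewrite !e// -addrA (_ : pi / 2 + pi / 2 = pi); last by field.
rewrite fourN; last exact: bsupp_coord.
by congr four; apply/funext => x; ring.
Qed.

End fourier.

(** * Uniqueness for the tested system *)

Section uniqueness.
Context {R : realType}.
Variable Q : box R.

(** The gain of one power of t and of the factor 1 / (n + 1) produces the factorial in the
    iteration. At t = 0 only the limit from the right is available. *)
Lemma growth (f df : R -> R) (T c : R) (n : nat) : 0 <= c ->
  (forall t : R, 0 < t -> is_derive t 1 f (df t)) -> f t @[t --> 0^'+] --> 0 ->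
  (forall t, 0 < t <= T -> `|df t| <= c * t ^+ n) ->
  forall t, 0 < t <= T -> `|f t| <= c / n.+1%:R * t ^+ n.+1.
Proof.
move=> c0; have upper (g dg : R -> R) : (forall t : R, 0 < t -> is_derive t 1 g (dg t)) ->
  g t @[t --> 0^'+] --> 0 -> (forall t, 0 < t <= T -> dg t <= c * t ^+ n) ->
  forall t, 0 < t <= T -> g t <= c / n.+1%:R * t ^+ n.+1.
  move=> gdg g0 gc t /andP[t0 tT].
  pose h s := c / n.+1%:R * s ^+ n.+1 - g s.
  have hd (s : R) : 0 < s -> is_derive s 1 h (c * s ^+ n - dg s).
    move=> s0; have ? := gdg s s0.
    have dX : is_derive s 1 (fun s : R => s ^+ n.+1) (n.+1%:R * s ^+ n).
      have -> : (fun s : R => s ^+ n.+1) = (id ^+ n.+1 : R -> R).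
        by apply/funext => y; rewrite exprfctE.
      apply: (@is_derive_eq _ _ _ _ _ _ _ _ (@is_deriveX R R id n.+1 s 1 _ (is_derive_id _ _))).
      by rewrite /GRing.scale/= mulr1.
    apply: is_derive_eq; rewrite /GRing.scale/=; field.
    by rewrite nat1r pnatr_eq0.
  (* [h] is nondecreasing on [e, t] and h e >= - g e; letting e tend to 0 from the right gives h t
     >= 0. *)
  have he e : 0 < e < t -> - g e <= h t.
    move=> /andP[e0 et].
    have hd' x : x \in `]e, t[ -> is_derive x 1 h (c * x ^+ n - dg x).
      by move=> /itvP xe; apply: hd; rewrite (lt_trans e0)// xe.
    have ch : {within `[e, t], continuous h}.
      apply: derivable_within_continuous => x /itvP xe.
      by case: (hd x) => //; rewrite (lt_le_trans e0)// xe.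
    have [x /itvP xe E] := MVT et hd' ch.
    have : 0 <= h t - h e.
      rewrite E mulr_ge0 ?subr_ge0 ?(ltW et)//; apply: gc.
      by rewrite (lt_trans e0) ?xe//= (le_trans _ tT)// xe.
    rewrite subr_ge0 => /(le_trans _); apply.
    rewrite /h lerDr; apply: mulr_ge0; first exact: divr_ge0.
    by apply: exprn_ge0; exact: ltW.
  have : 0 <= h t.
    have g0' : (- g) e @[e --> 0^'+] --> - 0 by exact: cvgN.
    rewrite oppr0 in g0'; apply: (cvgr_to_le g0').
    near=> e; apply: he; apply/andP; split; near: e.
      exact: nbhs_right_gt.
    exact: nbhs_right_lt.
  by rewrite /h subr_ge0.
move=> fd f0 fc t tT; rewrite ler_norml; apply/andP; split.
  rewrite lerNl; apply: (upper (- f) (- df)) => //.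
  - by move=> s s0; have ? := fd s s0; exact: is_deriveN.
  - have : (- f) s @[s --> 0^'+] --> - 0 by exact: cvgN.
    by rewrite oppr0.
  - by move=> s sT; rewrite (le_trans (ler_norm _))// normrN fc.
apply: (upper f df) => //.
by move=> s sT; rewrite (le_trans (ler_norm _))// fc.
Unshelve. all: by end_near.
Qed.

(* The first-order system X' = Y - X A, Y' = - X B with zero initial data,
   where A and B are bounded multipliers: iterating it gives
   |X| + |Y| = O(((1 + L) t)^n / n!) for all n. *)
Lemma system_uniqueness (A B : R * R -> R) (T L K : R)
    (X Y : (R * R -> R) -> R -> R) :
  0 <= T -> 0 <= L -> 0 <= K ->
  (forall psi, test Q psi -> test Q (fun x => A x * psi x)) ->
  (forall psi, test Q psi -> test Q (fun x => B x * psi x)) ->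
  (forall x, rect Q x -> `|A x| <= L) -> (forall x, rect Q x -> `|B x| <= L) ->
  (forall psi, test Q psi -> forall t : R, 0 < t ->
     is_derive t 1 (X psi) (Y psi t - X (fun x => A x * psi x) t)) ->
  (forall psi, test Q psi -> forall t : R, 0 < t ->
     is_derive t 1 (Y psi) (- X (fun x => B x * psi x) t)) ->
  (forall psi, test Q psi -> X psi t @[t --> 0^'+] --> 0) ->
  (forall psi, test Q psi -> Y psi t @[t --> 0^'+] --> 0) ->
  (forall psi b, test Q psi -> (forall x, `|psi x| <= b) ->
     forall t, 0 < t <= T -> `|X psi t| <= K * b) ->
  forall psi, test Q psi -> forall t, 0 < t <= T -> X psi t = 0.
Proof.
move=> T0 L0 K0 tA tB AL BL dX dY X0 Y0 XK.
have mulL C psi b : (forall x, rect Q x -> `|C x| <= L) -> test Q psi ->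
    (forall x, `|psi x| <= b) -> forall x, `|C x * psi x| <= L * b.
  move=> CL tp pb x; have [rx|nx] := pselect (rect Q x).
    by rewrite normrM ler_pM// CL.
  by rewrite (test_out tp nx) mulr0 normr0 mulr_ge0// (le_trans _ (pb x)).
(* [K'] starts the induction for both unknowns: |X| <= K b directly, and |Y| <= K L b T by
   integrating Y' = - X B. [La] is the cost of one step, since X' contains Y and one application of
   A. *)
pose K' := K * (1 + L * T); pose La := 1 + L.
have K'0 : 0 <= K' by rewrite mulr_ge0// addr_ge0// mulr_ge0.
have La0 : 0 <= La by rewrite addr_ge0.
(* [psi] and [b] stay general because the induction hypothesis is used for A psi and B psi, with the
   bound L b. *)
have main n : forall psi b, test Q psi -> (forall x, `|psi x| <= b) ->
    forall t, 0 < t <= T ->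
    `|X psi t| <= K' * b * La ^+ n / n`!%:R * t ^+ n /\
    `|Y psi t| <= K' * b * La ^+ n / n`!%:R * t ^+ n.
  elim: n => [|n IH] psi b tp pb t tT; have /andP[t0 tT'] := tT;
    have b0 : 0 <= b by apply: le_trans (pb (0, 0)).
  - rewrite !expr0 fact0 divr1 !mulr1; split.
      apply: (le_trans (XK _ _ tp pb _ tT)); rewrite ler_wpM2r//.
      by rewrite /K' ler_peMr// lerDl mulr_ge0.
    have := @growth (Y psi) _ T (K * (L * b)) 0 _ (dY _ tp) (Y0 _ tp) _ t tT.
    rewrite divr1 expr1 => H; apply: (le_trans (H _ _)).
    + by rewrite !mulr_ge0.
    + move=> s sT; rewrite normrN expr0 mulr1; apply: XK sT; first exact: tB.
      exact: mulL.
    + apply: (@le_trans _ _ (K * (L * b) * T)); first by rewrite ler_wpM2l// !mulr_ge0.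
      rewrite /K' -subr_ge0.
      by rewrite (_ : _ - _ = K * b); [rewrite mulr_ge0|ring].
  - have cf : K' * b * La ^+ n.+1 / n.+1`!%:R = K' * b * La ^+ n.+1 / n`!%:R / n.+1%:R.
      by rewrite factS natrM invfM mulrA mulrAC.
    have c0 : 0 <= K' * b * La ^+ n.+1 / n`!%:R.
      by apply: divr_ge0 => //; apply: mulr_ge0; [exact: mulr_ge0|exact: exprn_ge0].
    have c0' : 0 <= K' * b * La ^+ n / n`!%:R.
      by apply: divr_ge0 => //; apply: mulr_ge0; [exact: mulr_ge0|exact: exprn_ge0].
    rewrite cf; split.
      apply: (growth c0 (dX _ tp) (X0 _ tp)) tT => s sT; have /andP[s0 _] := sT.
      rewrite (le_trans (ler_normB _ _))//.
      have := (IH _ _ tp pb _ sT).2.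
      have := (IH _ _ (tA _ tp) (mulL _ _ _ AL tp pb) _ sT).1.
      have -> : K' * (L * b) * La ^+ n / n`!%:R * s ^+ n =
          L * (K' * b * La ^+ n / n`!%:R * s ^+ n) by ring.
      have -> : K' * b * La ^+ n.+1 / n`!%:R * s ^+ n =
          (1 + L) * (K' * b * La ^+ n / n`!%:R * s ^+ n) by rewrite exprS /La; ring.
      by move: (_ * s ^+ n) => Z; lra.
    apply: (growth c0 (dY _ tp) (Y0 _ tp)) tT => s sT; have /andP[s0 _] := sT.
    rewrite normrN; apply: (le_trans (IH _ _ (tB _ tp) (mulL _ _ _ BL tp pb) _ sT).1).
    have -> : K' * (L * b) * La ^+ n / n`!%:R * s ^+ n =
        L * (K' * b * La ^+ n / n`!%:R * s ^+ n) by ring.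
    have -> : K' * b * La ^+ n.+1 / n`!%:R * s ^+ n =
        (1 + L) * (K' * b * La ^+ n / n`!%:R * s ^+ n) by rewrite exprS /La; ring.
    have : 0 <= K' * b * La ^+ n / n`!%:R * s ^+ n by rewrite mulr_ge0// exprn_ge0// ltW.
    by move: (_ * s ^+ n) => Z; lra.
move=> psi tp t tT; have [b b0 pb] := test_bounded tp.
have lim0 : K' * b * exp_coeff (La * t) n @[n --> \oo] --> 0.
  rewrite -(mulr0 (K' * b)); apply: cvgMr; exact: cvg_exp_coeff.
apply/eqP; rewrite -normr_le0; apply: (cvgr_to_ge lim0).
apply: nearW => n; apply: (le_trans (main n _ _ tp pb _ tT).1).
by rewrite /exp_coeff/= exprMn le_eqVlt; apply/orP; left; apply/eqP; ring.
Qed.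

End uniqueness.

(** * Explicit solution *)

Section measurable_kernels.
Context {R : realType}.
Implicit Types (f g : R * R -> R).

Lemma pmeasV f : pmeas f -> pmeas (fun x => (f x)^-1).
Proof.
(* The square makes the base nonnegative, where the measurable function [powR] is the true power;
   both sides are 0 where f vanishes. *)
move=> mf; have e x : (f x)^-1 = f x * (f x ^+ 2) `^ (- 1).
  have [->|f0] := eqVneq (f x) 0; first by rewrite invr0 mul0r.
  rewrite powRN powRr1 ?sqr_ge0// expr2 invfM mulrA divff// mul1r//.
under [X in pmeas X]eq_fun do rewrite e.
apply: pmeasM => //; apply: (@pmeas_comp _ (fun y => y `^ (- 1))).
  exact: measurable_powR.
exact: pmeasX.
Qed.

Lemma pmeas_if f g h k : pmeas f -> pmeas g -> pmeas h -> pmeas k ->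
  pmeas (fun x : R * R => if f x < g x then h x else k x).
Proof.
by move=> mf mg mh mk; apply: measurable_fun_ifT => //; exact: measurable_fun_ltr.
Qed.

Lemma pmeas_sqrt f : pmeas f -> pmeas (fun x => Num.sqrt (f x)).
Proof. by apply: (@pmeas_continuous _ Num.sqrt) => x; exact: sqrt_continuous. Qed.

Lemma pmeas_expR f : pmeas f -> pmeas (fun x => expR (f x)).
Proof. by apply: (@pmeas_continuous _ expR) => x; exact: continuous_expR. Qed.

Lemma pmeasB f g : pmeas f -> pmeas g -> pmeas (fun x => f x - g x).
Proof. by move=> mf mg; apply: pmeasD => //; exact: pmeasN. Qed.

Lemma pmeas_sinhc f t : pmeas f -> pmeas (fun x => sinhc (f x) t).
Proof.
move=> mf; have m0 := @pmeas_cst R 0; have mt := @pmeas_cst R t.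
have ms := pmeas_sqrt mf; have ms' := pmeas_sqrt (pmeasN mf).
apply: pmeas_if => //; last apply: pmeas_if => //.
- apply: pmeasM; last by apply: pmeasV; apply: pmeasM => //; exact: pmeas_cst.
  by apply: pmeasB; apply: pmeas_expR; [|apply: pmeasN]; exact: pmeasM.
- apply: pmeasM; last exact: pmeasV.
  by apply: (@pmeas_continuous _ sin); [exact: continuous_sin|exact: pmeasM].
Qed.

Lemma pmeas_coshc f t : pmeas f -> pmeas (fun x => coshc (f x) t).
Proof.
move=> mf; have m0 := @pmeas_cst R 0; have mt := @pmeas_cst R t.
have ms := pmeas_sqrt mf; have ms' := pmeas_sqrt (pmeasN mf).
apply: pmeas_if => //; last apply: pmeas_if => //.
- apply: pmeasM; last exact: pmeas_cst.
  by apply: pmeasD; apply: pmeas_expR; [|apply: pmeasN]; exact: pmeasM.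
- by apply: (@pmeas_continuous _ cos); [exact: continuous_cos|exact: pmeasM].
- exact: pmeas_cst.
Qed.

Variables a b r : R * R -> R.
Hypotheses (ma : pmeas a) (mb : pmeas b) (mr : pmeas r).

Lemma pmeas_disc : pmeas (fun x => disc (a x) (b x) (r x)).
Proof.
apply: pmeasB => //; apply: pmeasX; apply: pmeasM; last exact: pmeas_cst.
exact: pmeasB.
Qed.

Lemma pmeas_exp_trace t : pmeas (fun x => expR (- ((a x + b x) / 2) * t)).
Proof.
apply: pmeas_expR; apply: pmeasM; last exact: pmeas_cst.
by apply: pmeasN; apply: pmeasM; [exact: pmeasD|exact: pmeas_cst].
Qed.

Lemma pmeas_kerG t : pmeas (fun x => kerG (a x) (b x) (r x) t).
Proof. by apply: pmeasM; [exact: pmeas_exp_trace|by apply: pmeas_sinhc; exact: pmeas_disc]. Qed.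

Lemma pmeas_kerK t : pmeas (fun x => kerK (a x) (b x) (r x) t).
Proof.
apply: pmeasM; first exact: pmeas_exp_trace.
apply: pmeasD; first by apply: pmeas_coshc; exact: pmeas_disc.
apply: pmeasM; last by apply: pmeas_sinhc; exact: pmeas_disc.
by apply: pmeasM; [exact: pmeasB|exact: pmeas_cst].
Qed.

End measurable_kernels.

(** Crude bounds without decay, for both signs of t: they only serve for integrability and as
    dominating functions. *)
Lemma kernel_bounds (R : realType) (L T : R) : 0 <= L -> 0 <= T ->
  exists2 C, 0 <= C & forall a b r t : R, `|a| <= L -> `|b| <= L -> `|r| <= L ->
    `|t| <= T -> `|kerK a b r t| <= C /\ `|kerG a b r t| <= C.
Proof.
move=> L0 T0; pose E := expR ((L + 1) * T).
have E0 : 0 <= E by exact: expR_ge0.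
exists (E * ((1 + L) * (E + T * E))); first by rewrite !mulr_ge0// !addr_ge0// mulr_ge0.
move=> a b r t aL bL rL tT.
have d0 : 0 <= L + 1 by rewrite addr_ge0.
have ab : `|(a - b) / 2| <= L.
  rewrite normrM (@ger0_norm _ 2^-1)// ler_pdivrMr//.
  by rewrite (le_trans (ler_normB _ _))//; lra.
(* The discriminant is at most L^2 + L, so L + 1 bounds its square root. *)
have dd : disc a b r <= (L + 1) ^+ 2.
  have : ((a - b) / 2) ^+ 2 <= L ^+ 2.
    by rewrite -real_normK ?num_real// lerXn2r// nnegrE.
  by move: rL; rewrite /disc ler_norml; move: ((a - b) / 2) => z; nra.
have eE : expR ((L + 1) * `|t|) <= E by rewrite ler_expR ler_wpM2l.
have e1 : expR (- ((a + b) / 2) * t) <= E.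
  rewrite (le_trans _ eE)// ler_expR (le_trans (ler_norm _))// normrM ler_wpM2r//.
  rewrite normrN normrM (@ger0_norm _ 2^-1)// ler_pdivrMr//.
  by rewrite (le_trans (ler_normD _ _))//; lra.
have S : `|sinhc (disc a b r) t| <= T * E.
  have -> : `|sinhc (disc a b r) t| = `|sinhc (disc a b r) `|t| |.
    have [t0|t0] := leP 0 t; first by rewrite (ger0_norm t0).
    by rewrite (ltr0_norm t0) sinhcN normrN.
  by rewrite (le_trans (ler_norm_sinhc d0 dd _))// ler_pM// expR_ge0.
have Cb : `|coshc (disc a b r) t| <= E.
  have -> : coshc (disc a b r) t = coshc (disc a b r) `|t|.
    have [t0|t0] := leP 0 t; first by rewrite (ger0_norm t0).
    by rewrite (ltr0_norm t0) coshcN.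
  by rewrite (le_trans (ler_norm_coshc d0 dd _)).
have TE0 : 0 <= T * E by exact: mulr_ge0.
split; rewrite /kerK /kerG normrM ger0_norm ?expR_ge0//; apply: ler_pM => //.
- rewrite (le_trans (ler_normD _ _))// normrM.
  have : `|(a - b) / 2| * `|sinhc (disc a b r) t| <= L * (T * E) by exact: ler_pM.
  have : 0 <= L * E by exact: mulr_ge0.
  by move: (_ * `|_|) (T * E) TE0 => Z Y; lra.
- have : 0 <= L * E by exact: mulr_ge0.
  have : 0 <= L * (T * E) by exact: mulr_ge0.
  by move: (T * E) TE0 S => Y; lra.
Qed.

Lemma diff_integ (R : realType) (w w' : R -> R * R -> R) (G : R * R -> R) (t0 T : R) :
  `|t0| < T -> (forall t, intg (w t)) ->
  (forall (t : R) xi, is_derive t 1 (w^~ xi) (w' t xi)) ->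
  intg G -> (forall xi, 0 <= G xi) ->
  (forall t xi, `|t| < T -> `|w' t xi| <= G xi) ->
  is_derive t0 1 (fun t => integ (w t)) (integ (w' t0)).
Proof.
move=> tT iw dw iG G0 wG.
have It : `]- T, T[%classic t0 by rewrite /= in_itv/= -ltr_norml.
have der1 (t : R) xi : partial1of2 w t xi = w' t xi.
  by rewrite partial1of2E; case: (dw t xi).
have dt' (t : R) xi : derivable (w^~ xi) t 1 by case: (dw t xi).
have bd (t : R) (xi : measurableTypeR R * measurableTypeR R) : `]- T, T[%classic t -> setT xi ->
    `|partial1of2 w t xi| <= G xi.
  by rewrite /= in_itv/= -ltr_norml => tT' _; rewrite der1; exact: wG.
apply: DeriveDef.
  apply: (@derivable_under_integral R _ _ leb2 w setT measurableT t0 (- T) T It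
    (fun t _ => iw t) (fun t xi _ _ => dt' t xi) G G0 iG bd).
rewrite -derive1E.
rewrite (@differentiation_under_integral R _ _ leb2 w setT measurableT t0 (- T) T It
    (fun t _ => iw t) (fun t xi _ _ => dt' t xi) G G0 iG bd).
by apply: eq_integ => xi; exact: der1.
Qed.

Section explicit_solution.
Context {R : realType}.
Variable Q : box R.
Variables (a b r : R * R -> R) (L : R).
Hypotheses (ma : pmeas a) (mb : pmeas b) (mr : pmeas r).
Hypotheses (aL : forall x, rect Q x -> `|a x| <= L) (bL : forall x, rect Q x -> `|b x| <= L)
  (rL : forall x, rect Q x -> `|r x| <= L).
Variables f g : R * R -> R.
Hypotheses (fQ : rect_int Q f) (gQ : rect_int Q g).

Local Notation K t x := (kerK (a x) (b x) (r x) t).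
Local Notation G t x := (kerG (a x) (b x) (r x) t).

(* The solution of w'' + (a + b) w' + (a b + r) w = 0 with w(0) = f and
   w'(0) = g - b f, and y = w' + (a + b) w. *)
Definition wsol (t : R) (x : R * R) : R := f x * K t x + g x * G t x.
Definition ysol (t : R) (x : R * R) : R :=
  f x * (a x * K t x - r x * G t x) + g x * (K t x + b x * G t x).

Lemma L_ge0 : 0 <= L.
Proof.
have [e1 e2] : al Q <= al Q <= be Q /\ ga Q <= ga Q <= de Q.
  by rewrite !lexx !ltW ?al_lt_be ?ga_lt_de.
by apply: le_trans (aL (x := (al Q, ga Q)) _); [|apply/rectP; rewrite /= e1 e2].
Qed.

Lemma rect_int_norm h : rect_int Q h -> rect_int Q (fun x => `|h x|).
Proof.
move=> [mh ih]; split; last by move/integrable_norm : ih.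
by apply: (@pmeas_continuous _ (fun y => `|y|)) mh => x; exact: norm_continuous.
Qed.

Lemma intg_comb p q : bsupp Q p -> bsupp Q q -> intg (fun x => f x * p x + g x * q x).
Proof.
move=> bp bq; apply: intgD; [exact: (integrable_bsupp fQ bp)|exact: (integrable_bsupp gQ bq)].
Qed.

Lemma bounded_kernels t : exists2 C, 0 <= C & forall x, rect Q x ->
  `|K t x| <= C /\ `|G t x| <= C.
Proof.
have [C C0 hC] := @kernel_bounds R L `|t| L_ge0 (normr_ge0 t).
by exists C => // x rx; apply: hC => //; [exact: aL|exact: bL|exact: rL].
Qed.

Lemma bsupp_K t psi : bsupp Q psi -> bsupp Q (fun x => K t x * psi x).
Proof.
apply: bsuppM; first exact: pmeas_kerK.
by have [C _ hC] := bounded_kernels t; exists C => x /hC[].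
Qed.

Lemma bsupp_G t psi : bsupp Q psi -> bsupp Q (fun x => G t x * psi x).
Proof.
apply: bsuppM; first exact: pmeas_kerG.
by have [C _ hC] := bounded_kernels t; exists C => x /hC[].
Qed.

Lemma bsupp_a psi : bsupp Q psi -> bsupp Q (fun x => a x * psi x).
Proof. by apply: bsuppM => //; exists L. Qed.
Lemma bsupp_b psi : bsupp Q psi -> bsupp Q (fun x => b x * psi x).
Proof. by apply: bsuppM => //; exists L. Qed.
Lemma bsupp_r psi : bsupp Q psi -> bsupp Q (fun x => r x * psi x).
Proof. by apply: bsuppM => //; exists L. Qed.

Lemma intg_wsol t psi : bsupp Q psi -> intg (fun x => wsol t x * psi x).
Proof.
move=> bp; have := intg_comb (bsupp_K t bp) (bsupp_G t bp).
by congr intg; apply/funext => x; rewrite /wsol; ring.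
Qed.

Lemma intg_ysol t psi : bsupp Q psi -> intg (fun x => ysol t x * psi x).
Proof.
move=> bp; have bK := bsupp_K t bp; have bG := bsupp_G t bp.
have := intg_comb (bsuppB (bsupp_a bK) (bsupp_r bG)) (bsuppD bK (bsupp_b bG)).
by congr intg; apply/funext => x; rewrite /ysol; ring.
Qed.

Lemma wsol_bound T : 0 <= T -> exists2 C, 0 <= C & forall t x, `|t| <= T -> rect Q x ->
  `|wsol t x| <= C * (`|f x| + `|g x|) /\ `|ysol t x| <= C * (`|f x| + `|g x|).
Proof.
move=> T0; have L0 := L_ge0; have [C C0 hC] := kernel_bounds L0 T0.
exists ((2 * L + 1) * C); first by rewrite mulr_ge0// addr_ge0// mulr_ge0.
move=> t x tT rx; have [KC GC] := hC _ _ _ _ (aL rx) (bL rx) (rL rx) tT.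
have LC : 0 <= L * C by exact: mulr_ge0.
have aK : `|a x * K t x| <= L * C by rewrite normrM ler_pM// aL.
have rG : `|r x * G t x| <= L * C by rewrite normrM ler_pM// rL.
have bG : `|b x * G t x| <= L * C by rewrite normrM ler_pM// bL.
rewrite mulrDr ![_ * `|_ x|]mulrC; split.
- apply: (le_trans (ler_normD _ _)); rewrite (normrM (f x)) (normrM (g x)).
  apply: lerD; apply: ler_wpM2l => //; first by apply: (le_trans KC); lra.
  by apply: (le_trans GC); lra.
- apply: (le_trans (ler_normD _ _)); rewrite (normrM (f x)) (normrM (g x)).
  apply: lerD; apply: ler_wpM2l => //.
    by apply: (le_trans (ler_normB _ _)); lra.
  by apply: (le_trans (ler_normD _ _)); lra.
Qed.

Lemma is_derive_wsol (t : R) x :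
  is_derive t 1 (wsol^~ x) (ysol t x - (a x + b x) * wsol t x).
Proof.
have ? := is_derive_kerK (a x) (b x) (r x) t; have ? := is_derive_kerG (a x) (b x) (r x) t.
by apply: is_derive_eq; rewrite /GRing.scale/= /ysol /wsol; ring.
Qed.

Lemma is_derive_ysol (t : R) x :
  is_derive t 1 (ysol^~ x) (- (a x * b x + r x) * wsol t x).
Proof.
have ? := is_derive_kerK (a x) (b x) (r x) t; have ? := is_derive_kerG (a x) (b x) (r x) t.
by apply: is_derive_eq; rewrite /GRing.scale/= /ysol /wsol; ring.
Qed.

Lemma intg_dominator psi M : bsupp Q psi -> intg (fun x => M * ((`|f x| + `|g x|) * `|psi x|)).
Proof.
move=> bp; have bn := bsupp_norm bp; apply: intgZ.
have := intgD (integrable_bsupp (rect_int_norm fQ) bn) (integrable_bsupp (rect_int_norm gQ) bn).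
by congr intg; apply/funext => x; rewrite mulrDl.
Qed.

Lemma is_derive_integ_wsol psi (t : R) : bsupp Q psi ->
  is_derive t 1 (fun t => integ (fun x => wsol t x * psi x))
    (integ (fun x => ysol t x * psi x) - integ (fun x => wsol t x * ((a x + b x) * psi x))).
Proof.
move=> bp; have bab := bsuppD (bsupp_a bp) (bsupp_b bp).
have babE x : (a x + b x) * psi x = a x * psi x + b x * psi x by rewrite mulrDl.
have iw := intg_wsol t bab.
under [X in _ - X]eq_integ do rewrite babE.
rewrite -integB//; last exact: intg_ysol.
have t10 : 0 <= `|t| + 1 by rewrite addr_ge0.
have [C C0 hC] := wsol_bound t10; have L0 := L_ge0.
apply: (@diff_integ R (fun t x => wsol t x * psi x)
  (fun t x => ysol t x * psi x - wsol t x * (a x * psi x + b x * psi x))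
  (fun x => (C * (1 + 2 * L)) * ((`|f x| + `|g x|) * `|psi x|)) t (`|t| + 1)).
- by rewrite ltrDl.
- by move=> s; exact: intg_wsol.
- move=> s xi; have ? := is_derive_wsol s xi.
  by apply: is_derive_eq; rewrite /GRing.scale/=; ring.
- exact: intg_dominator.
- by move=> xi; rewrite !mulr_ge0 ?addr_ge0 ?mulr_ge0.
- move=> s xi /ltW sT; have [rx|nx] := pselect (rect Q xi); last first.
    by case: bp => _ _ /(_ _ nx) ->; rewrite !mulr0 addr0 mulr0 subrr normr0 !mulr0.
  have [wC yC] := hC _ _ sT rx.
  rewrite (_ : _ - _ = (ysol s xi - (a xi + b xi) * wsol s xi) * psi xi); last by ring.
  rewrite normrM mulrA; apply: ler_wpM2r => //.
  rewrite (le_trans (ler_normB _ _))// normrM.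
  have : `|a xi + b xi| * `|wsol s xi| <= (2 * L) * (C * (`|f xi| + `|g xi|)).
    by apply: ler_pM => //; apply: (le_trans (ler_normD _ _)); have := aL rx; have := bL rx; lra.
  by move: yC; move: (`|f xi| + `|g xi|) => Z; lra.
Qed.

Lemma is_derive_integ_ysol psi (t : R) : bsupp Q psi ->
  is_derive t 1 (fun t => integ (fun x => ysol t x * psi x))
    (- integ (fun x => wsol t x * ((a x * b x + r x) * psi x))).
Proof.
move=> bp; have bab := bsuppD (bsupp_a (bsupp_b bp)) (bsupp_r bp).
have babE x : (a x * b x + r x) * psi x = a x * (b x * psi x) + r x * psi x by ring.
have iw := intg_wsol t bab.
under [X in - X]eq_integ do rewrite babE.
rewrite -mulN1r -integZ//.
have t10 : 0 <= `|t| + 1 by rewrite addr_ge0.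
have [C C0 hC] := wsol_bound t10; have L0 := L_ge0.
apply: (@diff_integ R (fun t x => ysol t x * psi x)
  (fun t x => -1 * (wsol t x * (a x * (b x * psi x) + r x * psi x)))
  (fun x => (C * (L * L + L)) * ((`|f x| + `|g x|) * `|psi x|)) t (`|t| + 1)).
- by rewrite ltrDl.
- by move=> s; exact: intg_ysol.
- move=> s xi; have ? := is_derive_ysol s xi.
  by apply: is_derive_eq; rewrite /GRing.scale/=; ring.
- exact: intg_dominator.
- by move=> xi; rewrite !mulr_ge0 ?addr_ge0 ?mulr_ge0.
- move=> s xi /ltW sT; have [rx|nx] := pselect (rect Q xi); last first.
    by case: bp => _ _ /(_ _ nx) ->; rewrite !mulr0 addr0 !mulr0 normr0 !mulr0.
  have [wC _] := hC _ _ sT rx.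
  rewrite (_ : _ * _ = - ((a xi * b xi + r xi) * wsol s xi * psi xi)); last by ring.
  rewrite normrN !normrM mulrA; apply: ler_wpM2r => //.
  rewrite [C * _]mulrC -mulrA; apply: ler_pM => //.
  rewrite (le_trans (ler_normD _ _))// normrM lerD//; last exact: rL.
  by apply: ler_pM => //; [exact: aL|exact: bL].
Qed.

Lemma wsol0 x : wsol 0 x = f x.
Proof. by rewrite /wsol kerK0 kerG0 mulr1 mulr0 addr0. Qed.

Lemma ysol0 x : ysol 0 x = a x * f x + g x.
Proof. by rewrite /ysol kerK0 kerG0; ring. Qed.

Lemma bsupp_indic : bsupp Q \1_(rect Q).
Proof.
split.
- by apply: measurable_indic; exact: measurable_rect.
- by exists 1 => // x; rewrite indicE; case: (x \in _); rewrite ?normr1 ?normr0.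
- by move=> x nx; rewrite indicE memNset.
Qed.

(** For the explicit solution, this is the bound by the sup norm of the test function that
    [system_uniqueness] asks for. *)
Lemma integ_wsol_bound T : 0 <= T -> exists2 C, 0 <= C &
  forall psi be t, bsupp Q psi -> (forall x, `|psi x| <= be) -> `|t| <= T ->
  `|integ (fun x => wsol t x * psi x)| <= C * be.
Proof.
move=> T0; have [C C0 hC] := wsol_bound T0.
pose I := integ (fun x => C * ((`|f x| + `|g x|) * `|\1_(rect Q) x : R|)).
have I0 : 0 <= I by apply: Rintegral_ge0 => x _; rewrite !mulr_ge0// addr_ge0.
exists I => // psi be t bp pb tT.
have be0 : 0 <= be by apply: le_trans (pb (0, 0)).
have id := intg_dominator C bsupp_indic.
rewrite mulrC -integZ//; apply: le_norm_integ; [exact: intg_wsol|exact: intgZ|].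
move=> x; have [rx|nx] := pselect (rect Q x); last first.
  by case: bp => _ _ ->//; rewrite mulr0 normr0 !mulr_ge0// addr_ge0.
rewrite indicE mem_set// normr1 mulr1 normrM mulrC; apply: ler_pM => //.
by case: (hC _ _ tT rx).
Qed.

End explicit_solution.

(** * Solutions on the Fourier side *)

Section fourier_of_dist.
Context {R : realType}.
Implicit Types (T S : dist R) (psi : R * R -> R) (re : bool).

(** One boolean selects the real or the imaginary part together with the matching phase of the
    cosine transform; as all symbols are real, the two parts evolve separately in the same way. *)
Definition part re (z : R[i]) : R := if re then complex.Re z else complex.Im z.
Definition phase re : R := if re then 0 else pi / 2.

Lemma part_sq re z : part re z ^+ 2 <= sq_modulus z.
Proof. by rewrite /part /sq_modulus; case: re; rewrite ?lerDl ?lerDr sqr_ge0. Qed.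

Lemma is_fourier_test (Q : box R) T g psi re : is_fourier T g -> test Q psi ->
  T (four (phase re) psi) = integ (fun xi => part re (g xi) * psi xi).
Proof.
move=> [_ _ Tg] tp; have [_ _ e1 e2] := Tg _ (test_schwartz tp).
rewrite /part /phase; case: re; first by rewrite -four_re e1.
by rewrite -(four_im (test_bsupp tp)) e2.
Qed.

Lemma hat_is_fourier T : (exists g, is_fourier T g) -> is_fourier T (hat T).
Proof. by move=> [g Tg]; rewrite /hat; apply: xgetPex; exists g. Qed.

(** The symbol moves onto the test function, which eliminates the unspecified representative [g] of
    the Fourier transform. *)
Lemma multiplier_test (Q : box R) m T S psi re : is_multiplier m T S -> test Q psi ->
  test Q (fun x => m x * psi x) ->
  S (four (phase re) psi) = T (four (phase re) (fun x => m x * psi x)).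
Proof.
move=> [_ [g [Tg Sg]]] tp tm.
rewrite (is_fourier_test re Sg tp) (is_fourier_test re Tg tm).
by apply: eq_integ => x; rewrite /part; case: re => /=; ring.
Qed.

Lemma aniso_norm_fourier i r sigma T : (aniso_norm i r sigma T < +oo)%E ->
  exists g, is_fourier T g.
Proof. by rewrite /aniso_norm /weighted_norm; case: asboolP. Qed.

Lemma poweR_half_le (I : \bar R) (M : R) : (0 <= I)%E -> (I `^ 2^-1 <= M%:E)%E ->
  (I <= (M ^+ 2)%:E)%E.
Proof.
case: I => [i| |]//.
- rewrite lee_fin => i0; rewrite poweR_EFin !lee_fin powR12_sqrt// => h.
  rewrite -(sqr_sqrtr i0) lerXn2r// nnegrE ?sqrtr_ge0//.
  by rewrite (le_trans _ h)// sqrtr_ge0.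
- by move=> _; rewrite poweRyr ?leye_eq// invr_neq0.
Qed.

Lemma pmeas_part T g re : is_fourier T g -> pmeas (fun x => part re (g x)).
Proof. by move=> [mr mi _]; rewrite /part; case: re. Qed.

Lemma pmeas_enorm : pmeas (@enorm R).
Proof. exact: (pmeas_sqrt (@pmeas_rho R)). Qed.

Lemma pmeas_powR (f : R * R -> R) p : pmeas f -> pmeas (fun x => f x `^ p).
Proof. by apply: (@pmeas_comp _ (fun y => y `^ p)); exact: measurable_powR. Qed.

Lemma pmeas_norm (f : R * R -> R) : pmeas f -> pmeas (fun x => `|f x|).
Proof. by apply: (@pmeas_continuous _ (fun y => `|y|)) => x; exact: norm_continuous. Qed.

Lemma pmeas_weight i r sigma :
  pmeas (fun x : R * R => enorm x `^ (2 * r) * `|Defs.coord i x| `^ (- (2 * sigma))).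
Proof.
apply: pmeasM; apply: pmeas_powR; first exact: pmeas_enorm.
exact: pmeas_norm (pmeas_coord i).
Qed.

Lemma pmeas_sq_modulus T g : is_fourier T g -> pmeas (fun x => sq_modulus (g x)).
Proof. by move=> [mr mi _]; apply: pmeasD; apply: pmeasX. Qed.

(** On the rectangle |xi_1|^(-2 sigma) is bounded below, so the weighted norm controls the L^2 norm
    and hence the L^1 norm there. The constant [c] depends on the rectangle but not on [T], which
    makes the bound uniform in time along a solution. *)
Lemma hat_rect_int (Q : box R) sigma : 0 <= sigma -> exists2 c : R, 0 <= c &
  forall T (M : R) re, (aniso_norm ax1 0 sigma T <= M%:E)%E ->
  rect_int Q (fun x => part re (hat T x)) /\
  forall psi be, bsupp Q psi -> (forall x, `|psi x| <= be) ->
    `|integ (fun x => part re (hat T x) * psi x)| <= c * (1 + M ^+ 2) * be.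
Proof.
move=> s0; have [B B0 hB] := @continuous_bounded_itv R (fun x => x) (al Q) (be Q) (fun _ => cvg_id).
(* Only 0 <= B is known; the margin makes the base of the power positive. *)
pose B1 := B + 1; have B10 : 0 < B1 by rewrite ltr_wpDl.
pose k := B1 `^ (2 * sigma); have k0 : 0 < k by exact: powR_gt0.
have wk x : rect Q x -> 1 <= k * `|Defs.coord ax1 x| `^ (- (2 * sigma)).
  move=> rx; have /andP[x1 _] := (rectP Q x).1 rx.
  have x0 : 0 < `|x.1|.
    rewrite normr_gt0; apply: contraTneq (ka_gt0 Q) => e.
    by rewrite -leNgt (le_trans (ka_le x1))// e expr0n.
  rewrite /Defs.coord/= powRN -ler_pdivrMr ?invr_gt0 ?powR_gt0// invrK mul1r.
  by apply: ge0_ler_powR; rewrite ?mulr_ge0 ?nnegrE// ?(ltW B10)// (le_trans (hB _ x1))// lerDl.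
pose m := fine (leb2 (rect Q)).
have m0 : 0 <= m by rewrite fine_ge0.
exists (m + k); first by rewrite addr_ge0// ltW.
move=> T M re TM.
have Tg : is_fourier T (hat T).
  by apply/hat_is_fourier/(@aniso_norm_fourier ax1 0 sigma); exact: le_lt_trans TM (ltry _).
pose w x := `|Defs.coord ax1 x| `^ (- (2 * sigma)) * sq_modulus (hat T x).
have mw : pmeas w.
  apply: pmeasM; last exact: pmeas_sq_modulus Tg.
  by apply: pmeas_powR; exact: pmeas_norm (pmeas_coord ax1).
have sq0 (z : R[i]) : 0 <= sq_modulus z by rewrite addr_ge0// sqr_ge0.
have w0 x : 0 <= w x by rewrite mulr_ge0 ?powR_ge0 ?sq0.
have Iw : (\int[leb2]_x (w x)%:E <= (M ^+ 2)%:E)%E.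
  apply: poweR_half_le; first by apply: integral_ge0 => x _; rewrite lee_fin.
  move: TM; rewrite /aniso_norm /weighted_norm asboolT; last by exists (hat T).
  congr (_ <= _)%E; congr (_ `^ _)%E; apply: eq_integral => x _.
  by rewrite mulr0 powRr0 mul1r.
have mp := pmeas_part re Tg.
(* The inequality u <= 1 + u^2 takes the place of Cauchy-Schwarz, which is why the final bound has 1
   + M^2 and not M. *)
have aux (u v y : R) : 0 <= v -> u ^+ 2 <= v -> 1 <= k * y -> u <= 1 + k * (y * v).
  move=> v0 uv ky; have : v <= k * (y * v) by rewrite mulrA ler_peMl.
  have := sqr_ge0 (u - 1); have := sqr_ge0 u; move: uv; rewrite !expr2 => *; lra.
have Ip : (\int[leb2]_(x in rect Q) `|part re (hat T x)|%:E <= (m + k * M ^+ 2)%:E)%E.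
  have mr := measurable_rect Q.
  apply: (@le_trans _ _ (\int[leb2]_(x in rect Q) (1 + k * w x)%:E)%E).
    apply: ge0_le_integral => //=.
    - by apply/measurable_EFinP; apply: measurable_funTS; exact: pmeas_norm.
    - apply/measurable_EFinP; apply: measurable_funTS; apply: pmeasD; first exact: pmeas_cst.
      by apply: pmeasM => //; exact: pmeas_cst.
    - move=> x rx; rewrite lee_fin; have := wk x rx; have := part_sq re (hat T x).
      have := sq0 (hat T x); rewrite /w -(real_normK (num_real (part re _))).
      exact: aux.
  rewrite EFinD; under eq_integral do rewrite EFinD.
  rewrite ge0_integralD//=; last 2 first.
  - by move=> x _; rewrite lee_fin mulr_ge0// ltW.
  - apply/measurable_EFinP; apply: measurable_funTS.
    by apply: pmeasM => //; exact: pmeas_cst.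
  apply: leeD.
    rewrite integral_cst// mul1e /m fineK// ge0_fin_numE//; exact: leb2_rect.
  under eq_integral do rewrite EFinM.
  rewrite ge0_integralZl//=; last 3 first.
  - by apply/measurable_EFinP; exact: measurable_funTS.
  - by move=> x _; rewrite lee_fin.
  - by rewrite lee_fin ltW.
  rewrite EFinM; apply: lee_wpmul2l; first by rewrite lee_fin ltW.
  apply: le_trans Iw; apply: ge0_subset_integral => //.
  - exact/measurable_EFinP.
  - by move=> x _; rewrite lee_fin.
have ri : rect_int Q (fun x => part re (hat T x)).
  split => //; apply/integrableP; split.
    by apply/measurable_EFinP; exact: measurable_funTS.
  by apply: le_lt_trans Ip (ltry _).
split => // psi be bp pb.
have be0 : 0 <= be by apply: le_trans (pb (0, 0)).
have bi := bsupp_indic Q.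
have ii := integrable_bsupp (rect_int_norm ri) bi.
apply: (@le_trans _ _ (be * integ (fun x => `|part re (hat T x)| * \1_(rect Q) x))).
  rewrite -integZ//; apply: le_norm_integ.
  - exact: (integrable_bsupp ri bp).
  - exact: intgZ.
  - move=> x; have [rx|nx] := pselect (rect Q x); last first.
      by case: bp => _ _ ->//; rewrite mulr0 normr0 !mulr_ge0.
    by rewrite indicE mem_set// mulr1 normrM mulrC ler_wpM2r.
rewrite mulrC ler_wpM2r//.
have -> : integ (fun x => `|part re (hat T x)| * \1_(rect Q) x) =
    fine (\int[leb2]_(x in rect Q) `|part re (hat T x)|%:E)%E.
  rewrite /integ /Rintegral; congr fine; rewrite [RHS]integral_mkcond.
  apply: eq_integral => x _; rewrite /patch indicE; case: (x \in rect Q).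
    by rewrite mulr1.
  by rewrite mulr0.
rewrite -lee_fin fineK; last first.
  rewrite ge0_fin_numE; first exact: le_lt_trans Ip (ltry _).
  by apply: integral_ge0 => x _; rewrite lee_fin.
apply: (le_trans Ip); rewrite lee_fin.
have : 0 <= m * M ^+ 2 by rewrite mulr_ge0// sqr_ge0.
by move: (ltW k0); lra.
Qed.

End fourier_of_dist.

(** * Reduction of the weak equation to the tested first-order system *)

Section weak_solution.
Context {R : realType}.
Variables (nu eta sigma : R) (nu0 : 0 < nu) (eta0 : 0 < eta) (sigma0 : 0 <= sigma).
Implicit Types (psi : R * R -> R).

Definition sa (x : R * R) : R := eta * x.1 ^+ 2.
Definition sb (x : R * R) : R := nu * x.2 ^+ 2.
Definition sr : R * R -> R := riesz_symbol ax1 ax1.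

Lemma enorm_sqr (x : R * R) : enorm x ^+ 2 = rho x.
Proof. by rewrite /enorm sqr_sqrtr// addr_ge0// sqr_ge0. Qed.

Lemma rho_ge0 (x : R * R) : 0 <= rho x. Proof. by rewrite addr_ge0// sqr_ge0. Qed.

Lemma sr_bounds x : 0 <= sr x <= 1.
Proof.
rewrite /sr /riesz_symbol enorm_sqr /Defs.coord/= -expr2.
have [->|r0] := eqVneq (rho x) 0; first by rewrite invr0 mulr0 lexx ler01.
have r1 : 0 < rho x by rewrite lt_neqAle eq_sym r0 rho_ge0.
by rewrite divr_ge0 ?sqr_ge0 ?rho_ge0//= ler_pdivrMr// mul1r lerDl sqr_ge0.
Qed.

Lemma pmeas_sa : pmeas sa.
Proof. by apply: pmeasM; [exact: pmeas_cst|apply: pmeasX; exact: pmeas1]. Qed.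
Lemma pmeas_sb : pmeas sb.
Proof. by apply: pmeasM; [exact: pmeas_cst|apply: pmeasX; exact: pmeas2]. Qed.
Lemma pmeas_riesz i j : pmeas (riesz_symbol i j : R * R -> R).
Proof.
apply: pmeasM; first by apply: pmeasM; exact: pmeas_coord.
by apply: pmeasV; apply: pmeasX; exact: pmeas_enorm.
Qed.

Variable Q : box R.

Lemma test_riesz i j psi : test Q psi -> test Q (fun x => riesz_symbol i j x * psi x).
Proof.
move=> tp; have := test_divrho (test_coord i (test_coord j tp)).
by congr test; apply/funext => x; rewrite /riesz_symbol enorm_sqr; ring.
Qed.

Lemma test_sq i psi : test Q psi -> test Q (fun x => - Defs.coord i x ^+ 2 * psi x).
Proof.
move=> tp; have := testZ (-1) (test_coord i (test_coord i tp)).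
by congr test; apply/funext => x; ring.
Qed.

Lemma test_A psi : test Q psi -> test Q (fun x => (sa x + sb x) * psi x).
Proof.
move=> tp; have := testD (testZ (- eta) (test_sq ax1 tp)) (testZ (- nu) (test_sq ax2 tp)).
by congr test; apply/funext => x; rewrite /sa /sb /Defs.coord/=; ring.
Qed.

Lemma test_B psi : test Q psi -> test Q (fun x => (sa x * sb x + sr x) * psi x).
Proof.
move=> tp; have := testD (testZ (nu * eta) (test_sq ax2 (test_sq ax1 tp))) (test_riesz ax1 ax1 tp).
by congr test; apply/funext => x; rewrite /sa /sb /Defs.coord/= /sr; ring.
Qed.

Lemma symbol_bound : exists2 L, 0 <= L & forall x, rect Q x ->
  [/\ `|sa x| <= L, `|sb x| <= L & `|sr x| <= L].
Proof.
have [M M0 hM] := @continuous_bounded_itv R (fun x => x) (al Q) (be Q) (fun _ => cvg_id).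
have [N N0 hN] := @continuous_bounded_itv R (fun x => x) (ga Q) (de Q) (fun _ => cvg_id).
have h1 : 0 <= eta * M ^+ 2 by rewrite mulr_ge0 ?sqr_ge0// ltW.
have h2 : 0 <= nu * N ^+ 2 by rewrite mulr_ge0 ?sqr_ge0// ltW.
exists (eta * M ^+ 2 + nu * N ^+ 2 + 1); first by rewrite !addr_ge0.
move=> x /rectP/andP[x1 x2]; split.
- have : `|sa x| <= eta * M ^+ 2.
    rewrite /sa normrM (gtr0_norm eta0) normrX ler_wpM2l ?(ltW eta0)//.
    by rewrite lerXn2r ?nnegrE// hM.
  lra.
- have : `|sb x| <= nu * N ^+ 2.
    rewrite /sb normrM (gtr0_norm nu0) normrX ler_wpM2l ?(ltW nu0)//.
    by rewrite lerXn2r ?nnegrE// hN.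
  lra.
- by have /andP[r0 r1] := sr_bounds x; rewrite ger0_norm//; lra.
Qed.

Variables (W : R -> dist R) (W0 V0 : dist R) (re : bool).
Hypothesis Wsol : solves nu eta sigma W W0 V0.
Variables f g : R * R -> R.
Hypotheses (fQ : rect_int Q f) (gQ : rect_int Q g).
Hypothesis W0f : forall psi, test Q psi ->
  W0 (four (phase re) psi) = integ (fun x => f x * psi x).
Hypothesis V0g : forall psi, test Q psi ->
  V0 (four (phase re) psi) = integ (fun x => (g x - sb x * f x) * psi x).

Let X psi t := W t (four (phase re) psi).
Let dX psi t := dt W t (four (phase re) psi).

Lemma four_lin (a p : R) psi1 psi2 : test Q psi1 -> test Q psi2 ->
  four p (fun x => a * psi1 x + psi2 x) = fun x => a * four p psi1 x + four p psi2 x.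
Proof.
move=> /test_bsupp b1 /test_bsupp b2; apply/funext => x.
have i1 := intg_bsupp (bsupp_cos p x b1); have i2 := intg_bsupp (bsupp_cos p x b2).
rewrite /four -integZ// -integD//; last exact: intgZ.
by apply: eq_integ => xi; ring.
Qed.

Lemma X_lin a psi1 psi2 t : 0 <= t -> test Q psi1 -> test Q psi2 ->
  X (fun x => a * psi1 x + psi2 x) t = a * X psi1 t + X psi2 t.
Proof.
move=> t0 t1 t2; have [H _ _ _] := Wsol; have [lin _] := H _ t0.
rewrite /X (four_lin a (phase re) t1 t2).
by apply: lin; [exact: (schwartz_four (phase re) t1)|exact: (schwartz_four (phase re) t2)].
Qed.

Lemma XZ a psi t : 0 <= t -> test Q psi -> X (fun x => a * psi x) t = a * X psi t.
Proof.
(* Linearity is given for a psi1 + psi2, so X of the zero function, written - psi + psi, is found to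
   be 0 first. *)
move=> t0 tp; have := X_lin (-1) t0 tp tp; rewrite mulN1r addNr => e.
have := X_lin a t0 tp (testD (testZ (-1) tp) tp); rewrite e addr0 => <-.
by congr (X _ t); apply/funext => x; ring.
Qed.

Lemma is_derive_X psi (t : R) : test Q psi -> 0 < t -> is_derive t 1 (X psi) (dX psi t).
Proof.
move=> tp t0; have [_ _ H _] := Wsol.
have [d _ _ _ _] := H _ (schwartz_four (phase re) tp).
by rewrite /dX /dt derive1E; apply: derivableP; exact: d.
Qed.

Lemma is_derive_lin (u v : R -> R) (du dv c d t : R) :
  is_derive t 1 u du -> is_derive t 1 v dv ->
  is_derive t 1 (fun s => c * u s + d * v s) (c * du + d * dv).
Proof. by move=> uu vv; apply: is_derive_eq; rewrite /GRing.scale/=; ring. Qed.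

(** [dt W t] is not assumed to be linear. The identity holds for X at all times near t, and
    differentiating it gives the claim. *)
Lemma dX_A psi (t : R) : test Q psi -> 0 < t ->
  dX (fun x => (sa x + sb x) * psi x) t =
  - eta * dX (fun x => - Defs.coord ax1 x ^+ 2 * psi x) t +
  - nu * dX (fun x => - Defs.coord ax2 x ^+ 2 * psi x) t.
Proof.
move=> tp t0; have t1 := test_sq ax1 tp; have t2 := test_sq ax2 tp.
have d12 := is_derive_lin (- eta) (- nu) (is_derive_X t1 t0) (is_derive_X t2 t0).
have [_ <-] := is_derive_X (test_A tp) t0.
have [_ <-] := d12.
apply: near_eq_derive; near=> s.
have s0 : 0 <= s by rewrite ltW//; near: s; exact: lt_nbhsr.
rewrite -(XZ (- nu) s0 t2) -(X_lin (- eta) s0 t1 (testZ (- nu) t2)).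
by congr (X _ s); apply/funext => x; rewrite /sa /sb /Defs.coord/=; ring.
Unshelve. all: by end_near.
Qed.

Lemma dist_partial2_test i (T : dist R) psi : test Q psi ->
  dist_partial i (dist_partial i T) (four (phase re) psi) =
  T (four (phase re) (fun x => - Defs.coord i x ^+ 2 * psi x)).
Proof. by move=> tp; rewrite /dist_partial opprK (partial2_four _ _ tp). Qed.

(** Moving the damping term into the unknown Y = X' + X A leaves no time derivative on the right, so
    the equation takes the form treated by [system_uniqueness]. *)
Lemma wave_eq_test psi (t : R) : test Q psi -> 0 < t ->
  is_derive t 1 (fun s => dX psi s + X (fun x => (sa x + sb x) * psi x) s)
    (- X (fun x => (sa x * sb x + sr x) * psi x) t).
Proof.
move=> tp t0; have [_ _ H we] := Wsol.
have ts := schwartz_four (phase re) tp.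
have [_ dd _ _ _] := H _ ts.
have d1 : is_derive t 1 (dX psi) (dt (dt W) t (four (phase re) psi)).
  by rewrite /dt [X in is_derive _ _ _ X]derive1E; apply: derivableP; exact: dd.
have d2 := is_derive_X (test_A tp) t0.
have [S mS /(_ _ ts) E] := we _ t0.
have tt := test_sq ax2 (test_sq ax1 tp).
have eB : X (fun x => (sa x * sb x + sr x) * psi x) t =
   nu * eta * X (fun x => - Defs.coord ax2 x ^+ 2 * (- Defs.coord ax1 x ^+ 2 * psi x)) t +
   X (fun x => sr x * psi x) t.
  rewrite -(X_lin _ (ltW t0) tt (test_riesz ax1 ax1 tp)).
  by congr (X _ t); apply/funext => x; rewrite /sa /sb /Defs.coord/= /sr; ring.
have eA := dX_A tp t0.
have e1 : dist_partial ax1 (dist_partial ax1 (dt W t)) (four (phase re) psi) =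
    dX (fun x => - Defs.coord ax1 x ^+ 2 * psi x) t by exact: dist_partial2_test.
have e2 : dist_partial ax2 (dist_partial ax2 (dt W t)) (four (phase re) psi) =
    dX (fun x => - Defs.coord ax2 x ^+ 2 * psi x) t by exact: dist_partial2_test.
have e4 : dist_partial ax1 (dist_partial ax1 (dist_partial ax2 (dist_partial ax2 (W t))))
    (four (phase re) psi) =
    X (fun x => - Defs.coord ax2 x ^+ 2 * (- Defs.coord ax1 x ^+ 2 * psi x)) t.
  by rewrite (dist_partial2_test ax1 _ tp) (dist_partial2_test ax2 _ (test_sq ax1 tp)).
have eS : S (four (phase re) psi) = X (fun x => sr x * psi x) t.
  exact: (multiplier_test re mS tp (test_riesz ax1 ax1 tp)).
have dd12 := is_deriveD d1 d2.
apply: (@is_derive_eq _ _ _ _ _ _ _ _ dd12).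
rewrite e1 e2 e4 eS in E.
rewrite eA eB.
move: E; move: (dt (dt W) t _) (X _ t) (X _ t) (dX _ t) (dX _ t) => u v w x y E.
by rewrite -[RHS]add0r -E; ring.
Qed.

Lemma aniso_le_neg (r s0 : R) (T : dist R) : (aniso_norm ax1 r s0 T <= neg_norm r s0 T)%E.
Proof.
rewrite /neg_norm leeDl// /aniso_norm /weighted_norm; case: ifP => // _.
exact: poweR_ge0.
Qed.

Lemma X_hat psi s M : test Q psi -> (neg_norm 0 sigma (W s) <= M%:E)%E ->
  X psi s = integ (fun x => part re (hat (W s) x) * psi x).
Proof.
move=> tp hM; apply: (is_fourier_test re _ tp).
apply/hat_is_fourier/(@aniso_norm_fourier R ax1 0 sigma).
exact: le_lt_trans (le_trans (aniso_le_neg _ _ _) hM) (ltry _).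
Qed.

(** The boundedness of the solution in H^{0,-sigma} on [0, t] enters uniqueness here: the seminorm
    bound of a tempered distribution would involve derivatives of psi, which the iteration does not
    control. *)
Lemma X_bound t : exists2 K, 0 <= K & forall psi b, test Q psi ->
  (forall x, `|psi x| <= b) -> forall s, 0 < s <= t -> `|X psi s| <= K * b.
Proof.
have [_ H _ _] := Wsol; have [t0|t0] := leP 0 t; last first.
  exists 0 => // psi b _ _ s /andP[s0 st].
  by move: (lt_le_trans s0 st); rewrite ltNge ltW.
have [M hM] := H t t0; have [c c0 hc] := hat_rect_int Q sigma0.
exists (c * (1 + M ^+ 2)); first by rewrite mulr_ge0// addr_ge0// sqr_ge0.
move=> psi b tp pb s /andP[s0 st].
have Ms : (neg_norm 0 sigma (W s) <= M%:E)%E by apply: hM; rewrite ltW.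
rewrite (X_hat tp Ms).
have [_] := hc _ _ re (le_trans (aniso_le_neg _ _ _) Ms).
by apply => //; exact: test_bsupp.
Qed.

Lemma cvg_X psi : test Q psi -> X psi t @[t --> 0^'+] --> integ (fun x => f x * psi x).
Proof.
move=> tp; have [_ _ H _] := Wsol.
by have [_ _ _ h _] := H _ (schwartz_four (phase re) tp); rewrite W0f in h.
Qed.

Lemma cvg_dX psi : test Q psi ->
  dX psi t @[t --> 0^'+] --> integ (fun x => (g x - sb x * f x) * psi x).
Proof.
move=> tp; have [_ _ H _] := Wsol.
by have [_ _ _ _ h] := H _ (schwartz_four (phase re) tp); rewrite V0g in h.
Qed.

Lemma derive_cvg0 (h : R -> R) (dh : R) : is_derive (0 : R) 1 h dh ->
  h t @[t --> 0^'+] --> h 0.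
Proof.
move=> [d _]; apply: cvg_at_right_filter.
by apply: differentiable_continuous; exact/derivable1_diffP.
Qed.

Lemma weak_solution psi t : test Q psi -> 0 < t ->
  X psi t = integ (fun x => wsol sa sb sr f g t x * psi x).
Proof.
move=> tp t0; have [L L0 hL] := symbol_bound.
have aL x : rect Q x -> `|sa x| <= L by move=> /hL[].
have bL x : rect Q x -> `|sb x| <= L by move=> /hL[].
have rL x : rect Q x -> `|sr x| <= L by move=> /hL[].
have ma := pmeas_sa; have mb := pmeas_sb; have mr := pmeas_riesz ax1 ax1.
pose E psi s := integ (fun x => wsol sa sb sr f g s x * psi x).
pose YE psi s := integ (fun x => ysol sa sb sr f g s x * psi x).
pose A x := sa x + sb x; pose B x := sa x * sb x + sr x.
pose Y psi s := dX psi s + X (fun x => A x * psi x) s.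
have dE q (s : R) : test Q q -> is_derive s 1 (E q) (YE q s - E (fun x => A x * q x) s).
  by move=> /test_bsupp bq; exact: (is_derive_integ_wsol ma mb mr aL bL rL fQ gQ).
have dYE q (s : R) : test Q q -> is_derive s 1 (YE q) (- E (fun x => B x * q x) s).
  by move=> /test_bsupp bq; exact: (is_derive_integ_ysol ma mb mr aL bL rL fQ gQ).
have [K1 K10 hK1] := X_bound t.
have [K2 K20 hK2] := integ_wsol_bound ma mb mr aL bL rL fQ gQ (ltW t0).
apply/eqP; rewrite -subr_eq0; apply/eqP.
(* One constant for both multipliers: |a + b| <= 2 L and |a b + r| <= L^2 + L. *)
have LL0 : 0 <= L * L + 2 * L by rewrite addr_ge0// mulr_ge0.
have := @system_uniqueness R Q A B t (L * L + 2 * L) (K1 + K2)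
  (fun q s => X q s - E q s) (fun q s => Y q s - YE q s) (ltW t0) LL0 (addr_ge0 K10 K20)
  test_A test_B.
apply => //.
- move=> x rx; rewrite (le_trans (ler_normD _ _))//.
  by have := aL x rx; have := bL x rx; have : 0 <= L * L by [exact: mulr_ge0]; lra.
- move=> x rx; rewrite (le_trans (ler_normD _ _))//.
  have : `|sa x * sb x| <= L * L by rewrite normrM; apply: ler_pM => //; [exact: aL|exact: bL].
  by have := rL x rx; lra.
- move=> q tq s s0.
  have d := is_deriveB (is_derive_X tq s0) (dE q s tq).
  apply: (@is_derive_eq _ _ _ _ _ _ _ _ d).
  by rewrite /Y -/A; ring.
- move=> q tq s s0.
  have d := is_deriveB (wave_eq_test tq s0) (dYE q s tq).
  apply: (@is_derive_eq _ _ _ _ _ _ _ _ d).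
  by rewrite -/B; ring.
- move=> q tq.
  have c1 := cvg_X tq; have c2 := derive_cvg0 (dE q 0 tq).
  have key : integ (fun x => f x * q x) - E q 0 = 0.
    by apply/eqP; rewrite subr_eq0 /E; apply/eqP/eq_integ => x; rewrite wsol0.
  suff : X q t - E q t @[t --> 0^'+] --> integ (fun x => f x * q x) - E q 0.
    by rewrite key.
  exact: cvgB.
- move=> q tq; have tA := test_A tq.
  have c1 := cvg_dX tq; have c1' := cvg_X tA; have c2 := derive_cvg0 (dYE q 0 tq).
  have bq := test_bsupp tq.
  have i1 : intg (fun x => (g x - sb x * f x) * q x).
    have := intgB (integrable_bsupp gQ bq) (integrable_bsupp fQ (bsupp_b mb bL bq)).
    by congr intg; apply/funext => x; ring.
  have i2 := integrable_bsupp fQ (test_bsupp tA).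
  (* The initial value of Y is (g - b f) + (a + b) f = a f + g, which is [ysol] at time 0. *)
  have key : integ (fun x => (g x - sb x * f x) * q x) +
      integ (fun x => f x * ((sa x + sb x) * q x)) - YE q 0 = 0.
    rewrite -(integD i1 i2); apply/eqP; rewrite subr_eq0; apply/eqP/eq_integ => x.
    by rewrite ysol0; ring.
  suff : Y q t - YE q t @[t --> 0^'+] -->
      integ (fun x => (g x - sb x * f x) * q x) +
      integ (fun x => f x * ((sa x + sb x) * q x)) - YE q 0 by rewrite key.
  by apply: cvgB => //; exact: cvgD.
- move=> q b tq qb s sT; rewrite mulrDl (le_trans (ler_normB _ _))//.
  apply: lerD; first exact: hK1.
  apply: hK2 => //; first exact: test_bsupp.
  by have /andP[s0 st] := sT; rewrite gtr0_norm.
- by rewrite t0 lexx.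
Qed.

End weak_solution.

(** * Functions determined by their test integrals *)

Section rectangles_determine.
Context {R : realType}.
Variable k : R * R -> R.
Hypothesis ik : intg k.

Let Rm := measurableTypeR R.
Let null (E : set (Rm * Rm)) : Prop := (\int[leb2]_(x in E) (k x)%:E = 0)%E.

(** Open rays form a pi-system generating the Borel sets; [None] adds the whole line, with which a
    Dynkin argument starts. *)
Definition ray (o : option R) : set R := if o is Some x then `]x, +oo[%classic else setT.

Lemma measurable_ray o : measurable (ray o : set Rm).
Proof. by case: o => [x|] /=; [exact: measurable_itv|exact: measurableT]. Qed.

Lemma null_diff E F : measurable E -> measurable F -> E `<=` F ->
  null E -> null F -> null (F `\` E).
Proof.
move=> mE mF EF nE nF; have mD := measurableD mF mE.
have : (\int[leb2]_(x in E `|` (F `\` E)) (k x)%:E = 0)%E by rewrite setDUK.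
rewrite integral_setU//; first by rewrite nE add0e.
- by apply: measurable_funTS; exact: measurable_int ik.
- by apply/disj_setPS => x [/= Ex [_]].
Qed.

Lemma null_bigcup (F : (set (Rm * Rm))^nat) : (forall n, measurable (F n)) ->
  trivIset setT F -> (forall n, null (F n)) -> null (\bigcup_n F n).
Proof.
move=> mF tF nF; rewrite /null integral_bigcup//.
  by rewrite eseries0// => n _ _; exact: nF.
apply: integrableS ik => //; exact: bigcup_measurable.
Qed.

Lemma measurable_rays : @measurable _ Rm = <<s [set A | exists x, A = `]x, +oo[%classic] >>.
Proof. exact: RGenOInfty.measurableE. Qed.

Lemma rays_setI : setI_closed ([set A : set R | exists x, A = `]x, +oo[%classic]).
Proof.
move=> _ _ [x ->] [y ->]; exists (Num.max x y); apply/seteqP; split => z /=;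
  by rewrite !in_itv/= !andbT gt_max => /andP.
Qed.

Hypothesis null_rays : forall o1 o2, null (ray o1 `*` ray o2).

(** Dynkin's theorem in one factor while the other is still a ray; the second factor and then the
    product sigma-algebra follow in the same way. *)
Lemma null_left (A : set R) o : measurable (A : set Rm) -> null (A `*` ray o).
Proof.
rewrite measurable_rays; apply: (@dynkin_induction _ Rm _ (fun A => null (A `*` ray o))).
- exact: measurable_rays.
- exact: rays_setI.
- exact: null_rays None o.
- by move=> _ [x ->]; exact: null_rays (Some x) o.
- move=> S mS nS.
  have -> : ~` S `*` ray o = (setT `*` ray o) `\` (S `*` ray o).
    apply/seteqP; split => -[x y] /= => [[nx ry]|[[_ ry] h]]; first by split => // -[].
    by split => // Sx; apply: h.
  apply: null_diff => //.
  + by apply: measurableX => //; exact: measurable_ray.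
  + by apply: measurableX => //; exact: measurable_ray.
  + by move=> [x y] [].
  + exact: null_rays None o.
- move=> F mF tF nF; rewrite setX_bigcupl; apply: null_bigcup => //.
  + by move=> n; apply: measurableX => //; exact: measurable_ray.
  + apply/trivIsetP => i j _ _ ij; rewrite -subset0 => -[x y] /= [[Fi _] [Fj _]].
    by move/trivIsetP : tF => /(_ i j I I ij); rewrite -subset0 => /(_ x); apply.
Qed.

Lemma null_prod (A B : set R) : measurable (A : set Rm) -> measurable (B : set Rm) ->
  null (A `*` B).
Proof.
move=> mA; rewrite measurable_rays; apply: (@dynkin_induction _ Rm _ (fun B => null (A `*` B))).
- exact: measurable_rays.
- exact: rays_setI.
- exact: null_left None mA.
- by move=> _ [x ->]; exact: null_left (Some x) mA.
- move=> S mS nS.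
  have -> : A `*` ~` S = (A `*` setT) `\` (A `*` S).
    apply/seteqP; split => -[x y] /= => [[nx ry]|[[ry _] h]]; first by split => // -[].
    by split => // Sx; apply: h.
  apply: null_diff => //.
  + exact: measurableX.
  + exact: measurableX.
  + by move=> [x y] [].
  + exact: null_left None mA.
- move=> F mF tF nF; rewrite setX_bigcupr; apply: null_bigcup => //.
  + by move=> n; apply: measurableX.
  + apply/trivIsetP => i j _ _ ij; rewrite -subset0 => -[x y] /= [[_ Fi] [_ Fj]].
    by move/trivIsetP : tF => /(_ i j I I ij); rewrite -subset0 => /(_ y); apply.
Qed.

Lemma null_measurable (E : set (Rm * Rm)) : measurable E -> null E.
Proof.
rewrite measurable_prod_measurableType.
apply: (@dynkin_induction _ (Rm * Rm)%type _ null).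
- exact: measurable_prod_measurableType.
- move=> _ _ [A mA [B mB <-]] [A' mA' [B' mB' <-]].
  exists (A `&` A'); first exact: measurableI.
  exists (B `&` B'); first exact: measurableI.
  by rewrite setXI.
- by rewrite -setXTT; exact: null_prod.
- by move=> _ [A mA [B mB <-]]; exact: null_prod.
- move=> S mS nS; rewrite -setTD; apply: null_diff => //.
  by rewrite -setXTT; exact: null_prod.
- exact: null_bigcup.
Qed.

Lemma ae_null : {ae leb2, forall x, k x = 0}.
Proof.
have := @integral_ae_eq _ _ _ leb2 setT measurableT (cst 0%E) (EFin \o k) ik _ _.
case.
- exact: measurable_cst.
- by move=> E _ mE; rewrite integral0; exact: null_measurable.
move=> N [mN N0 sN]; exists N; split => // x nx; apply: sN => /= h; apply: nx.
by have [] := h I.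
Qed.

End rectangles_determine.

(** * Test functions separate functions that are integrable on every box *)

Section separation.
Context {R : realType}.
Variable h : R * R -> R.
Hypothesis hQ : forall Q : box R, rect_int Q h.
Hypothesis h0 : forall (Q : box R) psi, test Q psi -> integ (fun x => h x * psi x) = 0.

Definition orect (a b c d : R) : set (R * R) := `]a, b[%classic `*` `]c, d[%classic.

Lemma measurable_orect a b c d :
  measurable (orect a b c d : set (measurableTypeR R * measurableTypeR R)).
Proof. by apply: measurableX; exact: measurable_itv. Qed.

(** The steepness can be changed at will on a given rectangle; as it tends to 0, exp (- c / quad)
    tends to the indicator of the open interval. *)
Lemma sharp_box (Q : box R) (c : R) : 0 < c -> {Q' : box R |
  [/\ al Q' = al Q, be Q' = be Q, ga Q' = ga Q, de Q' = de Q & cc Q' = c]}.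
Proof.
move=> c0; exists (@Box R (al Q) (be Q) (ga Q) (de Q) c (ka Q)
  (al_lt_be Q) (ga_lt_de Q) c0 (ka_gt0 Q) (@ka_le R Q)).
by [].
Qed.

Lemma bumpf1E (a b c x : R) : a < b ->
  bumpf a b c 1 0 x = if a < x < b then expR (- (c / ((x - a) * (b - x)))) else 0.
Proof.
move=> ab; rewrite /bumpf quadpE hornerC expr0 !mul1r.
suff -> : (0 < (x - a) * (b - x)) = (a < x < b) by [].
apply/idP/idP => [q0|/andP[ax xb]]; last by rewrite mulr_gt0 ?subr_gt0.
by apply/andP; split; rewrite ltNge; apply/negP => H; nra.
Qed.

Lemma cvg_bumpf1 (a b x : R) : a < b ->
  bumpf a b n.+1%:R^-1 1 0 x @[n --> \oo] --> (\1_(`]a, b[%classic) x : R).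
Proof.
move=> ab; under eq_fun do rewrite bumpf1E//.
rewrite indicE; case: (boolP (a < x < b)) => xab; last first.
  by rewrite memNset ?in_itv /= ?(negbTE xab)//=; [exact: cvg_cst|rewrite in_itv/=; apply/negP].
rewrite mem_set; last by rewrite /= in_itv.
rewrite (_ : true%:R = expR (- (0 / ((x - a) * (b - x)))) :> R); last first.
  by rewrite mul0r oppr0 expR0.
apply: (@cvg_comp _ _ _ (fun n : nat => - (n.+1%:R^-1 / ((x - a) * (b - x)))) expR _
  (nbhs (- (0 / ((x - a) * (b - x)))))); last exact: continuous_expR.
by apply: cvgN; apply: cvgMl; exact: cvg_harmonic.
Qed.

Lemma bumpf1_bound (a b c x : R) : a < b -> 0 < c -> 0 <= bumpf a b c 1 0 x <= 1.
Proof.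
move=> ab c0; rewrite bumpf1E//; case: ifPn => [/andP[ax xb]|_]; last by rewrite lexx ler01.
rewrite expR_ge0/= -expR0 ler_expR oppr_le0 divr_ge0 ?mulr_ge0 ?subr_ge0//; exact: ltW.
Qed.

(** Dominated convergence along steepness 1 / (n + 1), with |h| restricted to the closed rectangle
    as dominating function. *)
Lemma integ_orect (Q : box R) :
  integ (fun x => h x * \1_(orect (al Q) (be Q) (ga Q) (de Q)) x) = 0.
Proof.
pose c n : R := n.+1%:R^-1.
pose psi n x := bumpf (al Q) (be Q) (c n) 1 0 x.1 * bumpf (ga Q) (de Q) (c n) 1 0 x.2.
have c0 n : 0 < c n by rewrite invr_gt0.
have Hp n : [/\ integ (fun x => h x * psi n x) = 0, pmeas (psi n) & intg (fun x => h x * psi n x)].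
  have [Q' [e1 e2 e3 e4 e5]] := sharp_box Q (c0 n).
  have t : test Q' (psi n).
    have := test_term Q' 1 1 0 0 0; congr test; apply/funext => x.
    by rewrite expr0 mulr1 /bump1 /bump2 e1 e2 e3 e4 e5.
  split; [exact: h0 t|exact: test_measurable t|].
  exact: (integrable_bsupp (hQ Q') (test_bsupp t)).
have mh : pmeas h by case: (hQ Q).
have mi : pmeas \1_(orect (al Q) (be Q) (ga Q) (de Q)).
  by apply: measurable_indic; exact: measurable_orect.
have [] := @dominated_convergence _ _ _ (@leb2 R) setT measurableT
  (fun n x => (h x * psi n x)%:E)
  (fun x => (h x * \1_(orect (al Q) (be Q) (ga Q) (de Q)) x)%:E)
  (fun x => (`|h x| * \1_(rect Q) x)%:E) _ _ _ _ _.
- by move=> n; apply/measurable_EFinP; apply: pmeasM => //; case: (Hp n).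
- by apply/measurable_EFinP; exact: pmeasM.
- apply: aeW => x _; apply: cvg_EFin; first exact: nearW.
  apply: cvgMr; rewrite /psi.
  have -> : \1_(orect (al Q) (be Q) (ga Q) (de Q)) x =
      \1_(`]al Q, be Q[%classic) x.1 * \1_(`]ga Q, de Q[%classic) x.2 :> R.
    by rewrite !indicE /orect in_setX -mulnb natrM.
  by apply: cvgM; apply: cvg_bumpf1; [exact: al_lt_be|exact: ga_lt_de].
- exact: (integrable_bsupp (rect_int_norm (hQ Q)) (bsupp_indic Q)).
- apply: aeW => x n _; rewrite lee_fin normrM ler_wpM2l//.
  have /andP[a1 a2] := bumpf1_bound x.1 (al_lt_be Q) (c0 n).
  have /andP[b1 b2] := bumpf1_bound x.2 (ga_lt_de Q) (c0 n).
  rewrite ger0_norm ?mulr_ge0// indicE.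
  have [rx|nx] := boolP (x \in rect Q); first by rewrite mulr_ile1.
  suff -> : psi n x = 0 by [].
  apply/eqP; apply: contraNT nx; rewrite mulf_eq0 negb_or => /andP[u v].
  have /andP[? ?] := bump_supp (al_lt_be Q) u; have /andP[? ?] := bump_supp (ga_lt_de Q) v.
  by apply/mem_set/rectP; rewrite !ltW.
move=> ii _ cv.
have e0 n : (\int[leb2]_x (h x * psi n x)%:E = 0)%E.
  have [e _ i] := Hp n.
  by rewrite -[LHS](fineK (integrable_fin_num measurableT i)) -/(Rintegral _ _ _) -/(integ _) e.
have e := cvg_unique _ cv (_ : _ --> (0 : \bar R)).
rewrite /integ /Rintegral [X in fine X]e//.
by under eq_fun do rewrite e0; exact: cvg_cst.
Qed.

Lemma integ_zero : integ (fun _ : R * R => 0) = 0.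
Proof. by rewrite /integ Rintegral_cst// mul0r. Qed.

Lemma integ_orect_sub (a b c d : R) (Q : box R) : al Q <= a -> b <= be Q ->
  integ (fun x => h x * \1_(orect a b c d) x) = 0.
Proof.
move=> qa qb; have [ab|ba] := ltP a b; last first.
  rewrite -integ_zero.
  apply: eq_integ => x; rewrite indicE memNset ?mulr0// /orect/= in_itv/=.
  by move=> [/andP[ax xb] _]; move: (lt_trans ax xb); rewrite ltNge ba.
have [cd|dc] := ltP c d; last first.
  rewrite -integ_zero.
  apply: eq_integ => x; rewrite indicE memNset ?mulr0// /orect/= !in_itv/=.
  by move=> [_ /andP[ax xb]]; move: (lt_trans ax xb); rewrite ltNge dc.
have kle x : a <= x <= b -> ka Q <= x ^+ 2.
  by move=> /andP[ax xb]; apply: ka_le; rewrite (le_trans qa ax) (le_trans xb qb).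
exact: (integ_orect (@Box R a b c d (cc Q) (ka Q) ab cd (cc_gt0 Q) (ka_gt0 Q) kle)).
Qed.

Lemma intg_orect (a b c d : R) (Q : box R) :
  al Q <= a -> b <= be Q -> ga Q <= c -> d <= de Q ->
  intg (fun x => h x * \1_(orect a b c d) x).
Proof.
move=> qa qb qc qd; apply: (integrable_bsupp (hQ Q)); split.
- by apply: measurable_indic; exact: measurable_orect.
- by exists 1 => // x; rewrite indicE; case: (x \in _); rewrite ?normr1 ?normr0.
- move=> x nx; rewrite indicE memNset// => -[]; rewrite /= !in_itv/=.
  move=> /andP[ax xb] /andP[cx xd]; apply: nx; apply/rectP.
  by rewrite (le_trans qa (ltW ax)) (le_trans (ltW xb) qb) (le_trans qc (ltW cx)) (le_trans (ltW xd) qd).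
Qed.

(** The left end point of the intersection of a ray with an interval starting at l: cutting a box by
    rays gives a smaller box or the empty set. *)
Definition ray_low (l : R) (o : option R) : R := if o is Some x then Num.max l x else l.

Lemma ray_low_ge l o : l <= ray_low l o.
Proof. by case: o => [x|] //=; rewrite le_max lexx. Qed.

Lemma ray_itv l b o z :
  (z \in (`]ray_low l o, b[%classic : set R)) =
  (z \in ray o) && (z \in (`]l, b[%classic : set R)).
Proof.
case: o => [x|] /=; last by rewrite in_setT.
apply/idP/andP; rewrite !in_setE/= !in_itv/= ?andbT gt_max.
  by move=> /andP[/andP[-> ->] ->].
by move=> [-> /andP[-> ->]].
Qed.

Lemma ae_null_orect (Q : box R) :
  {ae leb2, forall x, h x * \1_(orect (al Q) (be Q) (ga Q) (de Q)) x = 0}.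
Proof.
have ii := intg_orect (lexx (al Q)) (lexx (be Q)) (lexx (ga Q)) (lexx (de Q)).
apply: (ae_null ii) => o1 o2.
have qa := ray_low_ge (al Q) o1; have qc := ray_low_ge (ga Q) o2.
have e0 := integ_orect_sub (ray_low (ga Q) o2) (de Q) qa (lexx (be Q)).
rewrite integral_mkcond.
have -> : (fun x => (h x * \1_(orect (al Q) (be Q) (ga Q) (de Q)) x)%:E) \_ (ray o1 `*` ray o2) =
    (fun x => (h x * \1_(orect (ray_low (al Q) o1) (be Q) (ray_low (ga Q) o2) (de Q)) x)%:E).
  apply/funext => -[x y]; rewrite /patch !indicE /orect !in_setX/= !ray_itv.
  by case: (x \in ray o1); case: (y \in ray o2) => /=; rewrite ?andbF ?mulr0.
have j := intg_orect qa (lexx (be Q)) qc (lexx (de Q)).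
by rewrite -[LHS](fineK (integrable_fin_num measurableT j)) -/(Rintegral _ _ _) -/(integ _) e0.
Qed.

(** These boxes exhaust the half-plane xi_1 > 0; starting at 2 keeps 1 / (n + 2) < n + 2. *)
Lemma pos_boxes n : {Q : box R | [/\ al Q = n.+2%:R^-1, be Q = n.+2%:R, ga Q = - n.+2%:R & de Q = n.+2%:R]}.
Proof.
have n1 : 1 < n.+2%:R :> R by rewrite ltr1n.
have n0 : 0 < n.+2%:R :> R by rewrite ltr0n.
have l1 : n.+2%:R^-1 < n.+2%:R :> R by rewrite (lt_trans _ n1)// invf_lt1.
have l2 : - n.+2%:R < n.+2%:R :> R by rewrite gtrN.
have k0 : 0 < (n.+2%:R^-1) ^+ 2 :> R by rewrite exprn_gt0// invr_gt0.
have kle (x : R) : n.+2%:R^-1 <= x <= n.+2%:R -> (n.+2%:R^-1) ^+ 2 <= x ^+ 2.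
  move=> /andP[x1 _]; rewrite lerXn2r ?nnegrE ?invr_ge0 ?(ltW n0)//.
  by rewrite (le_trans _ x1)// invr_ge0 ltW.
by exists (Box l1 l2 ltr01 k0 kle).
Qed.

Lemma neg_boxes n : {Q : box R | [/\ al Q = - n.+2%:R, be Q = - n.+2%:R^-1, ga Q = - n.+2%:R & de Q = n.+2%:R]}.
Proof.
have n1 : 1 < n.+2%:R :> R by rewrite ltr1n.
have n0 : 0 < n.+2%:R :> R by rewrite ltr0n.
have l1 : - n.+2%:R < - n.+2%:R^-1 :> R by rewrite ltrN2 (lt_trans _ n1)// invf_lt1.
have l2 : - n.+2%:R < n.+2%:R :> R by rewrite gtrN.
have k0 : 0 < (n.+2%:R^-1) ^+ 2 :> R by rewrite exprn_gt0// invr_gt0.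
have kle (x : R) : - n.+2%:R <= x <= - n.+2%:R^-1 -> (n.+2%:R^-1) ^+ 2 <= x ^+ 2.
  move=> /andP[_]; rewrite lerNr => x1; rewrite -[x ^+ 2]sqrrN lerXn2r ?nnegrE ?invr_ge0 ?(ltW n0)//.
  by rewrite (le_trans _ x1)// invr_ge0 ltW.
by exists (Box l1 l2 ltr01 k0 kle).
Qed.

Lemma leb2_axis1 : leb2.-negligible [set x : R * R | x.1 = 0].
Proof.
have -> : [set x : R * R | x.1 = 0] = [set 0] `*` setT.
  by apply/seteqP; split => -[x y] //= [].
apply/negligibleP; first exact: measurableX.
have e : lebesgue_measure [set (0:R)] = 0%E := lebesgue_measure_set1 0.
by apply: etrans (product_measure1E _ _ _ _) _ => //; apply: etrans (congr1 (fun x => (x * _)%E) e) _; rewrite mul0e.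
Qed.

Lemma leb2_axis2 : leb2.-negligible [set x : R * R | x.2 = 0].
Proof.
have -> : [set x : R * R | x.2 = 0] = setT `*` [set 0].
  by apply/seteqP; split => -[x y] //= [].
apply/negligibleP; first exact: measurableX.
have e : lebesgue_measure [set (0:R)] = 0%E := lebesgue_measure_set1 0.
by apply: etrans (product_measure1E _ _ _ _) _ => //; apply: etrans (congr1 (fun x => (_ * x)%E) e) _; rewrite mule0.
Qed.

Lemma ae_eq0_of_tests : {ae leb2, forall x, h x = 0}.
Proof.
pose P n := sval (pos_boxes n); pose N n := sval (neg_boxes n).
pose bad (Q : box R) := [set x | h x * \1_(orect (al Q) (be Q) (ga Q) (de Q)) x <> 0].
have nP : leb2.-negligible (\bigcup_n bad (P n)).
  by apply: negligible_bigcup => n; exact: ae_null_orect.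
have nN : leb2.-negligible (\bigcup_n bad (N n)).
  by apply: negligible_bigcup => n; exact: ae_null_orect.
apply: negligibleS (negligibleU (negligibleU nP nN) leb2_axis1) => x /= hx.
have [x0|x0] := eqVneq x.1 0; [by right|left].
have [n [n1 n2 n3]] : exists n, [/\ n.+2%:R^-1 < `|x.1|, `|x.1| < n.+2%:R & `|x.2| < n.+2%:R].
  have x1 : 0 < `|x.1| by rewrite normr_gt0.
  (* The sum dominates the three quantities to be bounded, so a single n suffices. *)
  pose y := `|x.1|^-1 + `|x.1| + `|x.2|.
  have i0 : 0 <= `|x.1|^-1 by rewrite invr_ge0.
  have yn : y < (Num.bound y).+2%:R.
    by rewrite (lt_le_trans (archi_boundP _)) ?ler_nat ?addr_ge0// -addn2 leq_addr.
  have a1 := normr_ge0 x.1; have a2 := normr_ge0 x.2.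
  exists (Num.bound y); split; last 2 first.
  - by apply: le_lt_trans yn; rewrite /y; lra.
  - by apply: le_lt_trans yn; rewrite /y; lra.
  - rewrite -[ltRHS]invrK ltf_pV2 ?posrE ?invr_gt0//.
    by apply: le_lt_trans yn; rewrite /y; lra.
have [x1|x1] := ltP 0 x.1.
- left; exists n => //; rewrite /bad/= /P; case: (pos_boxes n) => Q /= [-> -> -> ->].
  rewrite indicE mem_set ?mulr1//; split; rewrite /= in_itv/=.
    by move: n1 n2; rewrite gtr0_norm// => -> ->.
  by rewrite -ltr_norml.
- right; exists n => //; rewrite /bad/= /N; case: (neg_boxes n) => Q /= [-> -> -> ->].
  rewrite indicE mem_set ?mulr1//; split; rewrite /= in_itv/=; last by rewrite -ltr_norml.
  by move: n1 n2; rewrite ler0_norm// ltrNr ltrNl => -> ->.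
Qed.

End separation.

(** * Pointwise kernel bounds *)

Section exponential_decay.
Context {R : realType}.
Implicit Types (p x y t : R).

(** For p > 0 this is y / p <= exp (y / p) raised to the power p. *)
Lemma powR_le_expR p y : 0 <= p -> 0 < y -> y `^ p <= p `^ p * expR y.
Proof.
move=> p0 y0; move: p0; rewrite le_eqVlt => /predU1P[<-|p0].
  by rewrite !powRr0 mul1r; apply: le_trans (expR_ge1Dx y); rewrite lerDl ltW.
have -> : expR y = expR (y / p) `^ p by rewrite -expRM divfK// gt_eqF.
rewrite -powRM ?expR_ge0 ?(ltW p0)//; apply: ge0_ler_powR; rewrite ?nnegrE ?mulr_ge0 ?expR_ge0 ?(ltW p0) ?(ltW y0)//.
rewrite mulrC -ler_pdivrMr//; apply: le_trans (expR_ge1Dx _).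
by rewrite lerDr.
Qed.

Lemma expR_decay p : 0 <= p -> exists2 C, 0 < C & forall y, 0 < y ->
  expR (- y) <= C * y `^ (- p).
Proof.
move=> p0; exists (p `^ p); first by move: p0; rewrite le_eqVlt => /predU1P[<-|p0]; rewrite ?powRr0// powR_gt0.
move=> y y0; rewrite powRN expRN ler_pdivlMr ?powR_gt0// mulrC ler_pdivrMr ?expR_gt0//.
exact: powR_le_expR.
Qed.

Lemma mul_expRN_le1 y : y * expR (- y) <= 1.
Proof.
rewrite expRN ler_pdivrMr ?expR_gt0// mul1r.
by apply: le_trans (expR_ge1Dx y); rewrite lerDr.
Qed.

Lemma sqr_expRN_le4 y : 0 <= y -> y ^+ 2 * expR (- y) <= 4.
Proof.
move=> y0.
have -> : y ^+ 2 * expR (- y) = 4 * (y / 2 * expR (- (y / 2))) ^+ 2.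
  have -> : expR (- y) = expR (- (y / 2)) ^+ 2 by rewrite expr2 -expRD; congr expR; field.
  by field.
rewrite -[leRHS]mulr1 ler_pM2l// expr_le1 ?mul_expRN_le1// mulr_ge0 ?expR_ge0// divr_ge0//.
Qed.

Lemma powR_sqr t p : (t `^ p) ^+ 2 = t `^ (2 * p).
Proof. by rewrite -powR_mulrn ?powR_ge0// -powRrM mulrC. Qed.

Lemma powR_add t p q : 0 < t -> t `^ (p + q) = t `^ p * t `^ q.
Proof. by move=> t0; rewrite powRD// (gt_eqF t0) implybT. Qed.

Lemma powRM3 x y t p : 0 <= x -> 0 <= y -> 0 <= t ->
  (x * y * t) `^ p = x `^ p * y `^ p * t `^ p.
Proof. by move=> x0 y0 t0; rewrite !powRM// mulr_ge0. Qed.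

End exponential_decay.

Section pointwise.
Context {R : realType}.
Variables (nu eta s sigma : R).
Hypotheses (nu0 : 0 < nu) (eta0 : 0 < eta) (s0 : 0 <= s) (sigma0 : 0 <= sigma).
Implicit Types (x : R * R) (t r : R).

(** Its integral against |T^|^2 is the sum of the squares of the two norms that make up
    [neg_norm]. *)
Definition sweight r x : R :=
  enorm x `^ (2 * r) * `|x.1| `^ (- (2 * sigma)) +
  enorm x `^ (2 * r) * `|x.2| `^ (- (2 * sigma)).

Let w x := `|x.1| `^ (- (2 * sigma)) + `|x.2| `^ (- (2 * sigma)).
Let a := @sa R eta.
Let b := @sb R nu.
Let m x := Num.min (a x) (b x).
Let p x := (a x + b x) / 2.
(** The smaller diffusivity, for which p >= (ka / 2) |xi|^2; inside this section it hides the field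
    [ka] of a box. *)
Let ka := Num.min nu eta.
Let G t x := kerG (a x) (b x) (sr x) t.

Lemma sweightE r x : sweight r x = enorm x `^ (2 * r) * w x.
Proof. by rewrite /sweight mulrDr. Qed.

Lemma w_ge0 x : 0 <= w x. Proof. by rewrite addr_ge0 ?powR_ge0. Qed.

Lemma sweight_ge0 r x : 0 <= sweight r x.
Proof. by rewrite sweightE mulr_ge0 ?powR_ge0 ?w_ge0. Qed.

Lemma ka_pos : 0 < ka. Proof. by rewrite lt_min nu0 eta0. Qed.

Lemma sa_ge0 x : 0 <= a x. Proof. by rewrite mulr_ge0 ?sqr_ge0// ltW. Qed.
Lemma sb_ge0 x : 0 <= b x. Proof. by rewrite mulr_ge0 ?sqr_ge0// ltW. Qed.
Lemma m_ge0 x : 0 <= m x. Proof. by rewrite le_min sa_ge0 sb_ge0. Qed.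

Lemma p_ge x : ka / 2 * enorm x ^+ 2 <= p x.
Proof.
rewrite enorm_sqr /rho /p /a /b /sa /sb.
have h1 : ka * x.1 ^+ 2 <= eta * x.1 ^+ 2 by rewrite ler_wpM2r ?sqr_ge0// ge_min lexx orbT.
have h2 : ka * x.2 ^+ 2 <= nu * x.2 ^+ 2 by rewrite ler_wpM2r ?sqr_ge0// ge_min lexx.
lra.
Qed.

Lemma norm_le_enorm1 x : `|x.1| <= enorm x.
Proof. by rewrite -sqrtr_sqr ler_wsqrtr// lerDl sqr_ge0. Qed.

Lemma enorm_gt0 x : x.1 != 0 -> 0 < enorm x.
Proof. by move=> x1; apply: lt_le_trans (norm_le_enorm1 x); rewrite normr_gt0. Qed.

Lemma p_gt0 x : x.1 != 0 -> 0 < p x.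
Proof.
move=> x1; apply: lt_le_trans (p_ge x).
by rewrite mulr_gt0 ?divr_gt0 ?ka_pos// exprn_gt0// enorm_gt0.
Qed.

(** The minimum is eta xi_1^2 or nu xi_2^2, and exp (- y) <= C y^(-sigma) gives t^(-sigma) with the
    weight of that variable. As either case may occur, both weights are summed. *)
Lemma decay_min : exists2 C, 0 < C & forall t x, 0 < t -> x.1 != 0 -> x.2 != 0 ->
  expR (- (m x * t)) <= C * (t `^ (- sigma) * w x).
Proof.
have [C C0 hC] := expR_decay sigma0.
have one k y t : 0 < k -> 0 < t -> y != 0 ->
    expR (- (k * y ^+ 2 * t)) <= C * k `^ (- sigma) * (t `^ (- sigma) * `|y| `^ (- (2 * sigma))).
  move=> k0 t0 y0; have y20 : 0 < y ^+ 2 by rewrite exprn_even_gt0.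
  apply: (le_trans (hC _ _)); first by apply: mulr_gt0 => //; exact: mulr_gt0.
  rewrite (powRM3 _ (ltW k0) (ltW y20) (ltW t0)).
  rewrite -[y ^+ 2]real_normK ?num_real// -powR_mulrn// -powRrM mulrN le_eqVlt.
  by apply/orP; left; apply/eqP; ring.
exists (C * eta `^ (- sigma) + C * nu `^ (- sigma)).
  by rewrite addr_gt0// mulr_gt0// powR_gt0.
move=> t x t0 x1 x2; have tp := powR_ge0 t (- sigma).
have c1 : 0 <= C * eta `^ (- sigma) by rewrite mulr_ge0 ?powR_ge0// ltW.
have c2 : 0 <= C * nu `^ (- sigma) by rewrite mulr_ge0 ?powR_ge0// ltW.
have y1 : 0 <= t `^ (- sigma) * `|x.1| `^ (- (2 * sigma)) by rewrite mulr_ge0 ?powR_ge0.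
have y2 : 0 <= t `^ (- sigma) * `|x.2| `^ (- (2 * sigma)) by rewrite mulr_ge0 ?powR_ge0.
rewrite /w mulrDr mulrDl !mulrDr.
have z1 := mulr_ge0 c1 y2; have z2 := mulr_ge0 c2 y1.
have z3 := mulr_ge0 c2 y2; have z4 := mulr_ge0 c1 y1.
have := one _ _ _ eta0 t0 x1; have := one _ _ _ nu0 t0 x2.
rewrite /m /Num.min; case: ifP => _ h1 h2.
  by apply: (le_trans h2); rewrite -addrA lerDl !addr_ge0.
by apply: (le_trans h1); rewrite addrA lerDr !addr_ge0.
Qed.

(** The energy bound is symmetric in a and b, so it serves both orders: (a, b) for u and (b, a) for
    theta. Half of the exponential decay is enough. *)
Lemma kernel_K_bound : exists2 C, 0 < C & forall t x, 0 < t -> x.1 != 0 -> x.2 != 0 ->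
  enorm x `^ (2 * s) * kerK (a x) (b x) (sr x) t ^+ 2 <= C * t `^ (- sigma) * sweight s x /\
  enorm x `^ (2 * s) * kerK (b x) (a x) (sr x) t ^+ 2 <= C * t `^ (- sigma) * sweight s x.
Proof.
have [C C0 hC] := decay_min; exists C => // t x t0 x1 x2.
have /andP[r0 _] := sr_bounds x; have := hC t x t0 x1 x2.
have ma : m x <= a x by rewrite ge_min lexx.
have mb : m x <= b x by rewrite ge_min lexx orbT.
have e2 : expR (- (2 * m x * t)) <= expR (- (m x * t)).
  have mt : 0 <= m x * t by rewrite mulr_ge0 ?m_ge0// ltW.
  by rewrite ler_expR lerN2; lra.
rewrite sweightE => h.
have key k : k <= expR (- (2 * m x * t)) ->
    enorm x `^ (2 * s) * k <= C * t `^ (- sigma) * (enorm x `^ (2 * s) * w x).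
  move=> kl; rewrite mulrCA ler_wpM2l ?powR_ge0// -mulrA.
  exact: le_trans kl (le_trans e2 h).
by split; apply: key; apply: kerK_bound => //; exact: ltW.
Qed.

(* Where the discriminant is at most (p/2)^2 the kernel decays like a heat
   kernel; where it is larger, only the slow root matters. *)
Lemma kernel_G_dichotomy : exists2 C, 0 < C & forall t x, 0 < t -> x.1 != 0 -> x.2 != 0 ->
  enorm x `^ (2 * s) * G t x ^+ 2 <= C * t `^ (2 - (s + sigma)) * sweight 0 x \/
  G t x ^+ 2 <= (p x)^-1 ^+ 2 * expR (- (sr x / p x * t)) * expR (- (m x * t)).
Proof.
have ss0 : 0 <= s + sigma by rewrite addr_ge0.
have [C C0 hC] := expR_decay ss0.
have k2 : 0 < ka / 2 by rewrite divr_gt0 ?ka_pos.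
exists (C * (ka / 2) `^ (- (s + sigma))); first by rewrite mulr_gt0// powR_gt0.
move=> t x t0 x1 x2; have p0 := p_gt0 x1; have /andP[r0 _] := sr_bounds x.
have e0 := enorm_gt0 x1.
have [D|D] := leP (disc (a x) (b x) (sr x)) ((p x / 2) ^+ 2); [left|right].
- have := kerG_small_disc (ltW p0) (ltW t0) D; rewrite -/(G t x) => h.
  have g2 : G t x ^+ 2 <= t ^+ 2 * expR (- (ka / 2 * enorm x ^+ 2 * t)).
    apply: (@le_trans _ _ (t ^+ 2 * expR (- (p x * t)))).
      have -> : expR (- (p x * t)) = expR (- (p x / 2 * t)) ^+ 2.
        by rewrite expr2 -expRD; congr expR; field.
      rewrite -exprMn -[G t x ^+ 2]real_normK ?num_real// lerXn2r ?nnegrE//.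
      by rewrite mulr_ge0 ?expR_ge0// ltW.
    by rewrite ler_wpM2l ?sqr_ge0// ler_expR lerN2 ler_wpM2r ?(ltW t0)// p_ge.
  apply: (le_trans (ler_wpM2l (powR_ge0 _ _) g2)).
  have hh := hC (ka / 2 * enorm x ^+ 2 * t).
  apply: (@le_trans _ _ (enorm x `^ (2 * s) * (t ^+ 2 *
     (C * (ka / 2 * enorm x ^+ 2 * t) `^ (- (s + sigma)))))).
    rewrite ler_wpM2l ?powR_ge0// ler_wpM2l ?sqr_ge0// hh//.
    by rewrite !mulr_gt0// ?exprn_gt0// ?ka_pos ?invr_gt0.
  rewrite (powRM3 _ (ltW k2) (sqr_ge0 _) (ltW t0)).
  rewrite powR_add// (_ : t `^ 2 = t ^+ 2); last by rewrite -powR_mulrn// ltW.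
  (* The first factor cancels |xi|^(2 s); the second is at most |xi_1|^(-2 sigma) because |xi_1| <=
     |xi|. Hence the weight of order 0 on the right. *)
  have -> : (enorm x ^+ 2) `^ (- (s + sigma)) = enorm x `^ (- (2 * s)) * enorm x `^ (- (2 * sigma)).
    by rewrite -powR_mulrn ?(ltW e0)// -powRrM -powR_add//; congr powR; ring.
  rewrite sweightE mulr0 powRr0 mul1r.
  have ee : enorm x `^ (2 * s) * enorm x `^ (- (2 * s)) = 1.
    by rewrite powRN mulfV// gt_eqF// powR_gt0.
  set e1 := enorm x `^ (2 * s) in ee *; set e2 := enorm x `^ (- (2 * s)) in ee *.
  set kk := (ka / 2) `^ _; set tt := t `^ _; set e3 := enorm x `^ _.
  have -> : e1 * (t ^+ 2 * (C * (kk * (e2 * e3) * tt))) = C * kk * (t ^+ 2 * tt) * (e1 * e2) * e3 by ring.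
  rewrite ee mulr1 ler_wpM2l//; first by rewrite !mulr_ge0 ?powR_ge0 ?sqr_ge0// ltW.
  rewrite /w (@le_trans _ _ (`|x.1| `^ (- (2 * sigma))))// ?lerDl ?powR_ge0//.
  rewrite /e3 !powRN lef_pV2 ?posrE ?powR_gt0 ?normr_gt0//.
  apply: ge0_ler_powR; rewrite ?mulr_ge0 ?nnegrE ?(ltW e0)//.
  exact: norm_le_enorm1.
- have abr : 0 <= a x * b x + sr x by rewrite addr_ge0// mulr_ge0 ?sa_ge0 ?sb_ge0.
  have := kerG_large_disc p0 (ltW t0) abr D; rewrite -/(G t x) -/(p x) => h.
  apply: (@le_trans _ _ ((p x)^-1 ^+ 2 * expR (- ((a x * b x + sr x) / p x * t)))).
    have -> : expR (- ((a x * b x + sr x) / p x * t)) =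
        expR (- ((a x * b x + sr x) / (2 * p x) * t)) ^+ 2.
      by rewrite expr2 -expRD; congr expR; field; rewrite gt_eqF.
    rewrite -exprMn -[G t x ^+ 2]real_normK ?num_real// lerXn2r ?nnegrE//.
    by rewrite mulr_ge0 ?expR_ge0// invr_ge0 ltW.
  rewrite -[leRHS]mulrA ler_wpM2l ?sqr_ge0// -expRD ler_expR.
  (* a b is the product of the minimum and the maximum, and p is at most the maximum. So the part a
     b / p of the slow rate gives exp (- m t), while r / p is kept. *)
  have hm : m x <= a x * b x / p x.
    rewrite ler_pdivlMr// /m /p /Num.min; have := sa_ge0 x; have := sb_ge0 x.
    by case: ltP => ab b0' a0'; nra.
  have : m x * t <= a x * b x / p x * t by rewrite ler_wpM2r// ltW.
  by rewrite [(_ + _) / p x]mulrDl [(_ + _) * t]mulrDl; lra.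
Qed.

Lemma invp_le x : x.1 != 0 -> (p x)^-1 <= 2 / ka * enorm x `^ (- 2).
Proof.
move=> x1; have e0 := enorm_gt0 x1; have k0 := ka_pos.
rewrite powRN (_ : enorm x `^ 2 = enorm x ^+ 2); last by rewrite -powR_mulrn// ltW.
rewrite -[2 / ka]invf_div -invfM lef_pV2 ?posrE ?p_gt0 ?p_ge//.
by rewrite mulr_gt0 ?divr_gt0// exprn_gt0.
Qed.

Lemma slow_ge0 x : x.1 != 0 -> 0 <= sr x / p x.
Proof. by move=> x1; have /andP[r0 _] := sr_bounds x; rewrite divr_ge0// ltW// p_gt0. Qed.

(** The squared mixed symbol is [sr] times xi_2^2 / |xi|^2: it supplies one factor r where the
    squared symbol of d_11 supplies two. Hence t^(-1/2) for u_1 and t^(-1) for u_2. *)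
Lemma riesz12_sqr_le x : riesz_symbol ax1 ax2 x ^+ 2 <= sr x.
Proof.
rewrite /sr /riesz_symbol enorm_sqr /Defs.coord/=.
have [->|r0] := eqVneq (rho x) 0; first by rewrite invr0 !mulr0 expr0n.
have r1 : 0 < rho x by rewrite lt_neqAle eq_sym r0 rho_ge0.
have -> : (x.1 * x.2 / rho x) ^+ 2 = x.1 * x.1 / rho x * (x.2 ^+ 2 / rho x) by field.
rewrite ler_piMr//; first by rewrite divr_ge0 ?rho_ge0// -expr2 sqr_ge0.
by rewrite ler_pdivrMr// mul1r lerDr sqr_ge0.
Qed.

(* In the region of large discriminant, [y exp(-y t) <= 1/t] with y = sr / p
   trades the Riesz symbols for powers of [t]. *)
Lemma kernel_G_bound (q : R * R -> R) (c r e : R) : 0 < c ->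
  (forall x, q x ^+ 2 <= 1) ->
  (forall t x, 0 < t -> x.1 != 0 -> x.2 != 0 ->
    enorm x `^ (2 * s) * (q x ^+ 2 * ((p x)^-1 ^+ 2 * expR (- (sr x / p x * t)))) <=
    c * t `^ e * enorm x `^ (2 * r)) ->
  exists2 C, 0 < C & forall t x, 0 < t -> x.1 != 0 -> x.2 != 0 ->
  enorm x `^ (2 * s) * (q x ^+ 2 * G t x ^+ 2) <=
  C * t `^ (2 - (s + sigma)) * sweight 0 x + C * t `^ (e - sigma) * sweight r x.
Proof.
move=> c0 q1 hq; have [C1 C10 h1] := kernel_G_dichotomy; have [C2 C20 h2] := decay_min.
exists (C1 + c * C2); first by rewrite addr_gt0// mulr_gt0.
move=> t x t0 x1 x2; rewrite [(C1 + _) * _]mulrDl [(C1 + _) * _ `^ _]mulrDl ![(C1 * _ + _) * _]mulrDl.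
have n1 : 0 <= C1 * t `^ (2 - (s + sigma)) * sweight 0 x.
  by rewrite !mulr_ge0 ?powR_ge0 ?sweight_ge0// ltW.
have n2 : 0 <= c * C2 * t `^ (2 - (s + sigma)) * sweight 0 x.
  by rewrite !mulr_ge0 ?powR_ge0 ?sweight_ge0// ltW.
have n3 : 0 <= C1 * t `^ (e - sigma) * sweight r x.
  by rewrite !mulr_ge0 ?powR_ge0 ?sweight_ge0// ltW.
have n4 : 0 <= c * C2 * t `^ (e - sigma) * sweight r x.
  by rewrite !mulr_ge0 ?powR_ge0 ?sweight_ge0// ltW.
have [h|h] := h1 t x t0 x1 x2.
- apply: (@le_trans _ _ (enorm x `^ (2 * s) * G t x ^+ 2)).
    by rewrite ler_wpM2l ?powR_ge0// ler_piMl ?sqr_ge0.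
  by apply: (le_trans h); rewrite -[leRHS]addrA lerDl; apply: addr_ge0 => //; exact: addr_ge0.
- apply: (@le_trans _ _ (c * C2 * t `^ (e - sigma) * sweight r x)); last first.
    by rewrite addrA lerDr; apply: addr_ge0 => //; exact: addr_ge0.
  apply: (@le_trans _ _ (enorm x `^ (2 * s) * (q x ^+ 2 * ((p x)^-1 ^+ 2 *
     expR (- (sr x / p x * t)))) * expR (- (m x * t)))).
    by rewrite -[leRHS]mulrA ler_wpM2l ?powR_ge0// -[leRHS]mulrA ler_wpM2l ?sqr_ge0.
  apply: (@le_trans _ _ (c * t `^ e * enorm x `^ (2 * r) * (C2 * (t `^ (- sigma) * w x)))).
    apply: ler_pM => //; rewrite ?expR_ge0 ?hq ?h2//.
    by apply: mulr_ge0; rewrite ?powR_ge0//; apply: mulr_ge0; rewrite ?sqr_ge0//;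
      apply: mulr_ge0; rewrite ?sqr_ge0 ?expR_ge0.
  rewrite sweightE (powR_add e _ t0) le_eqVlt; apply/orP; left; apply/eqP; ring.
Qed.

Lemma enorm_shift r k x : x.1 != 0 ->
  enorm x `^ (2 * r) * enorm x `^ (- 2) ^+ k = enorm x `^ (2 * (r - k%:R)).
Proof.
move=> x1; rewrite -powR_mulrn ?powR_ge0// -powRrM -powR_add ?enorm_gt0//.
by congr powR; ring.
Qed.

(** With y = r / p, the factor r p^-2 exp (- y t) is p^-1 times y exp (- y t) <= 1 / t. The
    remaining 1 / p, at most a constant times |xi|^-2, lowers s to s - 1. *)
Lemma kernel_G_u1 : exists2 C, 0 < C & forall t x, 0 < t -> x.1 != 0 -> x.2 != 0 ->
  enorm x `^ (2 * s) * (riesz_symbol ax1 ax2 x ^+ 2 * G t x ^+ 2) <=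
  C * t `^ (2 - (s + sigma)) * sweight 0 x + C * t `^ (- 1 - sigma) * sweight (s - 1) x.
Proof.
have k0 := ka_pos.
apply: (@kernel_G_bound _ (2 / ka)); first by rewrite divr_gt0.
  by move=> x; apply: le_trans (riesz12_sqr_le x) _; have /andP[] := sr_bounds x.
move=> t x t0 x1 x2; have p0 := p_gt0 x1; have /andP[r0 _] := sr_bounds x.
rewrite -(enorm_shift s 1 x1) expr1.
set E := expR _; have E0 : 0 <= E := expR_ge0 _.
have h : sr x / p x * t * E <= 1 by exact: mul_expRN_le1.
have h' : sr x / p x * E <= t^-1.
  by rewrite -[t^-1]mul1r ler_pdivlMr// mulrAC.
rewrite powR_inv1 ?(ltW t0)// [leRHS]mulrCA ler_wpM2l ?powR_ge0//.
apply: (@le_trans _ _ ((p x)^-1 * (sr x / p x * E))).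
  have -> : (p x)^-1 * (sr x / p x * E) = sr x * ((p x)^-1 ^+ 2 * E) by ring.
  by rewrite ler_wpM2r ?riesz12_sqr_le// mulr_ge0 ?sqr_ge0.
rewrite [leRHS]mulrAC; apply: ler_pM => //; last exact: invp_le.
- by rewrite invr_ge0 ltW.
- by apply: mulr_ge0 => //; exact: slow_ge0.
Qed.

(** Both factors 1 / p are spent on y^2 exp (- y t) <= 4 / t^2, so the order s is unchanged. *)
Lemma kernel_G_u2 : exists2 C, 0 < C & forall t x, 0 < t -> x.1 != 0 -> x.2 != 0 ->
  enorm x `^ (2 * s) * (sr x ^+ 2 * G t x ^+ 2) <=
  C * t `^ (2 - (s + sigma)) * sweight 0 x + C * t `^ (- 2 - sigma) * sweight s x.
Proof.
apply: (@kernel_G_bound _ 4) => //.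
  by move=> x; have /andP[r0 r1] := sr_bounds x; rewrite expr_le1.
move=> t x t0 x1 x2; have p0 := p_gt0 x1; have /andP[r0 _] := sr_bounds x.
set E := expR _.
have h : (sr x / p x * t) ^+ 2 * E <= 4.
  by apply: sqr_expRN_le4; apply: mulr_ge0; [exact: slow_ge0|exact: ltW].
rewrite mulrC ler_wpM2r ?powR_ge0// powRN (_ : t `^ 2 = t ^+ 2); last by rewrite -powR_mulrn// ltW.
by rewrite ler_pdivlMr ?exprn_gt0//; move: h; congr (_ <= _); ring.
Qed.

(** Without a Riesz symbol nothing is traded for time: p^-2 gives |xi|^-4, that is the order s - 2.
    The factor 1 squared is the constant symbol of [kernel_G_bound]. *)
Lemma kernel_G_theta : exists2 C, 0 < C & forall t x, 0 < t -> x.1 != 0 -> x.2 != 0 ->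
  enorm x `^ (2 * s) * (1 ^+ 2 * G t x ^+ 2) <=
  C * t `^ (2 - (s + sigma)) * sweight 0 x + C * t `^ (0 - sigma) * sweight (s - 2) x.
Proof.
have k0 := ka_pos; have k2 : 0 < 2 / ka by rewrite divr_gt0.
apply: (@kernel_G_bound (fun=> 1) ((2 / ka) ^+ 2)); first by rewrite exprn_gt0.
  by rewrite expr1n.
move=> t x t0 x1 x2; have p0 := p_gt0 x1; have /andP[r0 _] := sr_bounds x.
rewrite -(enorm_shift s 2 x1) powRr0 expr1n mul1r mulr1 [leRHS]mulrCA ler_wpM2l ?powR_ge0//.
apply: (@le_trans _ _ ((p x)^-1 ^+ 2)).
  rewrite ler_piMr ?sqr_ge0// -[leRHS]expR0 ler_expR oppr_le0.
  by apply: mulr_ge0; [exact: slow_ge0|exact: ltW].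
have ip := invp_le x1; have ip0 : 0 <= (p x)^-1 by rewrite invr_ge0 ltW.
by rewrite -exprMn lerXn2r ?nnegrE// (le_trans ip0).
Qed.

End pointwise.

(** * Decay estimates *)

Lemma ae_leb2S (R : realType) (P Q : R * R -> Prop) : (forall x, P x -> Q x) ->
  {ae leb2, forall x, P x} -> {ae leb2, forall x, Q x}.
Proof. by move=> PQ; apply: negligibleS => x /=; apply: contra_not; exact: PQ. Qed.

Lemma ae_leb2I (R : realType) (P Q : R * R -> Prop) :
  {ae leb2, forall x, P x} -> {ae leb2, forall x, Q x} -> {ae leb2, forall x, P x /\ Q x}.
Proof.
move=> nP nQ; apply: negligibleS (negligibleU nP nQ) => x /= /not_andP.
by [].
Qed.

Section fourier_solution.
Context {R : realType}.
Variables (nu eta sigma : R) (nu0 : 0 < nu) (eta0 : 0 < eta) (sigma0 : 0 <= sigma).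
Implicit Types (Q : box R) (T : dist R).

Lemma rect_int_intg Q (h : R * R -> R) : pmeas h ->
  intg (fun x => h x * \1_(rect Q) x) -> rect_int Q h.
Proof.
move=> mh ih; split => //; have mQ := measurable_rect Q.
have := integrableS measurableT mQ (@subsetT _ _) ih.
apply: eq_integrable => // x xQ.
by rewrite /= indicE xQ mulr1.
Qed.

Lemma rect_int_mul Q (h k : R * R -> R) : rect_int Q h -> pmeas k ->
  (exists2 M, 0 <= M & forall x, rect Q x -> `|k x| <= M) ->
  rect_int Q (fun x => h x * k x).
Proof.
move=> hQ mk kM; apply: rect_int_intg; first by apply: pmeasM => //; case: hQ.
have [M M0 hM] := kM.
have bk : bsupp Q (fun x => k x * \1_(rect Q) x).
  by apply: bsuppM (bsupp_indic Q) => //; exists M.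
have := integrable_bsupp hQ bk.
by congr integrable; apply/funext => x /=; rewrite mulrA.
Qed.

Lemma rect_intB Q (h k : R * R -> R) : rect_int Q h -> rect_int Q k ->
  rect_int Q (fun x => h x - k x).
Proof.
move=> hQ kQ; apply: rect_int_intg.
  by apply: pmeasB; [case: hQ|case: kQ].
have := intgB (integrable_bsupp hQ (bsupp_indic Q)) (integrable_bsupp kQ (bsupp_indic Q)).
by congr intg; apply/funext => x /=; rewrite mulrBl.
Qed.

Lemma rect_int_hat Q T re : in_neg_space 0 sigma T ->
  rect_int Q (fun x => part re (hat T x)).
Proof.
move=> [_ fin1 _]; have [c _ hc] := hat_rect_int Q sigma0.
have : (aniso_norm ax1 0 sigma T <= (fine (aniso_norm ax1 0 sigma T))%:E)%E.
  rewrite fineK// ge0_fin_numE// /aniso_norm /weighted_norm; case: ifP => // _.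
  exact: poweR_ge0.
by move=> /hc -/(_ re)[].
Qed.

Lemma rect_int_riesz Q (i j : 'I_2) (h : R * R -> R) : rect_int Q h ->
  rect_int Q (fun x => h x * riesz_symbol i j x).
Proof.
move=> hQ; apply: rect_int_mul => //; first exact: pmeas_riesz.
have c1 (k : 'I_2) (x : R * R) : `|Defs.coord k x| <= enorm x.
  rewrite /Defs.coord; case: ifP => _; first exact: norm_le_enorm1.
  by rewrite -sqrtr_sqr ler_wsqrtr// lerDr sqr_ge0.
exists 1 => // x _; rewrite /riesz_symbol normrM normfV !normrM.
have [->|e0] := eqVneq (enorm x) 0; first by rewrite normr0 mulr0 invr0 mulr0.
have e1 : 0 < enorm x by rewrite lt_neqAle eq_sym e0 sqrtr_ge0.
by rewrite (gtr0_norm e1) ler_pdivrMr ?mulr_gt0// mul1r ler_pM.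
Qed.

(** Both sides are integrable on every box and have the same test integrals by [weak_solution], so
    they agree almost everywhere; the null set may depend on t. *)
Lemma solution_hat (W : R -> dist R) (W0 V0 : dist R) re (f g : R * R -> R) (t : R) :
  solves nu eta sigma W W0 V0 ->
  (forall Q, rect_int Q f) -> (forall Q, rect_int Q g) ->
  (forall Q psi, test Q psi ->
    W0 (four (phase re) psi) = integ (fun x => f x * psi x)) ->
  (forall Q psi, test Q psi ->
    V0 (four (phase re) psi) = integ (fun x => (g x - sb nu x * f x) * psi x)) ->
  0 < t ->
  {ae leb2, forall x, part re (hat (W t) x) = wsol (sa eta) (sb nu) sr f g t x}.
Proof.
move=> Wsol fQ gQ W0f V0g t0.
have [_ H _ _] := Wsol; have [M hM] := H t (ltW t0).
have Mt : (neg_norm 0 sigma (W t) <= M%:E)%E by apply: hM; rewrite (ltW t0) lexx.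
have hQ Q : rect_int Q (fun x => part re (hat (W t) x)).
  have [c _ hc] := hat_rect_int Q sigma0.
  by have [] := hc _ _ re (le_trans (aniso_le_neg _ _ _) Mt).
have wQ Q : rect_int Q (wsol (sa eta) (sb nu) sr f g t).
  have [L L0 hL] := symbol_bound nu0 eta0 Q.
  have ma := pmeas_sa eta; have mb := pmeas_sb nu; have mr := @pmeas_riesz R ax1 ax1.
  have [mf _] := fQ Q; have [mg _] := gQ Q.
  apply: rect_int_intg.
    by apply: pmeasD; apply: pmeasM => //; [exact: pmeas_kerK|exact: pmeas_kerG].
  by apply: (@intg_wsol R Q _ _ _ L) => //; [| | |exact: bsupp_indic] => x /hL[].
have hwQ Q := rect_intB (hQ Q) (wQ Q).
apply: (ae_leb2S _ (ae_eq0_of_tests hwQ _)) => [x /eqP|Q psi tp].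
  by rewrite subr_eq0 => /eqP.
have bp := test_bsupp tp.
transitivity (integ (fun x => part re (hat (W t) x) * psi x) -
    integ (fun x => wsol (sa eta) (sb nu) sr f g t x * psi x)).
  rewrite -integB; [|exact: integrable_bsupp (hQ Q) bp|exact: integrable_bsupp (wQ Q) bp].
  by apply: eq_integ => x; ring.
rewrite -(X_hat re tp Mt).
rewrite (weak_solution nu0 eta0 sigma0 Wsol (fQ Q) (gQ Q) (W0f Q) (V0g Q) tp t0).
by rewrite subrr.
Qed.

End fourier_solution.

(** * From pointwise bounds on the kernels to bounds on the norms *)

Section norms.
Context {R : realType}.
Variables (sigma : R).
Implicit Types (T S : dist R).

Lemma sq_modulus_ge0 (z : R[i]) : 0 <= sq_modulus z.
Proof. by rewrite addr_ge0 ?sqr_ge0. Qed.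

Lemma in_neg_space_fourier r T : in_neg_space r sigma T -> is_fourier T (hat T).
Proof. by move=> [_ /aniso_norm_fourier h _]; exact: hat_is_fourier. Qed.

Lemma pmeas_sweight r : pmeas (@sweight R sigma r).
Proof. by apply: pmeasD; [exact: (pmeas_weight ax1)|exact: (pmeas_weight ax2)]. Qed.

(** [neg_norm] is a sum A1 + A2 of two norms while the integral gives A1^2 + A2^2, which is at most
    (A1 + A2)^2. *)
Lemma neg_norm_integral r T : in_neg_space r sigma T ->
  exists2 A, 0 <= A & neg_norm r sigma T = A%:E /\
    (\int[leb2]_x (sweight sigma r x * sq_modulus (hat T x))%:E <= (A ^+ 2)%:E)%E.
Proof.
move=> h; have Tg := in_neg_space_fourier h; case: h => _ fin1 fin2.
have one i : (aniso_norm i r sigma T < +oo)%E -> exists2 A, 0 <= A &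
    aniso_norm i r sigma T = A%:E /\
    (\int[leb2]_x (enorm x `^ (2 * r) * `|Defs.coord i x| `^ (- (2 * sigma)) *
      sq_modulus (hat T x))%:E <= (A ^+ 2)%:E)%E.
  rewrite /aniso_norm /weighted_norm asboolT; last by exists (hat T).
  set I := (\int[leb2]_x _)%E => fin.
  have I0 : (0 <= I)%E.
    apply: integral_ge0 => x _; rewrite lee_fin.
    by rewrite !mulr_ge0 ?powR_ge0 ?sq_modulus_ge0.
  have e : (I `^ 2^-1 = (fine (I `^ 2^-1))%:E)%E.
    by rewrite fineK// ge0_fin_numE// poweR_ge0.
  exists (fine (I `^ 2^-1)); first by rewrite fine_ge0// poweR_ge0.
  by split => //; apply: poweR_half_le => //; rewrite -e.
have [A1 A10 [e1 i1]] := one _ fin1; have [A2 A20 [e2 i2]] := one _ fin2.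
exists (A1 + A2); first exact: addr_ge0.
split; first by rewrite /neg_norm e1 e2.
have ms := pmeas_sq_modulus Tg.
apply: (@le_trans _ _ (A1 ^+ 2 + A2 ^+ 2)%:E).
  rewrite EFinD; apply: le_trans (leeD i1 i2).
  rewrite -ge0_integralD//=; last 4 first.
  - by move=> x _; rewrite lee_fin !mulr_ge0 ?powR_ge0 ?sq_modulus_ge0.
  - by apply/measurable_EFinP; apply: pmeasM => //; exact: pmeas_weight.
  - by move=> x _; rewrite lee_fin !mulr_ge0 ?powR_ge0 ?sq_modulus_ge0.
  - by apply/measurable_EFinP; apply: pmeasM => //; exact: pmeas_weight.
  rewrite le_eqVlt; apply/orP; left; apply/eqP; apply: eq_integral => x _.
  by rewrite -EFinD -mulrDl /sweight /Defs.coord.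
have := mulr_ge0 A10 A20; rewrite lee_fin !expr2; lra.
Qed.

Lemma hdot_norm_le s T A : (exists g, is_fourier T g) -> 0 <= A ->
  (\int[leb2]_x (enorm x `^ (2 * s) * sq_modulus (hat T x))%:E <= (A ^+ 2)%:E)%E ->
  (hdot_norm s T <= A%:E)%E.
Proof.
move=> Tg A0; rewrite /hdot_norm /weighted_norm asboolT//.
set I := (\int[leb2]_x _)%E => IA.
have I0 : (0 <= I)%E.
  by apply: integral_ge0 => x _; rewrite lee_fin mulr_ge0 ?powR_ge0 ?sq_modulus_ge0.
have -> : A%:E = ((A ^+ 2)%:E `^ 2^-1)%E.
  by rewrite poweR_EFin powR12_sqrt ?sqr_ge0// sqrtr_sqr ger0_norm.
by apply: gt0_ler_poweR; rewrite ?in_itv/= ?I0 ?lee_fin ?sqr_ge0 ?leey.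
Qed.

(** The shape c f + g allows iteration starting from g = 0, which explains the trailing + 0 in the
    sums to come. *)
Lemma integral_add (f g : R * R -> R) (c : R) (A B : R) : 0 <= c ->
  pmeas f -> pmeas g -> (forall x, 0 <= f x) -> (forall x, 0 <= g x) ->
  (\int[leb2]_x (f x)%:E <= A%:E)%E -> (\int[leb2]_x (g x)%:E <= B%:E)%E ->
  (\int[leb2]_x (c * f x + g x)%:E <= (c * A + B)%:E)%E.
Proof.
move=> c0 mf mg f0 g0 fA gB; under eq_integral do rewrite EFinD EFinM.
rewrite ge0_integralD//=; last 4 first.
- by move=> x _; rewrite -EFinM lee_fin mulr_ge0.
- under eq_fun do rewrite -EFinM.
  by apply/measurable_EFinP; apply: pmeasM => //; exact: pmeas_cst.
- by move=> x _; rewrite lee_fin.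
- exact/measurable_EFinP.
rewrite EFinD; apply: leeD => //; rewrite ge0_integralZl//=.
- by rewrite EFinM lee_wpmul2l.
- exact/measurable_EFinP.
- by move=> x _; rewrite lee_fin.
Qed.

(** The factor 2 in the hypotheses comes from (u + v)^2 <= 2 u^2 + 2 v^2. At the end the sum of the
    squares of the three terms is bounded by the square of their sum. *)
Lemma hdot_norm_bound s r (W T S : dist R) (k1 k2 : R * R -> R) (d1 d2 d3 : R) :
  (exists g, is_fourier W g) ->
  in_neg_space s sigma T -> in_neg_space 0 sigma S -> in_neg_space r sigma S ->
  0 <= d1 -> 0 <= d2 -> 0 <= d3 ->
  (forall re, {ae leb2, forall x,
     part re (hat W x) = part re (hat T x) * k1 x + part re (hat S x) * k2 x}) ->
  (forall x, x.1 != 0 -> x.2 != 0 ->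
     2 * (enorm x `^ (2 * s) * k1 x ^+ 2) <= d1 ^+ 2 * sweight sigma s x) ->
  (forall x, x.1 != 0 -> x.2 != 0 ->
     2 * (enorm x `^ (2 * s) * k2 x ^+ 2) <=
     d2 ^+ 2 * sweight sigma 0 x + d3 ^+ 2 * sweight sigma r x) ->
  (hdot_norm s W <= d1%:E * neg_norm s sigma T + d2%:E * neg_norm 0 sigma S +
    d3%:E * neg_norm r sigma S)%E.
Proof.
move=> Wg hT hS hS' d10 d20 d30 ae12 b1 b2.
have [A1 A10 [-> i1]] := neg_norm_integral hT.
have [A2 A20 [-> i2]] := neg_norm_integral hS.
have [A3 A30 [-> i3]] := neg_norm_integral hS'.
have Tg := in_neg_space_fourier hT; have Sg := in_neg_space_fourier hS.
have p1 := mulr_ge0 d10 A10; have p2 := mulr_ge0 d20 A20; have p3 := mulr_ge0 d30 A30.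
rewrite -!EFinM -!EFinD; apply: hdot_norm_le => //; first by rewrite !addr_ge0.
have ge0 c (z : R[i]) (x : R * R) : 0 <= sweight sigma c x * sq_modulus z.
  by rewrite mulr_ge0 ?sweight_ge0 ?sq_modulus_ge0.
have ms c T' : is_fourier T' (hat T') -> pmeas (fun x => sweight sigma c x * sq_modulus (hat T' x)).
  by move=> h; apply: pmeasM; [exact: pmeas_sweight|exact: pmeas_sq_modulus h].
have m3 : pmeas (fun x => d3 ^+ 2 * (sweight sigma r x * sq_modulus (hat S x)) + 0).
  by apply: pmeasD; [apply: pmeasM; [exact: pmeas_cst|exact: ms]|exact: pmeas_cst].
have n3 x : 0 <= d3 ^+ 2 * (sweight sigma r x * sq_modulus (hat S x)) + 0.
  by rewrite addr0 mulr_ge0 ?sqr_ge0.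
have m2 : pmeas (fun x => d2 ^+ 2 * (sweight sigma 0 x * sq_modulus (hat S x)) +
    (d3 ^+ 2 * (sweight sigma r x * sq_modulus (hat S x)) + 0)).
  by apply: pmeasD => //; apply: pmeasM; [exact: pmeas_cst|exact: ms].
have n2 x : 0 <= d2 ^+ 2 * (sweight sigma 0 x * sq_modulus (hat S x)) +
    (d3 ^+ 2 * (sweight sigma r x * sq_modulus (hat S x)) + 0).
  by rewrite addr_ge0// mulr_ge0 ?sqr_ge0.
have i0 : (\int[leb2]_x ((fun=> 0) x : R)%:E <= (0 : R)%:E)%E.
  by rewrite integral0.
have j3 := integral_add (sqr_ge0 d3) (ms r S Sg) (pmeas_cst 0) (fun x => ge0 r _ x) (fun=> lexx 0) i3 i0.
have j2 := integral_add (sqr_ge0 d2) (ms 0 S Sg) m3 (fun x => ge0 0 _ x) n3 i2 j3.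
have j1 := integral_add (sqr_ge0 d1) (ms s T Tg) m2 (fun x => ge0 s _ x) n2 i1 j2.
apply: (@le_trans _ _ (d1 ^+ 2 * A1 ^+ 2 + (d2 ^+ 2 * A2 ^+ 2 + (d3 ^+ 2 * A3 ^+ 2 + 0)))%:E); last first.
  rewrite lee_fin addr0 -!exprMn.
  have := mulr_ge0 p1 p2; have := mulr_ge0 p1 p3; have := mulr_ge0 p2 p3.
  by rewrite !expr2; lra.
apply: le_trans j1; apply: ae_ge0_le_integral => //=.
- by move=> x _; rewrite lee_fin mulr_ge0 ?powR_ge0 ?sq_modulus_ge0.
- apply/measurable_EFinP; apply: pmeasM; first exact: pmeas_powR pmeas_enorm.
  exact: pmeas_sq_modulus (hat_is_fourier Wg).
- by move=> x _; rewrite lee_fin addr_ge0// mulr_ge0 ?sqr_ge0.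
- apply/measurable_EFinP; apply: pmeasD => //.
  by apply: pmeasM; [exact: pmeas_cst|exact: ms].
(* The axes are null sets, so kernel bounds off the axes are enough. *)
have n1 : {ae leb2, forall x : R * R, x.1 != 0}.
  by apply: negligibleS (@leb2_axis1 R) => x /= /negP; rewrite negbK => /eqP.
have n2' : {ae leb2, forall x : R * R, x.2 != 0}.
  by apply: negligibleS (@leb2_axis2 R) => x /= /negP; rewrite negbK => /eqP.
apply: ae_leb2S (ae_leb2I (ae_leb2I n1 n2') (ae_leb2I (ae12 true) (ae12 false))) => x.
move=> [[x1 x2] [er ei]] _.
rewrite lee_fin addr0.
have e w (z1 z2 y1 y2 : R) : 0 <= w -> w * (z1 * y1 + z2 * y2) ^+ 2 <=
    2 * (w * y1 ^+ 2) * z1 ^+ 2 + 2 * (w * y2 ^+ 2) * z2 ^+ 2.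
  move=> w0; have := mulr_ge0 w0 (sqr_ge0 (z1 * y1 - z2 * y2)).
  by rewrite !expr2; lra.
apply: (@le_trans _ _ (2 * (enorm x `^ (2 * s) * k1 x ^+ 2) * sq_modulus (hat T x) +
   2 * (enorm x `^ (2 * s) * k2 x ^+ 2) * sq_modulus (hat S x))).
  rewrite /sq_modulus; move: er ei; rewrite /part => -> ->.
  rewrite mulrDr !mulrDr addrACA.
  by apply: lerD; apply: e; exact: powR_ge0.
apply: lerD; first by rewrite [leRHS]mulrA ler_wpM2r ?sq_modulus_ge0// b1.
by rewrite !(mulrA (_ ^+ 2)) -mulrDl ler_wpM2r ?sq_modulus_ge0// b2.
Qed.

End norms.

(** * Decay of the three components *)

Section components.
Context {R : realType}.
Variables (nu eta s sigma : R).
Hypotheses (nu0 : 0 < nu) (eta0 : 0 < eta) (s0 : 0 <= s) (sigma0 : 0 <= sigma).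
Implicit Types (T S : dist R) (W : R -> dist R).

Lemma solves_fourier W (W0 V0 : dist R) (t : R) : solves nu eta sigma W W0 V0 -> 0 < t ->
  exists g, is_fourier (W t) g.
Proof.
move=> [_ H _ _] t0; have [M hM] := H t (ltW t0).
have Mt : (neg_norm 0 sigma (W t) <= M%:E)%E by apply: hM; rewrite (ltW t0) lexx.
apply: (@aniso_norm_fourier R ax1 0 sigma).
exact: le_lt_trans (le_trans (aniso_le_neg _ _ _) Mt) (ltry _).
Qed.

Lemma decay_of_kernels (W T S : dist R) (k1 k2 : R * R -> R) (r e e' CK CG D t : R) :
  (exists g, is_fourier W g) ->
  in_neg_space s sigma T -> in_neg_space 0 sigma S -> in_neg_space r sigma S ->
  0 <= CK -> 0 <= CG -> CK + 1 <= D -> CG + 1 <= D -> 2 * e' = e - sigma -> 0 < t ->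
  (forall re, {ae leb2, forall x,
     part re (hat W x) = part re (hat T x) * k1 x + part re (hat S x) * k2 x}) ->
  (forall x, x.1 != 0 -> x.2 != 0 ->
     enorm x `^ (2 * s) * k1 x ^+ 2 <= CK * t `^ (- sigma) * sweight sigma s x) ->
  (forall x, x.1 != 0 -> x.2 != 0 ->
     enorm x `^ (2 * s) * k2 x ^+ 2 <=
     CG * t `^ (2 - (s + sigma)) * sweight sigma 0 x + CG * t `^ (e - sigma) * sweight sigma r x) ->
  (hdot_norm s W <= (D * t `^ (- (sigma / 2)))%:E * neg_norm s sigma T +
    (D * t `^ (- ((s + sigma) / 2) + 1))%:E * neg_norm 0 sigma S +
    (D * t `^ e')%:E * neg_norm r sigma S)%E.
Proof.
move=> Wg hT hS hS' K0 G0 KD GD ee t0 hae b1 b2.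
have D0 : 0 <= D by apply: le_trans KD; rewrite addr_ge0.
(* From 2 c <= (c + 1)^2; the condition c + 1 <= D thus turns constants for squares into constants
   for norms without square roots. *)
have dbl c : 0 <= c -> c + 1 <= D -> 2 * c <= D ^+ 2.
  move=> c0 cD; apply: (@le_trans _ _ ((c + 1) ^+ 2)); last by rewrite lerXn2r// nnegrE addr_ge0.
  by have := sqr_ge0 c; rewrite !expr2; lra.
apply: (@hdot_norm_bound R sigma s r W T S k1 k2) => //; rewrite ?mulr_ge0 ?powR_ge0//.
- move=> x x1 x2; rewrite exprMn powR_sqr (_ : 2 * - (sigma / 2) = - sigma); last by field.
  apply: le_trans (ler_wpM2l (ler0n _ 2) (b1 x x1 x2)) _.
  by rewrite !mulrA !ler_wpM2r ?powR_ge0 ?sweight_ge0 ?dbl.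
- move=> x x1 x2; rewrite !exprMn !powR_sqr.
  rewrite (_ : 2 * (- ((s + sigma) / 2) + 1) = 2 - (s + sigma)); last by field.
  rewrite ee.
  apply: le_trans (ler_wpM2l (ler0n _ 2) (b2 x x1 x2)) _.
  by rewrite mulrDr !mulrA; apply: lerD; rewrite !ler_wpM2r ?powR_ge0 ?sweight_ge0 ?dbl.
Qed.

Let rh re T := fun x => part re (hat T x).

Lemma dist_test (Q : box R) T re psi : in_neg_space 0 sigma T -> test Q psi ->
  T (four (phase re) psi) = integ (fun x => rh re T x * psi x).
Proof. by move=> /in_neg_space_fourier Tg; exact: is_fourier_test. Qed.

Lemma intg_hat (Q : box R) T re psi : in_neg_space 0 sigma T -> test Q psi ->
  intg (fun x => rh re T x * psi x).
Proof. by move=> hT /test_bsupp; exact: (integrable_bsupp (rect_int_hat sigma0 Q re hT)). Qed.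

Lemma rect_int_sq (Q : box R) i (c : R) (h : R * R -> R) : rect_int Q h ->
  rect_int Q (fun x => h x * (c * Defs.coord i x ^+ 2)).
Proof.
have [L L0 hL] := @symbol_bound R 1 1 ltr01 ltr01 Q.
move=> hQ; apply: rect_int_mul => //.
  by apply: pmeasM; [exact: pmeas_cst|apply: pmeasX; exact: pmeas_coord].
exists (`|c| * L); first by rewrite mulr_ge0.
move=> x /hL[h1 h2 _]; rewrite normrM ler_wpM2l//.
by move: h1 h2; rewrite /sa /sb !mul1r /Defs.coord; case: ifP.
Qed.

(** On the Fourier side the initial velocity has the form g - b f, with f from u10 and g minus the
    mixed Riesz symbol times the transform of theta0. *)
Lemma decay_u1 : exists2 D, 0 < D & forall (W : R -> dist R) u10 theta0 S12 (t : R),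
  in_neg_space 0 sigma u10 -> in_neg_space s sigma u10 ->
  in_neg_space 0 sigma theta0 -> in_neg_space (s - 1) sigma theta0 ->
  is_multiplier (riesz_symbol ax1 ax2) theta0 S12 ->
  solves nu eta sigma W u10 (fun phi =>
        nu * dist_partial ax2 (dist_partial ax2 u10) phi - S12 phi) -> 0 < t ->
  (hdot_norm s (W t) <= (D * t `^ (- (sigma / 2)))%:E * neg_norm s sigma u10 +
    (D * t `^ (- ((s + sigma) / 2) + 1))%:E * neg_norm 0 sigma theta0 +
    (D * t `^ (- (1 / 2) - sigma / 2))%:E * neg_norm (s - 1) sigma theta0)%E.
Proof.
have [CK CK0 hK] := kernel_K_bound s nu0 eta0 sigma0.
have [CG CG0 hG] := kernel_G_u1 nu0 eta0 s0 sigma0.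
exists (CK + CG + 1); first by rewrite !addr_gt0.
move=> W u10 theta0 S12 t hu hus hth hths mS Wsol t0.
apply: (@decay_of_kernels (W t) u10 theta0
  (fun x => kerK (sa eta x) (sb nu x) (sr x) t)
  (fun x => - (riesz_symbol ax1 ax2 x * kerG (sa eta x) (sb nu x) (sr x) t))
  (s - 1) (- 1) _ CK CG) => //; rewrite ?(ltW CK0) ?(ltW CG0)//.
- exact: solves_fourier Wsol t0.
- by rewrite lerD2r lerDl ltW.
- by rewrite lerD2r lerDr ltW.
- by field.
- move=> re.
  pose f := rh re u10; pose g x := - 1 * (rh re theta0 x * riesz_symbol ax1 ax2 x).
  have hQ Q : rect_int Q (fun x => rh re theta0 x * riesz_symbol ax1 ax2 x).
    exact: (rect_int_riesz ax1 ax2 (rect_int_hat sigma0 Q re hth)).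
  have gQ Q : rect_int Q g.
    have [m1 _] := hQ Q; apply: rect_int_intg; first by apply: pmeasM => //; exact: pmeas_cst.
    have := intgZ (- 1) (integrable_bsupp (hQ Q) (bsupp_indic Q)).
    by congr intg; apply/funext => x /=; rewrite mulrA.
  apply: ae_leb2S (solution_hat nu0 eta0 sigma0 (f := f) (g := g) (re := re) Wsol _ gQ _ _ t0).
  + by move=> x ->; rewrite /wsol /f /g /rh; ring.
  + by move=> Q; exact: (rect_int_hat sigma0 Q re hu).
  + by move=> Q psi tp; exact: (dist_test re hu tp).
  + move=> Q psi tp; rewrite (dist_partial2_test _ _ _ tp).
    rewrite (dist_test re hu (test_sq ax2 tp)).
    rewrite (multiplier_test re mS tp (test_riesz ax1 ax2 tp)).
    rewrite (dist_test re hth (test_riesz ax1 ax2 tp)).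
    have i1 := intg_hat re hu (test_sq ax2 tp); have i2 := intg_hat re hth (test_riesz ax1 ax2 tp).
    rewrite -(integZ nu i1) -(integB (intgZ nu i1) i2); apply: eq_integ => x.
    by rewrite /g /f /sb /Defs.coord/=; ring.
- by move=> x x1 x2; have [] := hK t x t0 x1 x2.
- by move=> x x1 x2; rewrite sqrrN exprMn; exact: hG.
Qed.

Lemma decay_u2 : exists2 D, 0 < D & forall (W : R -> dist R) u20 theta0 S11 (t : R),
  in_neg_space 0 sigma u20 -> in_neg_space s sigma u20 ->
  in_neg_space 0 sigma theta0 -> in_neg_space s sigma theta0 ->
  is_multiplier (riesz_symbol ax1 ax1) theta0 S11 ->
  solves nu eta sigma W u20 (fun phi =>
        nu * dist_partial ax2 (dist_partial ax2 u20) phi + S11 phi) -> 0 < t ->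
  (hdot_norm s (W t) <= (D * t `^ (- (sigma / 2)))%:E * neg_norm s sigma u20 +
    (D * t `^ (- ((s + sigma) / 2) + 1))%:E * neg_norm 0 sigma theta0 +
    (D * t `^ (- 1 - sigma / 2))%:E * neg_norm s sigma theta0)%E.
Proof.
have [CK CK0 hK] := kernel_K_bound s nu0 eta0 sigma0.
have [CG CG0 hG] := kernel_G_u2 nu0 eta0 s0 sigma0.
exists (CK + CG + 1); first by rewrite !addr_gt0.
move=> W u20 theta0 S11 t hu hus hth hths mS Wsol t0.
apply: (@decay_of_kernels (W t) u20 theta0
  (fun x => kerK (sa eta x) (sb nu x) (sr x) t)
  (fun x => sr x * kerG (sa eta x) (sb nu x) (sr x) t)
  s (- 2) _ CK CG) => //; rewrite ?(ltW CK0) ?(ltW CG0)//.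
- exact: solves_fourier Wsol t0.
- by rewrite lerD2r lerDl ltW.
- by rewrite lerD2r lerDr ltW.
- by field.
- move=> re.
  pose f := rh re u20; pose g x := rh re theta0 x * riesz_symbol ax1 ax1 x.
  have gQ Q : rect_int Q g by exact: (rect_int_riesz ax1 ax1 (rect_int_hat sigma0 Q re hth)).
  apply: ae_leb2S (solution_hat nu0 eta0 sigma0 (f := f) (g := g) (re := re) Wsol _ gQ _ _ t0).
  + by move=> x ->; rewrite /wsol /f /g /rh /sr; ring.
  + by move=> Q; exact: (rect_int_hat sigma0 Q re hu).
  + by move=> Q psi tp; exact: (dist_test re hu tp).
  + move=> Q psi tp; rewrite (dist_partial2_test _ _ _ tp).
    rewrite (dist_test re hu (test_sq ax2 tp)).
    rewrite (multiplier_test re mS tp (test_riesz ax1 ax1 tp)).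
    rewrite (dist_test re hth (test_riesz ax1 ax1 tp)).
    have i1 := intg_hat re hu (test_sq ax2 tp); have i2 := intg_hat re hth (test_riesz ax1 ax1 tp).
    rewrite -(integZ nu i1) -(integD (intgZ nu i1) i2); apply: eq_integ => x.
    by rewrite /g /f /sb /Defs.coord/=; ring.
- by move=> x x1 x2; have [] := hK t x t0 x1 x2.
- by move=> x x1 x2; rewrite exprMn; exact: hG.
Qed.

(** The velocity - a f - u20 equals g - b f for g = (b - a) f - u20, and [kerK_sym] then turns f K +
    g G into f times the swapped K minus u20 times G. *)
Lemma decay_theta : exists2 D, 0 < D & forall (W : R -> dist R) u20 theta0 (t : R),
  in_neg_space 0 sigma theta0 -> in_neg_space s sigma theta0 ->
  in_neg_space 0 sigma u20 -> in_neg_space (s - 2) sigma u20 ->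
  solves nu eta sigma W theta0 (fun phi =>
        eta * dist_partial ax1 (dist_partial ax1 theta0) phi - u20 phi) -> 0 < t ->
  (hdot_norm s (W t) <= (D * t `^ (- (sigma / 2)))%:E * neg_norm s sigma theta0 +
    (D * t `^ (- ((s + sigma) / 2) + 1))%:E * neg_norm 0 sigma u20 +
    (D * t `^ (- (sigma / 2)))%:E * neg_norm (s - 2) sigma u20)%E.
Proof.
have [CK CK0 hK] := kernel_K_bound s nu0 eta0 sigma0.
have [CG CG0 hG] := kernel_G_theta nu0 eta0 s0 sigma0.
exists (CK + CG + 1); first by rewrite !addr_gt0.
move=> W u20 theta0 t hth hths hu hus Wsol t0.
apply: (@decay_of_kernels (W t) theta0 u20
  (fun x => kerK (sb nu x) (sa eta x) (sr x) t)
  (fun x => - kerG (sa eta x) (sb nu x) (sr x) t)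
  (s - 2) 0 _ CK CG) => //; rewrite ?(ltW CK0) ?(ltW CG0)//.
- exact: solves_fourier Wsol t0.
- by rewrite lerD2r lerDl ltW.
- by rewrite lerD2r lerDr ltW.
- by field.
- move=> re; pose f := rh re theta0.
  pose g x := f x * (nu * Defs.coord ax2 x ^+ 2) - f x * (eta * Defs.coord ax1 x ^+ 2) - rh re u20 x.
  have fQ Q : rect_int Q f := rect_int_hat sigma0 Q re hth.
  have gQ Q : rect_int Q g.
    apply: rect_intB; last exact: (rect_int_hat sigma0 Q re hu).
    by apply: rect_intB; exact: rect_int_sq.
  apply: ae_leb2S (solution_hat nu0 eta0 sigma0 (f := f) (g := g) (re := re) Wsol fQ gQ _ _ t0).
  + move=> x ->; rewrite /wsol /g /f /rh (kerK_sym (sa eta x)) /Defs.coord/= /sb /sa.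
    by ring.
  + by move=> Q psi tp; exact: (dist_test re hth tp).
  + move=> Q psi tp; rewrite (dist_partial2_test _ _ _ tp).
    rewrite (dist_test re hth (test_sq ax1 tp)) (dist_test re hu tp).
    have i1 := intg_hat re hth (test_sq ax1 tp); have i2 := intg_hat re hu tp.
    rewrite -(integZ eta i1) -(integB (intgZ eta i1) i2); apply: eq_integ => x.
    by rewrite /g /f /sb /Defs.coord/=; ring.
- by move=> x x1 x2; have [] := hK t x t0 x1 x2.
- by move=> x x1 x2; have := hG t x t0 x1 x2; rewrite expr1n mul1r sqrrN.
Qed.

End components.

Lemma neg_norm_ge0 (R : realType) (r sigma : R) (T : dist R) : (0 <= neg_norm r sigma T)%E.
Proof.
by rewrite adde_ge0// /aniso_norm /weighted_norm; case: ifP => // _; exact: poweR_ge0.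
Qed.

Lemma le_coef (R : realType) (D C p : R) (N : \bar R) : D <= C -> 0 <= p -> (0 <= N)%E ->
  ((D * p)%:E * N <= (C * p)%:E * N)%E.
Proof. by move=> DC p0 N0; rewrite lee_wpmul2r// lee_fin ler_wpM2r. Qed.

Unset Implicit Arguments.

Theorem theorem1p1 (R : realType) (nu eta s sigma : R)
    (nu_gt0 : 0 < nu) (eta_gt0 : 0 < eta)
    (s_ge0 : 0 <= s) (sigma_ge0 : 0 <= sigma) (s_sigma : 2 <= s + sigma) :
  exists2 C : R, 0 < C &
  forall (u10 u20 theta0 : dist R) (u1 u2 theta : R -> dist R),
    divergence_free u10 u20 ->
    [/\ in_neg_space 0 sigma u10, in_neg_space s sigma u10
      & in_neg_space (s - 2) sigma u10] ->
    [/\ in_neg_space 0 sigma u20, in_neg_space s sigma u20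
      & in_neg_space (s - 2) sigma u20] ->
    [/\ in_neg_space 0 sigma theta0, in_neg_space s sigma theta0
      & in_neg_space (s - 1) sigma theta0] ->
    linearized_solution nu eta sigma u1 u2 theta u10 u20 theta0 ->
    forall t : R, 0 < t ->
    [/\ (hdot_norm s (u1 t) <=
           (C * t `^ (- ((s + sigma) / 2)))%:E * neg_norm 0 sigma u10
         + (C * t `^ (- (sigma / 2)))%:E * neg_norm s sigma u10
         + (C * t `^ (- ((s + sigma) / 2) + 1))%:E * neg_norm 0 sigma theta0
         + (C * t `^ (- (1 / 2) - sigma / 2))%:E
             * neg_norm (s - 1) sigma theta0)%E,
        (hdot_norm s (u2 t) <=
           (C * t `^ (- ((s + sigma) / 2)))%:E * neg_norm 0 sigma u20
         + (C * t `^ (- (sigma / 2)))%:E * neg_norm s sigma u20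
         + (C * t `^ (- ((s + sigma) / 2) + 1))%:E * neg_norm 0 sigma theta0
         + (C * t `^ (- 1 - sigma / 2))%:E * neg_norm s sigma theta0)%E
      & (hdot_norm s (theta t) <=
           (C * t `^ (- ((s + sigma) / 2) + 1))%:E * neg_norm 0 sigma u20
         + (C * t `^ (- (sigma / 2)))%:E * neg_norm (s - 2) sigma u20
         + (C * t `^ (- ((s + sigma) / 2)))%:E * neg_norm 0 sigma theta0
         + (C * t `^ (- (sigma / 2)))%:E * neg_norm s sigma theta0)%E].
Proof.
have [D1 D10 h1] := decay_u1 nu_gt0 eta_gt0 s_ge0 sigma_ge0.
have [D2 D20 h2] := decay_u2 nu_gt0 eta_gt0 s_ge0 sigma_ge0.
have [D3 D30 h3] := decay_theta nu_gt0 eta_gt0 s_ge0 sigma_ge0.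
exists (D1 + D2 + D3); first by rewrite !addr_gt0.
move=> u10 u20 theta0 u1 u2 theta _ [a0 as_ _] [b0 bs bs2] [c0 cs cs1].
move=> [S12 [S11 [mS12 mS11 sol1 sol2 sol3]]] t t0.
have le1 : D1 <= D1 + D2 + D3 by rewrite -addrA lerDl addr_ge0 ?ltW.
have le2 : D2 <= D1 + D2 + D3 by rewrite addrAC lerDr addr_ge0 ?ltW.
have le3 : D3 <= D1 + D2 + D3 by rewrite lerDr addr_ge0 ?ltW.
have C0 : 0 <= D1 + D2 + D3 by rewrite !addr_ge0 ?ltW.
(* The kernel estimates produce three terms for each component; the fourth term of the claim is
   nonnegative and is added here. *)
have extra e (T : dist R) : (0 <= ((D1 + D2 + D3) * t `^ e)%:E * neg_norm 0 sigma T)%E.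
  by rewrite mule_ge0 ?neg_norm_ge0// lee_fin mulr_ge0 ?powR_ge0.
split.
- apply: (le_trans (h1 _ _ _ _ t a0 as_ c0 cs1 mS12 sol1 t0)).
  rewrite -[leRHS]addeA -[leRHS]addeA; apply: le_trans (leeDr _ (extra _ _)).
  by rewrite addeA !leeD// le_coef ?powR_ge0 ?neg_norm_ge0.
- apply: (le_trans (h2 _ _ _ _ t b0 bs c0 cs mS11 sol2 t0)).
  rewrite -[leRHS]addeA -[leRHS]addeA; apply: le_trans (leeDr _ (extra _ _)).
  by rewrite addeA !leeD// le_coef ?powR_ge0 ?neg_norm_ge0.
- apply: (le_trans (h3 _ _ _ t c0 cs b0 bs2 sol3 t0)).
  (* For theta the added term is the third summand, so the last one is moved to the front to leave
     it at the end. *)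
  rewrite [leRHS]addeC [leRHS]addeA; apply: le_trans (leeDl _ (extra _ _)).
  by rewrite addeA !leeD// le_coef ?powR_ge0 ?neg_norm_ge0.
Qed.
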